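(* Let $n\ge2$. For any relatively extremal knot $\gamma:\mathbf{S}^1\to\mathbf{R}^n$ with image $K=\gamma(\mathbf{S}^1)$ whose curvature $\kappa\gamma$ is not identically $R_O(K)^{-1}$, the thickness of $\gamma$ is $\frac12MDC(\gamma(\mathbf{S}^1))$, i.e. $i(K,\mathbf{R}^n)=\frac12MDC(K)$. Equivalently, if $\gamma$ is a relatively extremal knot such that $\frac12MDC(K)>R_O(K)=F_k(\gamma)$, then $\gamma$ must have constant generalized curvature, $\kappa\gamma\equiv F_k(\gamma)^{-1}$.
   Context: A simple $C^{1,1}$ closed curve is an injective $C^1$ map $\gamma:\mathbf{S}^1\cong\mathbf{R}/L\mathbf{Z}\to\mathbf{R}^n$ with Lipschitz derivative and $\gamma'\ne0$. Put $K=\gamma(\mathbf{S}^1)$. $C^{1,1}$ also denotes the set of such curves. Curvature: $\kappa\gamma(s)=\limsup_{t\ne u,\;t,u\to s}\frac{\measuredangle(\gamma'(t),\gamma'(u))}{\ell_{tu}(\gamma)}$, where $\ell_{tu}(\gamma)$ is the length of $\gamma$ between nearby parameters $t$ and $u$. Analytic focal distance: $F_k(\gamma)=(\sup_s\kappa\gamma(s))^{-1}$. Thickness (normal injectivity radius): with $NK=\{(x,z):x=\gamma(s)\text{ for some }s,\ z\cdot\gamma'(s)=0\}$ and $\exp^N(x,z)=x+z$, $i(K,\mathbf{R}^n)=\sup(\{0\}\cup\{r>0:\exp^N\text{ is one-to-one on }\{(x,z)\in NK:\|z\|<r\}\})$. Ball radius: for $x\in K$, $r>0$ and $u$ a unit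 tangent vector to $K$ at $x$, let $O_x(r;K)=\{y\in\mathbf{R}^n:\exists z,\ u\cdot z=0,\ \|z\|=1,\ \|y-x-rz\|<r\}$, $O(r;K)=\bigcup_{x\in K}O_x(r;K)$, and $R_O(\gamma)=R_O(K)=\inf\{r>0:O(r;K)\cap K\ne\emptyset\}$. A pair of distinct points $x,y\in K$ is a double critical pair if the line segment joining $x$ and $y$ is normal to $K$ at both $x$ and $y$. $MDC(K)=\inf\{\|x-y\|:\{x,y\}\text{ is a double critical pair for }K\}$. Ropelength: $\ell_e(\gamma)=\ell(\gamma)/R_O(\gamma)$, where $\ell(\gamma)$ is the length. A knot class $[\theta]$ is a free $C^0$-homotopy class of embeddings $\mathbf{S}^1\to\mathbf{R}^n$ (homotopy through embeddings). A simple $C^{1,1}$ closed curve $\gamma_0$ with knot class $[\theta]$ is called relatively extremal (a relatively extremal knot) if there is an open set $\mathcal{U}$ in the $C^1$ topology with $\gamma_0\in\mathcal{U}$ and $\ell_e(\gamma_0)\le\ell_e(\gamma)$ for all $\gamma\in\mathcal{U}\cap[\theta]\cap C^{1,1}$. *)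

(* Defs.v *)
From HB Require Import structures.
From mathcomp Require Import all_boot all_order all_algebra.
From mathcomp Require Import all_classical all_reals all_analysis.

Set Implicit Arguments.
Unset Strict Implicit.
Unset Printing Implicit Defensive.

Import Order.TTheory GRing.Theory Num.Theory.
Import numFieldNormedType.Exports.

Local Open Scope classical_set_scope.
Local Open Scope ring_scope.

Section EuclideanSpace.
Context {R : realType} {n : nat}.
Implicit Types u v : 'rV[R]_n.

Definition dot u v : R := \sum_(i < n) u ord0 i * v ord0 i.

(* The library norm on 'rV[R]_n is the sup norm, which induces the same
   topology and the same Lipschitz maps; lengths and distances use enorm. *)
Definition enorm u : R := Num.sqrt (dot u u).

Definition angle u v : R := acos (dot u v / (enorm u * enorm v)).

End EuclideanSpace.

(* A map S^1 = R/LZ -> R^n is represented by its L-periodic lift R -> R^n. *)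
Section ClosedCurves.
Context {R : realType} {n : nat}.
Notation V := 'rV[R]_n.
Implicit Types (L : R) (g f : R -> V).

Definition injective_mod L g : Prop :=
  forall s t, g s = g t -> exists k : int, s = t + k%:~R * L.

(* S^1 is compact, so an injective continuous map is an embedding. *)
Definition embedding L g : Prop :=
  [/\ periodic g L, continuous g & injective_mod L g].

Definition C1_loop L g : Prop :=
  [/\ periodic g L, forall s : R, derivable g s 1 & continuous (derive1 g)].

Definition simple_C11 L g : Prop :=
  [/\ C1_loop L g, injective_mod L g, forall s, derive1 g s != 0
    & [lipschitz (derive1 g s) | s in setT]].

(* Open sets for the C^1 topology on the space of C^1 maps R/LZ -> R^n. *)
Definition C1_open L (U : set (R -> V)) : Prop :=
  U `<=` C1_loop L /\
  forall f, U f -> exists2 e : R, 0 < e &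
    forall g, C1_loop L g ->
      (forall s, enorm (g s - f s) < e /\
                 enorm (derive1 g s - derive1 f s) < e) ->
      U g.

(* Free C^0 homotopy class of f, through embeddings. *)
Definition knot_class L f : set (R -> V) :=
  [set g | exists H : R -> R -> V,
    [/\ {within `[0, 1] `*` setT, continuous (fun p : R * R => H p.1 p.2)},
        forall t : R, 0 <= t <= 1 -> embedding L (H t),
        H 0 = f & H 1 = g]].

(* Integral of the speed over the interval with endpoints a and b, in either
   order. *)
Definition arc_length g (a b : R) : R :=
  \int[lebesgue_measure]_(x in `[Num.min a b, Num.max a b]) enorm (derive1 g x).

Definition loop_length L g : R := arc_length g 0 L.

Definition curvature g (s : R) : \bar R :=
  limf_esup
    (fun p : R * R =>
       (angle (derive1 g p.1) (derive1 g p.2) / arc_length g p.1 p.2)%:E)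
    (within [set p : R * R | p.1 != p.2] (nbhs (s, s))).

Definition focal_distance g : \bar R :=
  ((ereal_sup (range (curvature g)))^-1)%E.

Definition normal_bundle g : set (V * V) :=
  [set p | exists s, p.1 = g s /\ dot p.2 (derive1 g s) = 0].

Definition normal_exp (p : V * V) : V := p.1 + p.2.

Definition thickness g : \bar R :=
  ereal_sup ([set 0%E] `|`
    [set r%:E | r in [set r : R | 0 < r /\
       set_inj (normal_bundle g `&` [set p | enorm p.2 < r]) normal_exp]]).

Definition unit_tangent g (x u : V) : Prop :=
  enorm u = 1 /\ exists s, x = g s /\ exists c : R, u = c *: derive1 g s.

Definition tangent_balls_at g (x : V) (r : R) : set V :=
  [set y | exists u z : V, [/\ unit_tangent g x u, dot u z = 0, enorm z = 1
                             & enorm (y - x - r *: z) < r]].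

Definition tangent_balls g (r : R) : set V :=
  \bigcup_(x in range g) tangent_balls_at g x r.

Definition ball_radius g : \bar R :=
  ereal_inf [set r%:E | r in
    [set r : R | 0 < r /\ tangent_balls g r `&` range g !=set0]].

Definition double_critical g (x y : V) : Prop :=
  x != y /\ exists s t, [/\ x = g s, y = g t,
    dot (x - y) (derive1 g s) = 0 & dot (x - y) (derive1 g t) = 0].

Definition MDC g : \bar R :=
  ereal_inf [set (enorm (p.1 - p.2))%:E | p in
    [set p : V * V | double_critical g p.1 p.2]].

Definition ropelength L g : \bar R :=
  ((loop_length L g)%:E / ball_radius g)%E.

Definition relatively_extremal L g0 : Prop :=
  simple_C11 L g0 /\
  exists U : set (R -> V), [/\ C1_open L U, U g0 &
    forall g, (U `&` knot_class L g0 `&` simple_C11 L) g ->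
      (ropelength L g0 <= ropelength L g)%E].

End ClosedCurves.

(* Main.v *)
Require Import Defs.
From mathcomp Require Import all_boot all_order all_algebra.
From mathcomp Require Import all_classical all_reals all_analysis.
From mathcomp Require Import zify ring lra.

Set Implicit Arguments.
Unset Strict Implicit.
Unset Printing Implicit Defensive.

Import Order.TTheory GRing.Theory Num.Theory.
Import numFieldNormedType.Exports.

Local Open Scope classical_set_scope.
Local Open Scope ring_scope.

(** Scale the knot so that the largest curvature becomes 1 and follow it at unit
    speed: the tangent [T] is then 1-Lipschitz.

    The first ingredient compares tangent balls with curvature and double
    critical pairs. An arc of length at most [pi] and curvature at most 1 stays
    out of the unit balls tangent to it at its endpoints ([arc_ball]). Two
    points farther apart along the curve at distance less than 2 could be moved
    to a closest such pair, which would be double critical ([far_pairs]). Hence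
    a closed curve whose curvature is at most 1 and whose double critical pairs
    are at distance at least 2 avoids its tangent unit balls ([ball_sep]).
    Conversely, empty tangent balls of radius [r] bound the curvature by [r^-1]
    ([ball_curvature]) and make normals of length less than [r] disjoint
    ([ball_free_thickness]), whereas the normals at a double critical pair meet
    halfway ([thickness_le_MDC]). It follows that the thickness is half of [MDC]
    when that half is at most the focal distance, and that otherwise ball
    radius and focal distance agree. The first assertion thus reduces to the
    second one.

    For the second assertion, the distances of double critical pairs leave
    room, and this condition is open in the C^1 topology ([nearby_curve]). Near
    the knot, extremality therefore concerns the product of length and maximal
    curvature only ([no_gain], [extremal_no_gain]). Suppose that the curvature
    is less than 1 along some arc. That arc is straight: otherwise turning its
    tangents towards their mean direction shortens the curve, using the
    curvature that is available ([slack_straight]). Let [e] be its direction. A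
    straight arc can absorb the failure of any variation of the remaining curve
    to close up, so that the first variation of the product of length and
    curvature is nonnegative in all directions ([cost_ge]). As [T] is merely
    Lipschitz, the variations start from averages of [T] over intervals of
    length quadratic in the step. The result is an Euler-Lagrange equation,
    [(1 - c) T' = Q] with [c = dot e T] and [Q' = - (e + (1 - 2 * c) T)]
    ([vder_T], [vder_Q]). Its first integrals [|Q| = 1 - c] and
    [(dot e Q)^2 = (1 - c)^2 (1 - c^2)] ([Q_norm], [k_sq]) show that the curve
    is an arc of a unit circle wherever [T <> e] ([vder_nvec]). The circular arc
    that follows the straight one begins and ends with the tangent [e], hence
    at the same point, and the curve is not simple ([straight_false],
    [no_slack]). *)

(** * Euclidean geometry of row vectors *)

Section Dot.
Context {R : realType} {n : nat}.
Notation V := 'rV[R]_n.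
Implicit Types u v w : V.

Lemma dotC u v : dot u v = dot v u.
Proof. by apply: eq_bigr => i _; rewrite mulrC. Qed.

Lemma dotDl u v w : dot (u + v) w = dot u w + dot v w.
Proof. by rewrite -big_split; apply: eq_bigr => i _; rewrite mxE mulrDl. Qed.

Lemma dotZl (a : R) u v : dot (a *: u) v = a * dot u v.
Proof. by rewrite mulr_sumr; apply: eq_bigr => i _; rewrite mxE mulrA. Qed.

Lemma dotNl u v : dot (- u) v = - dot u v.
Proof. by rewrite -scaleN1r dotZl mulN1r. Qed.

Lemma dotBl u v w : dot (u - v) w = dot u w - dot v w.
Proof. by rewrite dotDl dotNl. Qed.

Lemma dotDr u v w : dot u (v + w) = dot u v + dot u w.
Proof. by rewrite dotC dotDl !(dotC _ u). Qed.

Lemma dotZr (a : R) u v : dot u (a *: v) = a * dot u v.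
Proof. by rewrite dotC dotZl dotC. Qed.

Lemma dotNr u v : dot u (- v) = - dot u v.
Proof. by rewrite dotC dotNl dotC. Qed.

Lemma dotBr u v w : dot u (v - w) = dot u v - dot u w.
Proof. by rewrite dotDr dotNr. Qed.

Lemma dot0l u : dot 0 u = 0.
Proof. by rewrite -(scale0r 0) dotZl mul0r. Qed.

Lemma dot0r u : dot u 0 = 0.
Proof. by rewrite dotC dot0l. Qed.

Definition dotE := (dotDl, dotDr, dotBl, dotBr, dotZl, dotZr, dotNl, dotNr,
  dot0l, dot0r).

Lemma dot_delta u (i : 'I_n) : dot u (delta_mx ord0 i) = u ord0 i.
Proof.
rewrite /dot (bigD1 i) //= mxE !eqxx mulr1 big1 ?addr0 // => j ji.
by rewrite mxE (negPf ji) andbF mulr0.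
Qed.

Lemma dot_eqP u v : (forall b, dot u b = dot v b) -> u = v.
Proof. by move=> uv; apply/rowP => i; rewrite -!dot_delta. Qed.

Lemma dot_ge0 u : 0 <= dot u u.
Proof. by apply: sumr_ge0 => i _; rewrite -expr2 sqr_ge0. Qed.

Lemma enorm_ge0 u : 0 <= enorm u. Proof. exact: sqrtr_ge0. Qed.

Lemma enorm_sq u : enorm u ^+ 2 = dot u u.
Proof. by rewrite sqr_sqrtr ?dot_ge0. Qed.

Lemma enormM u : enorm u * enorm u = dot u u.
Proof. by rewrite -expr2 enorm_sq. Qed.

Lemma dot_eq0 u : dot u u = 0 -> u = 0.
Proof.
move=> /eqP; rewrite psumr_eq0; last by move=> i _; rewrite -expr2 sqr_ge0.
move=> /allP u0; apply/rowP => i; rewrite mxE.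
by have := u0 i (mem_index_enum _); rewrite /= mulf_eq0 orbb => /eqP.
Qed.

Lemma enorm0 : enorm (0 : V) = 0.
Proof. by rewrite /enorm dot0l sqrtr0. Qed.

Lemma enorm_eq0 u : enorm u = 0 -> u = 0.
Proof. by move=> u0; apply: dot_eq0; rewrite -enormM u0 mulr0. Qed.

Lemma enorm_gt0 u : u != 0 -> 0 < enorm u.
Proof.
by move=> u0; rewrite lt_neqAle enorm_ge0 andbT eq_sym; apply: contra_neq u0 => /enorm_eq0.
Qed.

Lemma dot_cauchy u v : dot u v ^+ 2 <= dot u u * dot v v.
Proof.
have [->|v0] := eqVneq v 0; first by rewrite !dot0r expr0n mulr0.
have vv : 0 < dot v v.
  by rewrite lt_neqAle dot_ge0 andbT eq_sym; apply: contra_neq v0 => /dot_eq0.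
have := dot_ge0 (dot v v *: u - dot u v *: v).
rewrite !dotE (dotC v u); set x := dot u v; set a := dot u u; set b := dot v v.
move=> H; have : 0 <= b * (a * b - x ^+ 2) by apply: le_trans H _; rewrite le_eqVlt; apply/orP; left; apply/eqP; ring.
by rewrite pmulr_rge0 // subr_ge0.
Qed.

Lemma dot_le u v : dot u v <= enorm u * enorm v.
Proof.
apply: le_trans (ler_norm _) _; rewrite -(@ler_pXn2r _ 2) ?nnegrE ?mulr_ge0 ?enorm_ge0 //.
by rewrite exprMn !enorm_sq real_normK ?num_real // dot_cauchy.
Qed.

Lemma dot_ler_norm u v : `|dot u v| <= enorm u * enorm v.
Proof.
rewrite ler_norml dot_le andbT lerNl -dotNl (le_trans (dot_le _ _)) //.
by rewrite /enorm dotNl dotNr opprK.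
Qed.

Lemma enormN u : enorm (- u) = enorm u.
Proof. by rewrite /enorm dotNl dotNr opprK. Qed.

Lemma enormB u v : enorm (u - v) = enorm (v - u).
Proof. by rewrite -enormN opprB. Qed.

Lemma enormZ (a : R) u : enorm (a *: u) = `|a| * enorm u.
Proof. by rewrite /enorm dotZl dotZr mulrA -expr2 sqrtrM ?sqr_ge0 // sqrtr_sqr. Qed.

Lemma enormD u v : enorm (u + v) <= enorm u + enorm v.
Proof.
rewrite -(@ler_pXn2r _ 2) ?nnegrE ?addr_ge0 ?enorm_ge0 //.
rewrite enorm_sq !dotE sqrrD !enorm_sq (dotC v u).
have := dot_le u v; lra.
Qed.

Lemma enormBD u v : enorm (u - v) <= enorm u + enorm v.
Proof. by rewrite -(enormN v) enormD. Qed.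

Lemma enorm_tri w u v : enorm (u - v) <= enorm (u - w) + enorm (w - v).
Proof. by rewrite -[u - v](_ : (u - w) + (w - v) = _) ?enormD // addrA subrK. Qed.

Lemma enorm_sub_ge u v : enorm u - enorm v <= enorm (u - v).
Proof. by rewrite lerBlDr -{1}(subrK v u) enormD. Qed.

Lemma enorm_le_dot u (a : R) : 0 <= a -> dot u u <= a ^+ 2 -> enorm u <= a.
Proof.
by move=> a0; rewrite -enorm_sq; rewrite ler_pXn2r // nnegrE ?enorm_ge0.
Qed.

(** Testing against unit vectors computes the norm; this turns estimates of
    vector-valued functions into scalar ones. *)
Lemma enorm_le_test u (a : R) : 0 <= a ->
  (forall b, enorm b = 1 -> dot u b <= a) -> enorm u <= a.
Proof.
move=> a0 H; have [->|u0] := eqVneq u 0; first by rewrite enorm0.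
have ug := enorm_gt0 u0.
have := H ((enorm u)^-1 *: u); rewrite enormZ gtr0_norm ?invr_gt0 //.
rewrite mulVf ?gt_eqF // dotZr -enormM mulrA mulVf ?gt_eqF // mul1r.
exact.
Qed.

Lemma norm_le_enorm u : `|u| <= enorm u.
Proof.
rewrite /Num.Def.normr/= mx_normrE bigmax_le ?enorm_ge0 // => -[i j] _ /=.
rewrite (ord1 i) -dot_delta; apply: le_trans (dot_ler_norm _ _) _.
suff -> : enorm (delta_mx ord0 j : V) = 1 by rewrite mulr1.
by rewrite /enorm dot_delta mxE !eqxx sqrtr1.
Qed.

Lemma enorm_le_norm u : enorm u <= n%:R * `|u|.
Proof.
apply: enorm_le_dot; first by rewrite mulr_ge0.
apply: (@le_trans _ _ (\sum_(i < n) `|u| ^+ 2)).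
  apply: ler_sum => i _; rewrite -expr2 -[leLHS]real_normK ?num_real //.
  rewrite ler_pXn2r ?nnegrE //.
  rewrite [leRHS]/Num.Def.normr/= mx_normrE.
  exact: (le_bigmax _ (fun ij : 'I_1 * 'I_n => `|u ij.1 ij.2|) (ord0, i)).
rewrite sumr_const card_ord -[_ *+ n]mulr_natl exprMn ler_wpM2r ?sqr_ge0 //.
by rewrite -natrX ler_nat; case: n => // m; rewrite -{1}[m.+1]expn1 leq_pexp2l.
Qed.

Definition unitv u : V := (enorm u)^-1 *: u.

Lemma enorm_unitv u : u != 0 -> enorm (unitv u) = 1.
Proof.
move=> u0; rewrite /unitv enormZ gtr0_norm ?invr_gt0 ?enorm_gt0 //.
by rewrite mulVf // gt_eqF // enorm_gt0.
Qed.

Lemma unitvZ (a : R) u : 0 < a -> unitv (a *: u) = unitv u.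
Proof.
move=> a0; rewrite /unitv enormZ gtr0_norm // scalerA invfM mulrAC mulVf ?mul1r //.
by rewrite gt_eqF.
Qed.

Lemma unitvE u : u != 0 -> u = enorm u *: unitv u.
Proof.
by move=> u0; rewrite /unitv scalerA mulfV ?scale1r // gt_eqF // enorm_gt0.
Qed.

(** The radial projection satisfies the exact identity
    [|u/|u| - v/|v||^2 |u||v| = |u - v|^2 - (|u| - |v|)^2]. *)
Lemma unitv_dist u v : u != 0 -> v != 0 ->
  enorm (unitv u - unitv v) ^+ 2 * (enorm u * enorm v) <= enorm (u - v) ^+ 2.
Proof.
move=> u0 v0; have ug := enorm_gt0 u0; have vg := enorm_gt0 v0.
apply: (@le_trans _ _ (2 * (enorm u * enorm v) - 2 * dot u v)).
  rewrite le_eqVlt; apply/orP; left; apply/eqP.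
  rewrite enorm_sq /unitv !dotE (dotC v u) -!enormM.
  by field; rewrite !gt_eqF.
rewrite enorm_sq !dotE (dotC v u) -!enormM.
have := sqr_ge0 (enorm u - enorm v); lra.
Qed.

End Dot.

(** * Derivatives and oriented integrals of real functions *)

Section Calculus.
Context {R : realType}.
Implicit Types (f g : R -> R) (x y a b l m : R).

Lemma der_cont f x l : is_derive x 1 f l -> {for x, continuous f}.
Proof. by move=> [df _]; apply/differentiable_continuous/derivable1_diffP. Qed.

Lemma der_eq f x l m : is_derive x 1 f l -> l = m -> is_derive x 1 f m.
Proof. by move=> H <-. Qed.

Lemma der_cst c x : is_derive x 1 (fun _ : R => c : R) 0.
Proof. exact: is_derive_cst. Qed.

Lemma der_id x : is_derive x 1 (fun t : R => t) 1.
Proof. exact: is_derive_id. Qed.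

Lemma derD f g x l m : is_derive x 1 f l -> is_derive x 1 g m ->
  is_derive x 1 (fun t => f t + g t) (l + m).
Proof. exact: is_deriveD. Qed.

Lemma derN f x l : is_derive x 1 f l -> is_derive x 1 (fun t => - f t) (- l).
Proof. exact: is_deriveN. Qed.

Lemma derB f g x l m : is_derive x 1 f l -> is_derive x 1 g m ->
  is_derive x 1 (fun t => f t - g t) (l - m).
Proof. exact: is_deriveB. Qed.

Lemma derM f g x l m : is_derive x 1 f l -> is_derive x 1 g m ->
  is_derive x 1 (fun t => f t * g t) (l * g x + f x * m).
Proof.
move=> df dg; apply: (der_eq (is_deriveM df dg)).
by rewrite addrC; congr (_ + _); exact: mulrC.
Qed.

Lemma derZ c f x l : is_derive x 1 f l -> is_derive x 1 (fun t => c * f t) (c * l).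
Proof. by move=> df; apply: (der_eq (derM (der_cst c x) df)); rewrite mul0r add0r. Qed.

Lemma der_comp f g x l m : is_derive (g x) 1 f l -> is_derive x 1 g m ->
  is_derive x 1 (fun t => f (g t)) (l * m).
Proof. exact: is_derive1_comp. Qed.

Lemma der_sum (I : finType) (F : I -> R -> R) (l : I -> R) x :
  (forall i, is_derive x 1 (F i) (l i)) ->
  is_derive x 1 (fun t => \sum_i F i t) (\sum_i l i).
Proof.
move=> H; rewrite (_ : (fun t => _) = \sum_i F i); last first.
  by apply/funext => t; rewrite fct_sumE.
by elim/big_ind2 : _ => // [|] *; [exact: is_derive_cst|exact: is_deriveD].
Qed.

Lemma derV f x l : f x != 0 -> is_derive x 1 f l ->
  is_derive x 1 (fun t => (f t)^-1) (- l / f x ^+ 2).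
Proof.
move=> fx0 df; apply: (der_eq (is_deriveV fx0 df)).
by rewrite -[LHS]/(- (f x) ^- 2 * l) mulrC mulrN mulNr.
Qed.

Lemma der_unique f x l m : is_derive x 1 f l -> is_derive x 1 f m -> l = m.
Proof. by move=> [_ <-] [_ <-]. Qed.

Lemma der_near f g x l : (exists2 e, 0 < e & forall t, `|t - x| < e -> f t = g t) ->
  is_derive x 1 f l -> is_derive x 1 g l.
Proof.
move=> [e e0 fg]; apply: near_eq_is_derive.
by exists e => //= t; rewrite /ball /= distrC => /fg.
Qed.

Lemma der_edP f x l : is_derive x 1 f l <->
  (forall e, 0 < e -> exists2 d, 0 < d & forall t, `|t - x| < d ->
     `|f t - f x - l * (t - x)| <= e * `|t - x|).
Proof.
pose q h := h^-1 *: ((f \o shift x) (h *: (1 : R)) - f x).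
have qE h : h != 0 -> l - q h = - h^-1 * (f (h + x) - f x - l * h).
  move=> h0; have -> : q h = h^-1 * (f (h + x) - f x).
    by rewrite /q /= [h *: _]mulr1.
  by rewrite mulNr [in RHS]mulrBr [h^-1 * (l * h)]mulrCA mulVf // mulr1 opprB.
split=> [[df dE] e e0|H].
  have : q h @[h --> 0^'] --> l by rewrite -dE; exact: df.
  move=> /cvgrPdist_le/(_ e e0)[d /= d0 Hd]; exists d => // t tx.
  have [->|tnx] := eqVneq t x; first by rewrite !subrr mulr0 subr0 normr0 mulr0.
  have t0 : t - x != 0 by rewrite subr_eq0.
  have := Hd (t - x); rewrite /ball /= sub0r normrN => /(_ tx t0).
  rewrite qE // subrK normrM normrN normfV ler_pdivrMl ?normr_gt0 //.
  by rewrite [_ * e]mulrC.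
have C : q h @[h --> 0^'] --> l.
  apply/cvgrPdist_le => e e0; have [d d0 Hd] := H e e0.
  exists d => //= h; rewrite /ball /= sub0r normrN => hd h0.
  rewrite qE // normrM normrN normfV ler_pdivrMl ?normr_gt0 // [_ * e]mulrC.
  by have := Hd (h + x); rewrite addrK; exact.
by apply: DeriveDef; [apply/cvg_ex; exists l|exact: cvg_lim].
Qed.

Lemma der_nondecr f (df : R -> R) a b :
  a <= b -> (forall x, a <= x <= b -> {for x, continuous f}) ->
  (forall x, a < x < b -> is_derive x 1 f (df x)) ->
  (forall x, a < x < b -> 0 <= df x) -> f a <= f b.
Proof.
move=> ab cf Hd Hp; have [->//|nab] := eqVneq a b.
have ltab : a < b by rewrite lt_neqAle nab.
have D x : x \in `]a, b[ -> is_derive x 1 f (df x) by rewrite in_itv /= => /Hd.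
have C : {within `[a, b], continuous f}.
  by apply: continuous_in_subspaceT => x; rewrite inE /= in_itv /=; exact: cf.
have [c cab E] := MVT ltab D C.
by rewrite -subr_ge0 E mulr_ge0 ?subr_ge0 // Hp //; move: cab; rewrite in_itv.
Qed.

Lemma der_le f g (df dg : R -> R) a b : a <= b ->
  (forall x, a <= x <= b -> is_derive x 1 f (df x)) ->
  (forall x, a <= x <= b -> is_derive x 1 g (dg x)) ->
  (forall x, a <= x <= b -> df x <= dg x) -> f b - f a <= g b - g a.
Proof.
move=> ab Hf Hg Hle.
have := @der_nondecr (fun t => g t - f t) (fun t => dg t - df t) a b ab.
have W x : a < x < b -> a <= x <= b by move=> /andP[/ltW -> /ltW ->].
move=> H; have : g a - f a <= g b - f b; last lra.
apply: H => x xab; first exact: der_cont (derB (Hg x xab) (Hf x xab)).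
- exact: derB (Hg x (W x xab)) (Hf x (W x xab)).
- by rewrite subr_ge0; exact/Hle/W.
Qed.

Lemma der_eq_incr f g (df : R -> R) a b :
  (forall x, is_derive x 1 f (df x)) -> (forall x, is_derive x 1 g (df x)) ->
  f b - f a = g b - g a.
Proof.
move=> Hf Hg; wlog ab : a b / a <= b.
  move=> H; have [/H//|/ltW /H E] := leP a b.
  by apply: oppr_inj; rewrite !opprB.
by apply/eqP; rewrite eq_le !(@der_le _ _ df df).
Qed.

Lemma der0_const f a b : (forall x, is_derive x 1 f 0) -> f a = f b.
Proof.
move=> H; have := @der_eq_incr f (fun=> 0) (fun=> 0) b a H (fun x => der_cst 0 x).
by rewrite subrr => /eqP; rewrite subr_eq0 => /eqP.
Qed.

(** The integrals starting at [- N] and at [- M] differ by a constant wherever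
    both are primitives, so that primitives on bounded intervals can be glued. *)
Lemma prim_exists f : continuous f -> exists F : R -> R, forall x, is_derive x 1 F (f x).
Proof.
move=> cf.
pose mu := @lebesgue_measure R.
have intf (a b : R) : mu.-integrable `[a, b] (EFin \o f).
  apply: continuous_compact_integrable; first exact: segment_compact.
  exact: continuous_subspaceT.
pose G (N x : R) := (\int[mu]_(t in [set` `[- N, x]]) (f t))%R.
have dG N x : - N < x -> is_derive x 1 (G N) (f x).
  move=> Nx; have xu : x < x + 1 by rewrite ltrDl.
  have [dv E] := continuous_FTC1_closed xu (intf (- N) (x + 1)) Nx (cf x).
  exact: (DeriveDef dv (etrans (esym (derive1E (G N) x)) E)).
have EG N M x : `|x| < N -> `|x| < M -> 
  G N x - G N 0 = G M x - G M 0.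
  move=> xN xM.
  have N0 : 0 < N by exact: le_lt_trans xN.
  have M0 : 0 < M by exact: le_lt_trans xM.
  move: xN xM; rewrite !ltr_norml => /andP[xN _] /andP[xM _].
  have [x0|x0] := leP 0 x.
    apply/eqP; rewrite eq_le; apply/andP; split; apply: (@der_le _ _ f f) => // y /andP[y0 _];
    apply: dG; lra.
  suff : G N 0 - G N x = G M 0 - G M x by lra.
  apply/eqP; rewrite eq_le; apply/andP; split; apply: (@der_le _ _ f f) => //; try exact: ltW;
    move=> y /andP[y0 _]; apply: dG; lra.
pose F (x : R) : R := G (`|x| + 1) x - G (`|x| + 1) 0.
exists F => x.
have B : - (`|x| + 2) < x.
  by have := ler_norm (- x); rewrite normrN; lra.
have := derB (dG (`|x| + 2) x B) (der_cst (G (`|x| + 2) 0) x).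
rewrite subr0; apply: der_near; exists 1 => // t tx.
apply: EG; last by rewrite ltrDl.
by have := lerB_dist t x; lra.
Qed.

(** A choice of primitive, meaningful for continuous [f]. Increments of a primitive
    are oriented integrals, free of conditions on the order of the endpoints. *)
Definition prim f : R -> R :=
  if pselect (exists F, forall x, is_derive x 1 F (f x)) is left H
  then sval (cid H) else fun=> 0.

Lemma der_prim f x : continuous f -> is_derive x 1 (prim f) (f x).
Proof.
move=> /prim_exists H; rewrite /prim; case: pselect => // H'.
by case: (cid H').
Qed.

Definition itg f a b := prim f b - prim f a.

Lemma itgE f F a b : continuous f -> (forall x, is_derive x 1 F (f x)) ->
  itg f a b = F b - F a.
Proof. by move=> cf HF; apply: der_eq_incr HF => x; exact: der_prim. Qed.

Lemma itg_le f g a b : continuous f -> continuous g -> a <= b ->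
  (forall x, a <= x <= b -> f x <= g x) -> itg f a b <= itg g a b.
Proof. by move=> cf cg ab; apply: der_le => // x _; exact: der_prim. Qed.

Lemma itg_cat f a b c : itg f a b + itg f b c = itg f a c.
Proof. by rewrite /itg; ring. Qed.

Lemma itg_xx f a : itg f a a = 0. Proof. exact: subrr. Qed.

Lemma itg_opp f a b : itg f a b = - itg f b a. Proof. by rewrite opprB. Qed.

Lemma itgD f g a b : continuous f -> continuous g ->
  itg (fun x => f x + g x) a b = itg f a b + itg g a b.
Proof.
move=> cf cg; have C : continuous (fun x => f x + g x).
  by move=> x; apply: cvgD; [exact: cf|exact: cg].
have D x : is_derive x 1 (fun x => prim f x + prim g x) (f x + g x).
  by apply: derD; exact: der_prim.
by rewrite (itgE a b C D) /itg; ring.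
Qed.

Lemma itgZ c f a b : continuous f ->
  itg (fun x => c * f x) a b = c * itg f a b.
Proof.
move=> cf; have C : continuous (fun x => c * f x).
  by move=> x; apply: cvgM; [exact: cvg_cst|exact: cf].
have D x : is_derive x 1 (fun x => c * prim f x) (c * f x).
  by apply: derZ; exact: der_prim.
by rewrite (itgE a b C D) /itg; ring.
Qed.

Lemma itgB f g a b : continuous f -> continuous g ->
  itg (fun x => f x - g x) a b = itg f a b - itg g a b.
Proof.
move=> cf cg; have C : continuous (fun x => f x - g x).
  by move=> x; apply: cvgB; [exact: cf|exact: cg].
have D x : is_derive x 1 (fun x => prim f x - prim g x) (f x - g x).
  by apply: derB; exact: der_prim.
by rewrite (itgE a b C D) /itg; ring.
Qed.

Lemma itg_cst c a b : itg (fun=> c) a b = c * (b - a).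
Proof.
have C : continuous (fun _ : R => c) by move=> x; exact: cvg_cst.
have D (x : R) : is_derive x 1 (fun x => c * x) c.
  by apply: (der_eq (derZ c (der_id x))); rewrite mulr1.
by rewrite (itgE a b C D) mulrBr.
Qed.

Lemma itg_ge0 f a b : continuous f -> a <= b ->
  (forall x, a <= x <= b -> 0 <= f x) -> 0 <= itg f a b.
Proof.
move=> cf ab H; have := @itg_le (fun=> 0) f a b.
by rewrite itg_cst mul0r; apply => // x; exact: cvg_cst.
Qed.

Lemma itg_period f l a b : continuous f -> periodic f l ->
  itg f a (a + l) = itg f b (b + l).
Proof.
move=> cf pf; apply: (@der0_const (fun a => itg f a (a + l))) => x.
have dl : is_derive x 1 (fun t => t + l) 1.
  by apply: (der_eq (derD (der_id x) (der_cst l x))); rewrite addr0.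
have D : is_derive (x + l) 1 (prim f) (f (x + l)) by exact: der_prim.
have := derB (@der_comp (prim f) (fun t => t + l) x _ _ D dl) (der_prim x cf).
by rewrite pf mulr1 subrr.
Qed.

Lemma prim_periodic f l : continuous f -> periodic f l ->
  itg f 0 l = 0 -> forall a, periodic (fun x => itg f a x) l.
Proof.
move=> cf pf f0 a x; rewrite -(itg_cat f a x (x + l)).
by rewrite (@itg_period f l x 0) // add0r f0 addr0.
Qed.

Lemma der_itg f a x : continuous f -> is_derive x 1 (fun t => itg f a t) (f x).
Proof.
by move=> cf; apply: (der_eq (derB (der_prim x cf) (der_cst (prim f a) x))); rewrite subr0.
Qed.

Lemma itg_gt0 f a b x : continuous f -> a < x < b ->
  (forall x, a <= x <= b -> 0 <= f x) -> 0 < f x -> 0 < itg f a b.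
Proof.
move=> cf /andP[ax xb] f0 fx.
have : \forall y \near x, f x / 2 < f y.
  by move: (cf x) => /cvgrPdist_lt/(_ (f x / 2)); rewrite divr_gt0 // => /(_ isT);
  apply: filterS => y; rewrite ltr_norml => /andP[]; lra.
move=> [e /= e0 He].
pose r := Num.min (e / 2) (Num.min (x - a) (b - x)).
have r0 : 0 < r by rewrite !lt_min divr_gt0 //= !subr_gt0 ax.
have re : r <= e / 2 by rewrite ge_min lexx.
have rx : r <= x - a by rewrite !ge_min lexx orbT.
have rb : r <= b - x by rewrite !ge_min lexx !orbT.
rewrite -(itg_cat f a (x - r) b) -(itg_cat f (x - r) x b).
have I1 : 0 <= itg f a (x - r).
  by apply: itg_ge0 => //; [lra|move=> y /andP[? ?]; apply: f0; lra].
have I3 : 0 <= itg f x b.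
  by apply: itg_ge0 => //; [lra|move=> y /andP[? ?]; apply: f0; lra].
have I2 : itg (fun=> f x / 2) (x - r) x <= itg f (x - r) x.
  apply: itg_le => //; first by move=> y; exact: cvg_cst.
    lra.
  move=> y /andP[? ?]; apply/ltW/He; rewrite /ball /= ger0_norm; lra.
move: I2; rewrite itg_cst => I2.
have : 0 < f x / 2 * (x - (x - r)) by rewrite mulr_gt0 ?divr_gt0 //; lra.
lra.
Qed.

(** The supremum of the points up to which [P] holds satisfies [P] by the last
    hypothesis, and can only be [b] by the one before. *)
Lemma real_ind (P : R -> Prop) a b : a <= b -> P a ->
  (forall c, a <= c -> c < b -> P c -> exists2 e, 0 < e & forall u, c < u -> u < c + e -> P u) ->
  (forall c, a < c -> c <= b -> (forall u, a <= u -> u < c -> P u) -> P c) -> P b.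
Proof.
move=> ab Pa Hr Hl.
pose A := [set t | a <= t <= b /\ forall u, a <= u -> u <= t -> P u].
have Aa : A a.
  by split; [rewrite lexx|move=> u au ua; rewrite (@le_anti _ _ u a) // ua].
have hs : has_sup A by split; [exists a|exists b => t [/andP[]]].
have sab : a <= sup A <= b.
  rewrite (sup_upper_bound hs) //=; apply: sup_le_ub; first by exists a.
  by move=> t [/andP[]].
have Pu u : a <= u -> u < sup A -> P u.
  move=> au us; have e0 : 0 < sup A - u by rewrite subr_gt0.
  have [t [_ At] ut] := sup_adherent e0 hs.
  by apply: At => //; rewrite subKr in ut; exact: ltW.
have Ps : P (sup A).
  case/andP: sab => + sb; rewrite le_eqVlt => /orP[/eqP <- //|a_s].
  exact: Hl.
case/andP: sab => sa; rewrite le_eqVlt => /orP[/eqP <- //|sb].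
have [e e0 He] := Hr _ sa sb Ps.
pose d := Num.min (e / 2) (b - sup A).
have d0 : 0 < d by rewrite lt_min divr_gt0 // subr_gt0.
have de : d <= e / 2 by rewrite ge_min lexx.
have db : d <= b - sup A by rewrite ge_min lexx orbT.
have : A (sup A + d).
  split=> [|u au]; first by apply/andP; split; lra.
  have [us _|us ud] := ltP u (sup A); first exact: Pu.
  move: us; rewrite le_eqVlt => /orP[/eqP <- //|su].
  by apply: He => //; lra.
by move=> /(sup_upper_bound hs); lra.
Qed.

End Calculus.

(** * Calculus of vector-valued functions *)

Section VectorCalculus.
Context {R : realType} {n : nat}.
Notation V := 'rV[R]_n.
Implicit Types (f g : R -> V) (s t a b : R) (u v w : V).

(** Derivatives and continuity are tested against constant vectors: each scalar
    product is then a real function, to which real calculus applies. *)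
Definition vder f s v :=
  forall b : V, is_derive s 1 (fun t => dot (f t) b) (dot v b).

Definition vcont (T : topologicalType) (f : T -> V) :=
  forall b : V, continuous (fun x : T => dot (f x) b).

Lemma vder_eq f s v w : vder f s v -> v = w -> vder f s w.
Proof. by move=> H <-. Qed.

Lemma vder_cst v s : vder (fun=> v) s 0.
Proof. by move=> b; apply: (der_eq (der_cst _ _)); rewrite dot0l. Qed.

Lemma vderD f g s v w : vder f s v -> vder g s w ->
  vder (fun t => f t + g t) s (v + w).
Proof.
move=> Hf Hg b; rewrite dotDl.
under eq_fun do rewrite dotDl.
by apply: derD; [exact: Hf|exact: Hg].
Qed.

Lemma vderB f g s v w : vder f s v -> vder g s w ->
  vder (fun t => f t - g t) s (v - w).
Proof.
move=> Hf Hg b; rewrite dotBl.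
under eq_fun do rewrite dotBl.
by apply: derB; [exact: Hf|exact: Hg].
Qed.

Lemma vderM (a : R -> R) (l : R) f s v : is_derive s 1 a l -> vder f s v ->
  vder (fun t => a t *: f t) s (l *: f s + a s *: v).
Proof.
move=> Ha Hf b; rewrite !dotE.
under eq_fun do rewrite dotZl.
by apply: derM => //; exact: Hf.
Qed.

Lemma vderZ (c : R) f s v : vder f s v -> vder (fun t => c *: f t) s (c *: v).
Proof.
move=> Hf; apply: (vder_eq (vderM (der_cst c s) Hf)).
by rewrite scale0r add0r.
Qed.

Lemma vder_comp f (a : R -> R) (l : R) s v : vder f (a s) v -> is_derive s 1 a l ->
  vder (fun t => f (a t)) s (l *: v).
Proof.
move=> Hf Ha b; rewrite dotZl mulrC.
exact: (@der_comp _ (fun t => dot (f t) b) a s _ _ (Hf b) Ha).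
Qed.

Lemma vder_dot f g s v w : vder f s v -> vder g s w ->
  is_derive s 1 (fun t => dot (f t) (g t)) (dot v (g s) + dot (f s) w).
Proof.
move=> Hf Hg; rewrite /dot -big_split /=.
apply: der_sum => i; apply: derM; rewrite -dot_delta.
  by under eq_fun do rewrite -dot_delta; exact: (Hf (delta_mx ord0 i)).
by under eq_fun do rewrite -dot_delta; exact: (Hg (delta_mx ord0 i)).
Qed.

Lemma vder_unique f s v w : vder f s v -> vder f s w -> v = w.
Proof. by move=> H1 H2; apply: dot_eqP => b; exact: der_unique (H1 b) (H2 b). Qed.

Lemma vder_vcont f (f' : R -> V) : (forall s, vder f s (f' s)) -> vcont f.
Proof. by move=> H b s; exact: der_cont (H s b). Qed.

Section Continuity.
Context {T S : topologicalType}.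

Lemma vcontD (F G : T -> V) : vcont F -> vcont G -> vcont (fun x => F x + G x).
Proof.
move=> cf cg b; under eq_fun do rewrite dotDl.
by move=> x; apply: cvgD; [exact: cf|exact: cg].
Qed.

Lemma vcontN (F : T -> V) : vcont F -> vcont (fun x => - F x).
Proof.
by move=> cf b; under eq_fun do rewrite dotNl; move=> x; apply: cvgN; exact: cf.
Qed.

Lemma vcontB (F G : T -> V) : vcont F -> vcont G -> vcont (fun x => F x - G x).
Proof. by move=> cf cg; apply: vcontD => //; exact: vcontN. Qed.

Lemma vcont_cst v : vcont (fun _ : T => v).
Proof. by move=> b x; exact: cvg_cst. Qed.

Lemma vcontZ (a : T -> R) (F : T -> V) : continuous a -> vcont F ->
  vcont (fun x => a x *: F x).
Proof.
move=> ca cf b; under eq_fun do rewrite dotZl.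
by move=> x; apply: cvgM; [exact: ca|exact: cf].
Qed.

Lemma vcont_dot (F G : T -> V) : vcont F -> vcont G ->
  continuous (fun x => dot (F x) (G x)).
Proof.
move=> cf cg x; apply: cvg_big => [|i _].
  by move=> p; exact: add_continuous.
have coord (H : T -> V) : vcont H -> continuous (fun y => H y ord0 i).
  move=> cH; rewrite (_ : (fun y => _) = (fun y => dot (H y) (delta_mx ord0 i))).
    exact: cH.
  by apply/funext => y; rewrite dot_delta.
by apply: cvgM; [exact: (coord F)|exact: (coord G)].
Qed.

Lemma vcont_enorm (F : T -> V) : vcont F -> continuous (fun x => enorm (F x)).
Proof.
move=> cf x.
apply: (@continuous_comp _ _ _ (fun x => dot (F x) (F x)) (@Num.sqrt R)).
  exact: vcont_dot.
exact: sqrt_continuous.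
Qed.

Lemma vcont_comp (F : S -> V) (a : T -> S) : continuous a -> vcont F ->
  vcont (fun x => F (a x)).
Proof.
move=> ca cf b x; apply: (@continuous_comp _ _ _ a (fun y => dot (F y) b)).
  exact: ca.
exact: cf.
Qed.

End Continuity.

(** Testing against unit vectors reduces this mean value inequality to
    [der_le]. *)
Lemma vmvt f (f' : R -> V) (G g : R -> R) a b : a <= b ->
  (forall s, a <= s <= b -> vder f s (f' s)) ->
  (forall s, a <= s <= b -> is_derive s 1 G (g s)) ->
  (forall s, a <= s <= b -> enorm (f' s) <= g s) ->
  enorm (f b - f a) <= G b - G a.
Proof.
move=> ab Hf HG Hle; apply: enorm_le_test.
  have C s : a <= s <= b -> is_derive s 1 (fun _ : R => 0 : R) 0.
    by move=> _; exact: der_cst.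
  rewrite -(subrr (0 : R)); apply: (der_le ab C HG) => s sab.
  exact: le_trans (enorm_ge0 _) (Hle s sab).
move=> c c1; rewrite dotBl.
have D s : a <= s <= b -> is_derive s 1 (fun t => dot (f t) c) (dot (f' s) c).
  by move=> sab; exact: Hf.
apply: (der_le ab D HG) => s sab.
by apply: le_trans (Hle s sab); apply: le_trans (dot_le _ _) _; rewrite c1 mulr1.
Qed.

Lemma vder_lip f (f' : R -> V) (K : R) : (forall s, vder f s (f' s)) ->
  (forall s, enorm (f' s) <= K) -> forall s t, enorm (f s - f t) <= K * `|s - t|.
Proof.
move=> Hf HK.
suff H s t : t <= s -> enorm (f s - f t) <= K * (s - t).
  move=> s t; have [ts|st] := leP t s.
    by rewrite ger0_norm ?subr_ge0 // H.
  by rewrite enormB distrC ger0_norm ?subr_ge0 ?(ltW st) // H // ltW.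
move=> ts; rewrite mulrBr.
have D x : t <= x <= s -> is_derive x 1 (fun x => K * x) K.
  by move=> _; apply: (der_eq (derZ K (der_id x))); rewrite mulr1.
by apply: (vmvt ts _ D) => x _; [exact: Hf|exact: HK].
Qed.

Definition vitg f a b : V := \row_i itg (fun s => f s ord0 i) a b.

Lemma dot_vitg f a b u : vcont f -> dot (vitg f a b) u = itg (fun s => dot (f s) u) a b.
Proof.
move=> cf; have ci (i : 'I_n) : continuous (fun s => f s ord0 i).
  rewrite (_ : (fun s => _) = (fun s => dot (f s) (delta_mx ord0 i))); first exact: cf.
  by apply/funext => s; rewrite dot_delta.
have D (x : R) : is_derive x 1 (fun t => \sum_i prim (fun s => f s ord0 i) t * u ord0 i) (dot (f x) u).
  apply: der_sum => i.
  by apply: (der_eq (derM (der_prim x (ci i)) (der_cst _ x))); rewrite mulr0 addr0.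
rewrite (itgE a b (cf u) D) -sumrB /dot; apply: eq_bigr => i _.
by rewrite mxE /itg mulrBl.
Qed.

Lemma vder_vitg f a s : vcont f -> vder (fun t => vitg f a t) s (f s).
Proof.
move=> cf u; under eq_fun do rewrite dot_vitg //.
by apply: der_itg; exact: cf.
Qed.

Lemma vitgE f (F : R -> V) a b : vcont f -> (forall s, vder F s (f s)) ->
  vitg f a b = F b - F a.
Proof.
move=> cf HF; apply: dot_eqP => u; rewrite dot_vitg // dotBl.
have D s : is_derive s 1 (fun t => dot (F t) u) (dot (f s) u) by exact: HF.
exact: (itgE a b (cf u) D).
Qed.

Lemma vitg_xx f a : vitg f a a = 0.
Proof. by apply/rowP => i; rewrite !mxE itg_xx. Qed.

Lemma enorm_vitg f (g : R -> R) a b : vcont f -> continuous g -> a <= b ->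
  (forall s, a <= s <= b -> enorm (f s) <= g s) -> enorm (vitg f a b) <= itg g a b.
Proof.
move=> cf cg ab H; rewrite -[vitg f a b]subr0 -(vitg_xx f a).
have D s : a <= s <= b -> is_derive s 1 (prim g) (g s).
  by move=> _; exact: der_prim.
by apply: (vmvt ab _ D H) => s _; exact: vder_vitg.
Qed.

(** As [f] need not be differentiable, induction along the interval takes the
    place of the mean value theorem. *)
Lemma slope_le f (G g : R -> R) a b : a <= b ->
  (forall s, is_derive s 1 G (g s)) ->
  (forall s e, 0 < e -> exists2 d, 0 < d & forall t, `|t - s| < d ->
     enorm (f t - f s) <= (g s + e) * `|t - s|) ->
  enorm (f b - f a) <= G b - G a.
Proof.
move=> ab HG Hf; apply/ler_addgt0Pr => e0 e0gt.
pose e := e0 / (b - a + 1).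
have ba1 : 0 < b - a + 1 by lra.
have e0' : 0 < e by rewrite divr_gt0.
suff H : enorm (f b - f a) <= G b - G a + e * (b - a).
  apply: le_trans H _; rewrite lerD2l /e mulrAC ler_pdivrMr // ler_pM2l //; lra.
have e2 : 0 < e / 2 by rewrite divr_gt0.
have HGs s : exists2 d, 0 < d & forall t, `|t - s| < d ->
    `|G t - G s - g s * (t - s)| <= e / 2 * `|t - s|.
  by move/der_edP: (HG s); exact.
have loc s : exists2 d, 0 < d & forall t, `|t - s| < d ->
    enorm (f t - f s) <= (g s + e / 2) * `|t - s| /\
    `|G t - G s - g s * (t - s)| <= e / 2 * `|t - s|.
  have [d1 d10 H1] := HGs s; have [d2 d20 H2] := Hf s _ e2.
  exists (Num.min d1 d2); first by rewrite lt_min d10.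
  by move=> t; rewrite lt_min => /andP[t1 t2]; split; [exact: H2|exact: H1].
apply: (@real_ind _ (fun t => enorm (f t - f a) <= G t - G a + e * (t - a)) _ _ ab).
- by rewrite !subrr enorm0 mulr0 addr0.
- move=> c ac cb Pc; have [d d0 Hd] := loc c; exists d => // u cu ud.
  have [|H1 H2] := Hd u; first by rewrite gtr0_norm; lra.
  rewrite gtr0_norm ?subr_gt0 // in H1 H2.
  move: H2; rewrite ler_norml => /andP[H2 _].
  have := enorm_tri (f c) (f u) (f a); nra.
- move=> c ac cb Pc; have [d d0 Hd] := loc c.
  pose u := Num.max a (c - d / 2).
  have uc : u < c by rewrite gt_max ac; lra.
  have au : a <= u by rewrite le_max lexx.
  have ud : c - d / 2 <= u by rewrite le_max lexx orbT.
  have [|H1 H2] := Hd u; first by rewrite ltr0_norm; lra.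
  rewrite ltr0_norm ?subr_lt0 // in H1 H2.
  move: H2; rewrite ler_norml => /andP[_ H2].
  have := Pc u au uc; have := enorm_tri (f u) (f c) (f a); rewrite (enormB (f c) (f u)); nra.
Qed.

End VectorCalculus.

(** * Arcs of curvature at most 1 *)

Section Spherical.
Context {R : realType} {n : nat}.
Notation V := 'rV[R]_n.
Implicit Types (u v w : V).

(** In terms of angles on the sphere: two steps of at most [acos c] span at most
    twice that angle, by the formula for [cos (2 * x)]. *)
Lemma sph_cos u v w (c : R) : enorm u = 1 -> enorm v = 1 -> enorm w = 1 ->
  0 <= c -> c <= 1 -> c <= dot u v -> c <= dot v w -> c ^+ 2 *+ 2 - 1 <= dot u w.
Proof.
move=> u1 v1 w1 c0 c1 cuv cvw.
have uu : dot u u = 1 by rewrite -enorm_sq u1 expr1n.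
have vv : dot v v = 1 by rewrite -enorm_sq v1 expr1n.
have ww : dot w w = 1 by rewrite -enorm_sq w1 expr1n.
have := dot_cauchy (u - dot u v *: v) (w - dot v w *: v).
rewrite !dotE uu vv ww (dotC v u) (dotC w v).
move: cuv cvw; set p := dot u v; set q := dot v w; set x := dot u w => cp cq H.
have p1 : p <= 1 by have := dot_le u v; rewrite u1 v1 mulr1.
have q1 : q <= 1 by have := dot_le v w; rewrite v1 w1 mulr1.
have H1 : (x - p * q) ^+ 2 <= (1 - p ^+ 2) * (1 - q ^+ 2) by nra.
have H2 : (1 - p ^+ 2) * (1 - q ^+ 2) <= (1 - c ^+ 2) ^+ 2.
  rewrite expr2; apply: ler_pM; nra.
have : `|x - p * q| <= 1 - c ^+ 2.
  rewrite -(@ler_pXn2r _ 2) ?nnegrE //; last by nra.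
  by rewrite real_normK ?num_real // (le_trans H1).
rewrite ler_norml => /andP[H3 _].
have : c * c <= p * q by apply: ler_pM.
rewrite -expr2 mulr2n; lra.
Qed.

(** Here [c] and [s] are the cosine and the sine of an angle [x]: turning [v] by at
    most [x] takes it out of the half-space of the vectors with nonnegative
    product with [u] by at most [x]. *)
Lemma sph_sin u v w (c s : R) : enorm v = 1 -> enorm w = 1 ->
  0 <= c -> 0 <= s -> c ^+ 2 + s ^+ 2 = 1 -> 0 <= dot u v -> c <= dot v w ->
  - (enorm u * s) <= dot u w.
Proof.
move=> v1 w1 c0 s0 cs uv cvw.
have vv : dot v v = 1 by rewrite -enorm_sq v1 expr1n.
have ww : dot w w = 1 by rewrite -enorm_sq w1 expr1n.
set q := dot v w in cvw *.
have H : enorm (w - q *: v) <= s.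
  apply: enorm_le_dot => //; rewrite !dotE vv ww (dotC w v) -/q.
  by nra.
have := dot_le (- u) (w - q *: v); rewrite enormN !dotE -/q.
have : enorm u * enorm (w - q *: v) <= enorm u * s by rewrite ler_wpM2l // enorm_ge0.
have : 0 <= q * dot u v by rewrite mulr_ge0 // (le_trans c0).
lra.
Qed.

Lemma cos_lip (x y : R) : x <= y -> cos x - cos y <= y - x.
Proof.
move=> xy.
have D1 t : x <= t <= y -> is_derive t 1 (fun t => - cos t) (sin t).
  by move=> _; apply: (der_eq (derN (is_derive_cos t))); rewrite opprK.
have D2 t : x <= t <= y -> is_derive t 1 (fun t => t) 1 by move=> _; exact: der_id.
have := der_le xy D1 D2; rewrite opprK addrC; apply => t _; exact: sin_le1.
Qed.

(** The factor [1 + e] absorbs the terms of higher order of the cosine. *)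
Lemma cos_small (e : R) : 0 < e -> exists2 d : R, 0 < d & forall x : R, 0 <= x < d ->
  cos ((1 + e) * x) <= 1 - x ^+ 2 / 2.
Proof.
move=> e0.
have e1 : 0 < 1 + e by lra.
have : is_derive (0 : R) 1 sin 1 by apply: (der_eq (is_derive_sin 0)); exact: cos0.
move/der_edP => /(_ (e / (1 + e))); rewrite divr_gt0 // => /(_ isT) [d d0 Hd].
exists (d / (1 + e)); first by rewrite divr_gt0.
move=> x /andP[x0 xd]; rewrite ltr_pdivlMr // in xd.
pose y := (1 + e) * x / 2.
have y0 : 0 <= y by rewrite divr_ge0 // mulr_ge0 // ltW.
have yd : `|y - 0| < d by rewrite subr0 ger0_norm // /y; lra.
have := Hd y yd; rewrite sin0 !subr0 mul1r (ger0_norm y0) ler_norml => /andP[H _].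
have E : e / (1 + e) * y = e * x / 2 by rewrite /y; field; rewrite gt_eqF.
have S : x / 2 <= sin y by rewrite E /y in H; rewrite /y; lra.
have -> : (1 + e) * x = y *+ 2 by rewrite /y mulr2n; lra.
rewrite cos_mulr2n cos2sin2 mulr2n; nra.
Qed.

Lemma out_ball v b : enorm b = 1 -> 1 <= enorm (v - b) ->
  2 * dot b v <= enorm v ^+ 2.
Proof.
move=> b1; rewrite -(@ler_pXn2r _ 2) ?nnegrE ?enorm_ge0 // expr1n !enorm_sq.
by rewrite !dotE -(enorm_sq b) b1 expr1n (dotC v b); lra.
Qed.

End Spherical.

Section UnitSpeed.
Context {R : realType} {n : nat}.
Notation V := 'rV[R]_n.
Implicit Types (g T : R -> V) (s t : R).

Definition lip1 T := forall s t, enorm (T s - T t) <= `|s - t|.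

Definition unit_speed g T :=
  (forall s, vder g s (T s)) /\ (forall s, enorm (T s) = 1).

Lemma unit_dot T s : (forall s, enorm (T s) = 1) -> dot (T s) (T s) = 1.
Proof. by move=> T1; rewrite -enorm_sq T1 expr1n. Qed.

(** The bound on the speed of [T] on the sphere bounds the angle described over
    small times up to the factor [1 + e]; the doubling step [sph_cos] carries
    this bound to all times, and [e] then tends to 0. *)
Lemma tangent_cos T : (forall s, enorm (T s) = 1) -> lip1 T ->
  forall s t, s <= t -> t - s <= pi -> cos (t - s) <= dot (T s) (T t).
Proof.
move=> T1 TL.
have step (e : R) s t : 0 < e -> s <= t -> (1 + e) * (t - s) <= pi ->
    cos ((1 + e) * (t - s)) <= dot (T s) (T t).
  move=> e0 st stpi; have [d d0 Hd] := cos_small e0.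
  have [N HN] : exists N, t - s < d * 2 ^+ N.
    pose N := Num.bound ((t - s) / d); exists N.
    rewrite mulrC -ltr_pdivrMr //; apply: lt_trans (archi_boundP _) _.
      by rewrite divr_ge0 ?subr_ge0 // ltW.
    by rewrite -natrX ltr_nat ltn_expl.
  elim: N s t st stpi HN => [|N IH] s t st stpi HN.
    rewrite expr0 mulr1 in HN.
    apply: le_trans (Hd (t - s) _) _; first by rewrite subr_ge0 st.
    have := enorm_sq (T t - T s); rewrite !dotE !unit_dot // (dotC (T t)).
    have := TL t s; rewrite ger0_norm ?subr_ge0 // => H.
    have : enorm (T t - T s) ^+ 2 <= (t - s) ^+ 2.
      by rewrite ler_pXn2r // ?nnegrE ?enorm_ge0 ?subr_ge0.
    lra.
  pose m := (s + t) / 2.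
  have sm : s <= m by rewrite /m; lra.
  have mt : m <= t by rewrite /m; lra.
  have ms : m - s = (t - s) / 2 by rewrite /m; lra.
  have tm : t - m = (t - s) / 2 by rewrite /m; lra.
  have pi0 := pi_gt0 R.
  have H1 : cos ((1 + e) * ((t - s) / 2)) <= dot (T s) (T m).
    by rewrite -ms; apply: IH => //; rewrite ms; [nra|rewrite exprS in HN; lra].
  have H2 : cos ((1 + e) * ((t - s) / 2)) <= dot (T m) (T t).
    by rewrite -tm; apply: IH => //; rewrite tm; [nra|rewrite exprS in HN; lra].
  have -> : (1 + e) * (t - s) = ((1 + e) * ((t - s) / 2)) *+ 2 by rewrite mulr2n; lra.
  rewrite cos_mulr2n; apply: (sph_cos (T1 s) (T1 m) (T1 t) _ (cos_le1 _) H1 H2).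
  apply: cos_ge0_pihalf; apply/andP; split; last by lra.
  by have : 0 <= (1 + e) * ((t - s) / 2); [rewrite mulr_ge0; lra|lra].
move=> s t st; rewrite le_eqVlt => /orP[/eqP ->|stpi].
  rewrite cospi; have := dot_le (- T s) (T t); rewrite enormN !T1 dotNl; lra.
rewrite leNgt; apply/negP => H.
pose x := t - s; have x0 : 0 <= x by rewrite subr_ge0.
pose e := Num.min ((pi - x) / (x + 1)) ((cos x - dot (T s) (T t)) / (x + 1) / 2).
have x1 : 0 < x + 1 by lra.
have e0 : 0 < e by rewrite lt_min !divr_gt0 // subr_gt0.
have e1 : e * (x + 1) <= pi - x by rewrite -ler_pdivlMr // ge_min lexx.
have e2 : e * (x + 1) <= (cos x - dot (T s) (T t)) / 2.
  by rewrite -ler_pdivlMr // ge_min mulrAC lexx orbT.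
have H1 : (1 + e) * x <= pi by nra.
have := step e s t e0 st H1; rewrite -/x.
have := @cos_lip _ x ((1 + e) * x); have : x <= (1 + e) * x by nra.
by move=> h /(_ h); nra.
Qed.

Section Arc.
Variables (g T : R -> V).
Hypotheses (us : unit_speed g T) (TL : lip1 T).

Let gder := us.1.
Let T1 := us.2.

(** Schur comparison: for an arc of the unit circle this is an equality, and by
    [tangent_cos] the derivative in [s] compares. *)
Lemma chord_dot_end s t : s <= t -> t - s <= pi -> sin (t - s) <= dot (g t - g s) (T t).
Proof.
move=> st stpi.
have D1 x : s <= x <= t -> is_derive x 1 (fun x => - sin (t - x)) (cos (t - x)).
  move=> _; have d1 : is_derive x 1 (fun x => t - x) (-1).
    by apply: (der_eq (derB (der_cst t x) (der_id x))); rewrite sub0r.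
  have d2 : is_derive (t - x) 1 (@sin R) (cos (t - x)) by exact: is_derive_sin.
  by apply: (der_eq (derN (@der_comp _ (@sin R) (fun x => t - x) x _ _ d2 d1))); rewrite mulrN1 opprK.
have D2 x : s <= x <= t -> is_derive x 1 (fun x => dot (g x) (T t)) (dot (T x) (T t)).
  by move=> _; exact: gder.
have := der_le st D1 D2; rewrite subrr sin0 oppr0 sub0r opprK dotBl; apply.
move=> x /andP[sx xt]; apply: tangent_cos => //; lra.
Qed.

Lemma chord_sq s t : s <= t -> t - s <= pi ->
  (1 - cos (t - s)) *+ 2 <= dot (g t - g s) (g t - g s).
Proof.
move=> st stpi.
have D1 x : s <= x <= t -> is_derive x 1 (fun x => - cos (x - s) *+ 2) (sin (x - s) *+ 2).
  move=> _; have d1 : is_derive x 1 (fun x => x - s) 1.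
    by apply: (der_eq (derB (der_id x) (der_cst s x))); rewrite subr0.
  have d2 : is_derive (x - s) 1 (@cos R) (- sin (x - s)) by exact: is_derive_cos.
  have d3 := derN (@der_comp _ (@cos R) (fun x => x - s) x _ _ d2 d1).
  by apply: (der_eq (derD d3 d3)); rewrite mulr1 opprK.
have d (x : R) : vder (fun x => g x - g s) x (T x).
  by apply: (vder_eq (vderB (gder x) (vder_cst _ _))); rewrite subr0.
have D2 x : s <= x <= t ->
    is_derive x 1 (fun x => dot (g x - g s) (g x - g s)) (dot (g x - g s) (T x) *+ 2).
  by move=> _; apply: (der_eq (vder_dot (d x) (d x))); rewrite dotC.
have := der_le st D1 D2.
have -> : - cos (t - s) *+ 2 - - cos (s - s) *+ 2 = (1 - cos (t - s)) *+ 2.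
  by rewrite subrr cos0 !mulr2n; lra.
rewrite subrr dot0l subr0; apply.
move=> x /andP[sx xt]; rewrite lerMn2r; apply/orP; right; apply: chord_dot_end => //; lra.
Qed.

(** Write [r] for the distance from [g s] to [z] and [c] for [cos (t - s)]. By the
    law of cosines, [sph_sin] and [chord_sq], the square of the distance from
    [g t] to [z] is at least [r ^+ 2 - 2 * (r - 1) * (1 - c)], which is at least
    1 as [r >= 1] and [c >= 0]. *)
Lemma quarter_escape z s t : s <= t -> t - s <= pi / 2 -> 1 <= enorm (g s - z) ->
  0 <= dot (g s - z) (T s) -> 1 <= enorm (g t - z).
Proof.
move=> st stpi r1 d0; have pi0 := pi_gt0 R.
set r := enorm (g s - z) in r1; pose w := g t - g s.
have H x : s <= x <= t -> - (r * sin (x - s)) <= dot (g s - z) (T x).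
  move=> /andP[sx xt]; apply: (@sph_sin _ _ _ (T s) _ (cos (x - s))) => //.
  - by apply: cos_ge0_pihalf; apply/andP; split; lra.
  - by apply: sin_ge0_pi; apply/andP; split; lra.
  - exact: cos2Dsin2.
  - by apply: tangent_cos => //; lra.
have D1 x : s <= x <= t -> is_derive x 1 (fun x => r * cos (x - s)) (- (r * sin (x - s))).
  move=> _; have d1 : is_derive x 1 (fun x => x - s) 1.
    by apply: (der_eq (derB (der_id x) (der_cst s x))); rewrite subr0.
  have d2 : is_derive (x - s) 1 (@cos R) (- sin (x - s)) by exact: is_derive_cos.
  have d3 := derZ r (@der_comp _ (@cos R) (fun x => x - s) x _ _ d2 d1).
  by apply: (der_eq d3); rewrite mulr1 mulrN.
have D2 x : s <= x <= t -> is_derive x 1 (fun x => dot (g x) (g s - z)) (dot (g s - z) (T x)).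
  by move=> _; rewrite dotC; exact: gder.
have := der_le st D1 D2 H; rewrite subrr cos0 mulr1 => H1.
have H2 := chord_sq st (_ : t - s <= pi); have {}H2 := H2 ltac:(lra).
have c0 : 0 <= cos (t - s) by apply: cos_ge0_pihalf; apply/andP; split; lra.
have c1 : cos (t - s) <= 1 by exact: cos_le1.
have E : enorm (g t - z) ^+ 2 = r ^+ 2 + 2 * (dot (g t) (g s - z) - dot (g s) (g s - z))
    + dot (g t - g s) (g t - g s).
  rewrite /r !enorm_sq -dotBl -[g t - z](_ : (g s - z) + (g t - g s) = _); last first.
    by rewrite addrC addrA subrK.
  by move: (g s - z) (g t - g s) => a b; rewrite !dotE (dotC b a); lra.
rewrite -(@ler_pXn2r _ 2) ?nnegrE ?enorm_ge0 // expr1n E; rewrite mulr2n in H2.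
nra.
Qed.

(** After a quarter of a turn the curve still moves away from the centre [z], so
    that [quarter_escape] applies a second time. *)
Lemma quarter_turn z s t : s <= t -> t - s <= pi / 2 -> enorm (g s - z) = 1 ->
  0 <= dot (g s - z) (T s) -> 0 <= dot (g t - z) (T t).
Proof.
move=> st stpi r1 d0; have pi0 := pi_gt0 R.
have H1 : - (enorm (g s - z) * sin (t - s)) <= dot (g s - z) (T t).
  apply: (@sph_sin _ _ _ (T s) _ (cos (t - s))) => //.
  - by apply: cos_ge0_pihalf; apply/andP; split; lra.
  - by apply: sin_ge0_pi; apply/andP; split; lra.
  - exact: cos2Dsin2.
  - by apply: tangent_cos => //; lra.
have H2 := chord_dot_end st (_ : t - s <= pi); have {}H2 := H2 ltac:(lra).
rewrite -[g t - z](_ : (g s - z) + (g t - g s) = _); last first.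
  by rewrite addrC addrA subrK.
by rewrite dotDl; rewrite r1 mul1r in H1; lra.
Qed.

(** Two quarters of a turn, each governed by [quarter_escape], where [z] is the
    centre of the tangent ball of radius 1 that contains the one given by [a]. *)
Lemma arc_ball s t a : s <= t -> t - s <= pi -> dot a (T s) = 0 -> enorm a <= 1 ->
  2 * dot a (g t - g s) <= enorm (g t - g s) ^+ 2.
Proof.
move=> st stpi aT a1.
have [->|a0] := eqVneq a 0; first by rewrite dot0l mulr0 sqr_ge0.
have ag := enorm_gt0 a0.
pose b := unitv a; pose z := g s + b.
have b1 : enorm b = 1 by exact: enorm_unitv.
have gz : g s - z = - b by rewrite /z opprD addrA subrr add0r.
pose m := (s + t) / 2.
have sm : s <= m by rewrite /m; lra.
have mt : m <= t by rewrite /m; lra.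
have bT : dot b (T s) = 0 by rewrite /b /unitv dotZl aT mulr0.
have r1 : enorm (g s - z) = 1 by rewrite gz enormN.
have d0 : 0 <= dot (g s - z) (T s) by rewrite gz dotNl bT oppr0.
have Hm : 1 <= enorm (g m - z).
  by apply: (quarter_escape sm) => //; rewrite ?r1 // /m; lra.
have dm : 0 <= dot (g m - z) (T m).
  by apply: (quarter_turn sm) => //; rewrite /m; lra.
have : 1 <= enorm (g t - z).
  by apply: (quarter_escape mt) => //; rewrite /m; lra.
rewrite /z opprD addrA => /(out_ball b1) H'; have e0 := sqr_ge0 (enorm (g t - g s)).
have -> : a = enorm a *: b by exact: unitvE.
rewrite dotZl mulrCA; apply: le_trans (ler_wpM2l (ltW ag) H') _.
by rewrite ler_piMl.
Qed.

End Arc.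

Lemma unit_speed_rev g T : unit_speed g T -> unit_speed (fun s => g (- s)) (fun s => - T (- s)).
Proof.
move=> [gd T1]; split=> s; last by rewrite enormN.
have d1 : is_derive s 1 (fun t : R => - t) (-1) by exact: derN (der_id s).
by apply: (vder_eq (vder_comp (gd (- s)) d1)); rewrite scaleN1r.
Qed.

Lemma arc_ball_sym g T s t a : unit_speed g T -> lip1 T -> `|t - s| <= pi ->
  dot a (T s) = 0 -> enorm a <= 1 ->
  2 * dot a (g t - g s) <= enorm (g t - g s) ^+ 2.
Proof.
move=> us TL stpi aT a1; have [st|/ltW ts] := leP s t.
  by apply: (arc_ball us TL) => //; rewrite ger0_norm ?subr_ge0 in stpi.
have TL' : lip1 (fun s => - T (- s)).
  by move=> x y; rewrite -opprD enormN (le_trans (TL _ _)) // -opprD normrN.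
have := @arc_ball _ _ (unit_speed_rev us) TL' (- s) (- t) a.
rewrite !opprK lerN2; apply => //; last by rewrite dotNr aT oppr0.
by rewrite -normrN opprB ger0_norm ?subr_ge0 // in stpi; lra.
Qed.

End UnitSpeed.

(** * Tangent balls and double critical pairs of closed curves *)

Section Periodic.
Context {R : realType} {T : zmodType}.
Implicit Types (f : R -> T) (l s t : R).

Lemma periodicz f l (k : int) s : periodic f l -> f (s + k%:~R * l) = f s.
Proof.
move=> pf; have P m x : f (x + m%:R * l) = f x by rewrite mulr_natl periodicn.
case: k => m; first exact: P.
by rewrite NegzE mulrNz mulNr -(P m.+1 (s - _)) subrK.
Qed.

Lemma mod_shift l s t : 0 < l -> exists k : int, 0 <= t + k%:~R * l - s < l.
Proof.
move=> l0; exists (- Num.floor ((t - s) / l)); rewrite mulrNz mulNr.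
have /andP[] := floor_itv ((t - s) / l); rewrite ler_pdivlMr // ltr_pdivrMr // => H1 H2.
rewrite intrD mulrDl mul1r in H2.
by apply/andP; split; lra.
Qed.

End Periodic.

Section Rectangle.
Context {R : realType}.

Lemma rect_min (f : R * R -> R) (a b c d : R) : a <= b -> c <= d -> continuous f ->
  exists p : R * R, [/\ a <= p.1 <= b, c <= p.2 <= d &
    forall q : R * R, a <= q.1 <= b -> c <= q.2 <= d -> f p <= f q].
Proof.
move=> ab cd cf; pose A : set (R * R) := `[a, b] `*` `[c, d].
have A0 : A !=set0 by exists (a, c); split; rewrite /= in_itv /= lexx.
have cA : compact A by apply: compact_setX; exact: segment_compact.
have [p pA Hp] := compact_EVT_min A0 cA (continuous_subspaceT cf).
move: pA; rewrite inE => -[/=]; rewrite !in_itv /= => p1 p2; exists p; split=> // q q1 q2.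
by apply: Hp; rewrite inE; split; rewrite /= in_itv.
Qed.

Lemma rect_gt0 (f : R * R -> R) (a b c d : R) : continuous f ->
  (forall q : R * R, a <= q.1 <= b -> c <= q.2 <= d -> 0 < f q) ->
  exists2 m, 0 < m & forall q : R * R, a <= q.1 <= b -> c <= q.2 <= d -> m <= f q.
Proof.
move=> cf f0; have [ab|ba] := leP a b; last first.
  by exists 1 => // q /andP[q1 q2]; move: (le_trans q1 q2); rewrite leNgt ba.
have [cd|dc] := leP c d; last first.
  by exists 1 => // q _ /andP[q1 q2]; move: (le_trans q1 q2); rewrite leNgt dc.
have [p [p1 p2 Hp]] := rect_min ab cd cf.
by exists (f p) => //; exact: f0.
Qed.

End Rectangle.

Section ClosedUnit.
Context {R : realType} {n : nat}.
Notation V := 'rV[R]_n.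
Implicit Types (g T : R -> V) (s t l : R).

Definition closed_unit l g T :=
  [/\ 0 < l, unit_speed g T, periodic g l & injective_mod l g].

Lemma der_periodic g (g' : R -> V) l : (forall s, vder g s (g' s)) -> periodic g l -> periodic g' l.
Proof.
move=> gd pg s; have d1 : is_derive s 1 (fun t : R => t + l) 1.
  by apply: (der_eq (derD (der_id s) (der_cst l s))); rewrite addr0.
have := @vder_comp _ _ g (fun t : R => t + l) 1 s _ (gd (s + l)) d1; rewrite scale1r.
by under eq_fun do rewrite pg; move=> /vder_unique/(_ (gd s)).
Qed.

(** Parameters of a double critical pair of a curve [g] with tangent [T]. *)
Definition dcp g T s t :=
  [/\ g s != g t, dot (g s - g t) (T s) = 0 & dot (g s - g t) (T t) = 0].

Lemma lip1_vcont T : lip1 T -> vcont T.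
Proof.
move=> TL b s; apply/cvgrPdist_le => e e0.
have b1 : 0 < enorm b + 1 by have := enorm_ge0 b; lra.
exists (e / (enorm b + 1)) => /=; first by rewrite divr_gt0.
move=> t; rewrite /ball /= ltr_pdivlMr // => st.
rewrite -dotBl; apply: le_trans (dot_ler_norm _ _) _.
have := TL s t; have := enorm_ge0 b; have := normr_ge0 (s - t); nra.
Qed.

Lemma cont_pair_add : continuous (fun p : R * R => p.1 + p.2).
Proof. by move=> p; exact: add_continuous. Qed.

Lemma cont_fst : continuous (fun p : R * R => p.1).
Proof. by move=> p; exact: cvg_fst. Qed.

Lemma vcont_chord g : vcont g -> vcont (fun p : R * R => g (p.1 + p.2) - g p.1).
Proof.
move=> cg; apply: vcontB; apply: vcont_comp => //.
  exact: cont_pair_add.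
exact: cont_fst.
Qed.

Section Fixed.
Variables (l : R) (g T : R -> V).
Hypotheses (cu : closed_unit l g T) (TL : lip1 T).

Let l0 : 0 < l. Proof. by case: cu. Qed.
Let us : unit_speed g T. Proof. by case: cu. Qed.
Let pg : periodic g l. Proof. by case: cu. Qed.
Let ig : injective_mod l g. Proof. by case: cu. Qed.
Let pT : periodic T l. Proof. exact: der_periodic us.1 pg. Qed.
Let cg : vcont g. Proof. exact: vder_vcont us.1. Qed.
Let cT : vcont T. Proof. exact: lip1_vcont. Qed.

Lemma chord_neq s t : 0 < t - s < l -> g s != g t.
Proof.
move=> /andP[st tl]; apply/eqP => /ig [k E].
have kl : k%:~R * l = - (t - s) by rewrite E; lra.
have k0 : k%:~R < 0 :> R by rewrite -(pmulr_llt0 _ l0) kl; lra.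
have k1 : -1 < k%:~R :> R.
  have : 0 < (1 + k%:~R) * l by rewrite mulrDl mul1r kl; lra.
  by rewrite pmulr_lgt0 //; lra.
rewrite ltrz0 in k0.
have : (-1 : int)%:~R < k%:~R :> R by rewrite mulrN1z.
by rewrite ltr_int; lia.
Qed.

Lemma half_turn s : 2 <= enorm (g (s + pi) - g s).
Proof.
have H := chord_sq us TL (_ : s <= s + pi) (_ : s + pi - s <= pi).
rewrite -(@ler_pXn2r _ 2) ?nnegrE ?enorm_ge0 // enorm_sq.
have {}H := H (ltac:(have := pi_ge0 R; lra)) (ltac:(lra)).
have E : s + pi - s = pi by lra.
by rewrite E cospi mulr2n in H; lra.
Qed.

(** Two points of [g] at arc distance at least [pi] and Euclidean distance less
    than 2 can be moved to a closest such pair; as points at arc distance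
    exactly [pi] are at distance at least 2, that pair is a critical point of
    the distance. *)
Lemma far_pairs : (forall s t, dcp g T s t -> 2 <= enorm (g s - g t)) ->
  forall s t, pi <= t - s <= l - pi -> 2 <= enorm (g t - g s).
Proof.
move=> hd.
have [lpi|lpi] := ltP (l - pi) pi.
  by move=> s t /andP[h1 h2]; move: (le_lt_trans (le_trans h1 h2) lpi); rewrite ltxx.
pose f (p : R * R) := dot (g (p.1 + p.2) - g p.1) (g (p.1 + p.2) - g p.1).
have cf : continuous f by apply: vcont_dot; exact: vcont_chord.
have [[s0 d0] [/= _ /andP[p2 p3] Hp]] := rect_min (ltW l0) lpi cf.
have Hmin s d : pi <= d <= l - pi -> f (s0, d0) <= f (s, d).
  move=> hdd; have [k Hk] := mod_shift 0 s l0.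
  have -> : f (s, d) = f (s + k%:~R * l, d).
    by rewrite /f /= addrAC !periodicz.
  by apply: Hp => //=; rewrite subr0 in Hk; move: Hk => /andP[-> /ltW ->].
suff H : 2 <= enorm (g (s0 + d0) - g s0).
  move=> s t hst; apply: le_trans H _; rewrite /enorm ler_sqrt ?dot_ge0 //.
  by have := Hmin s (t - s) hst; rewrite /f /= [s + _]addrC subrK.
rewrite leNgt; apply/negP => H.
have d1 : pi < d0.
  rewrite lt_neqAle p2 andbT; apply/eqP => E; move: H; rewrite -E ltNge.
  by rewrite half_turn.
have d2 : d0 < l - pi.
  rewrite lt_neqAle p3 andbT; apply/eqP => E; move: H; rewrite E ltNge enormB.
  have -> : s0 + (l - pi) = s0 - pi + l by lra.
  rewrite pg; have := half_turn (s0 - pi); rewrite subrK => -> //.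
have pi0 := pi_gt0 R.
set v := g (s0 + d0) - g s0 in H.
have e1 : dot v (T (s0 + d0)) = 0.
  have D (x : R) : is_derive x 1 (fun x => dot (g x - g s0) (g x - g s0)) (dot (g x - g s0) (T x) *+ 2).
    have d : vder (fun x => g x - g s0) x (T x).
      by apply: (vder_eq (vderB (us.1 x) (vder_cst _ _))); rewrite subr0.
    by apply: (der_eq (vder_dot d d)); rewrite dotC.
  have := @derive1_at_min _ (fun x => dot (g x - g s0) (g x - g s0)) (s0 + pi) (s0 + (l - pi)) (s0 + d0).
  have h : s0 + pi <= s0 + (l - pi) by lra.
  have dv (t : R) : t \in `]s0 + pi, s0 + (l - pi)[ -> derivable (fun x => dot (g x - g s0) (g x - g s0)) t 1.
    by move=> _; case: (D t).
  have ic : s0 + d0 \in `]s0 + pi, s0 + (l - pi)[ by rewrite in_itv /=; lra.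
  move=> /(_ h dv ic) M.
  have {}M : is_derive (s0 + d0) 1 (fun x => dot (g x - g s0) (g x - g s0)) 0.
    apply: M => t; rewrite in_itv /= => /andP[t1 t2].
    have := Hmin s0 (t - s0); rewrite /f /= [s0 + (t - s0)]addrC subrK; apply; lra.
  by have := der_unique M (D _); rewrite -/v mulr2n; lra.
have e2 : dot v (T s0) = 0.
  set t0 := s0 + d0 in v e1 H *.
  have D (x : R) : is_derive x 1 (fun x => dot (g t0 - g x) (g t0 - g x)) (- (dot (g t0 - g x) (T x) *+ 2)).
    have d : vder (fun x => g t0 - g x) x (- T x).
      by apply: (vder_eq (vderB (vder_cst _ _) (us.1 x))); rewrite sub0r.
    by apply: (der_eq (vder_dot d d)); rewrite dotC dotNr mulr2n; lra.
  have := @derive1_at_min _ (fun x => dot (g t0 - g x) (g t0 - g x)) (t0 - (l - pi)) (t0 - pi) s0.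
  have h : t0 - (l - pi) <= t0 - pi by lra.
  have dv (t : R) : t \in `]t0 - (l - pi), t0 - pi[ -> derivable (fun x => dot (g t0 - g x) (g t0 - g x)) t 1.
    by move=> _; case: (D t).
  have ic : s0 \in `]t0 - (l - pi), t0 - pi[ by rewrite in_itv /= /t0; lra.
  move=> /(_ h dv ic) M.
  have {}M : is_derive s0 1 (fun x => dot (g t0 - g x) (g t0 - g x)) 0.
    apply: M => t; rewrite in_itv /= => /andP[t1 t2].
    have := Hmin t (t0 - t); rewrite /f /= [t + (t0 - t)]addrC subrK; apply; lra.
  by have := der_unique M (D _); rewrite -/v mulr2n; lra.
have : dcp g T s0 (s0 + d0).
  split; first by apply: chord_neq; lra.
    by rewrite -opprB dotNl -/v e2 oppr0.
  by rewrite -opprB dotNl -/v e1 oppr0.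
by move/hd; rewrite enormB -/v; lra.
Qed.

(** Points at arc distance at most [pi] are governed by [arc_ball], in both
    directions of travel, and the others by [far_pairs]. *)
Lemma ball_sep : (forall s t, dcp g T s t -> 2 <= enorm (g s - g t)) ->
  forall s t a, dot a (T s) = 0 -> enorm a <= 1 ->
  2 * dot a (g t - g s) <= enorm (g t - g s) ^+ 2.
Proof.
move=> hd s t a aT a1; have [k Hk] := mod_shift s t l0.
rewrite -(periodicz k t pg); set u := t + _ in Hk *.
have [h|h] := leP (u - s) pi.
  by apply: (arc_ball_sym us TL) => //; move: Hk => /andP[h0 _]; rewrite ger0_norm.
have [h'|h'] := leP (u - s) (l - pi).
  have := far_pairs hd (_ : pi <= u - s <= l - pi); rewrite (ltW h) h' => /(_ isT).
  have := dot_le a (g u - g s); have := enorm_ge0 (g u - g s); nra.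
have -> : g u = g (u - l) by rewrite -[in LHS](subrK l u) pg.
apply: (arc_ball_sym us TL) => //; move: Hk => /andP[h0 h1]; rewrite ler_norml; lra.
Qed.

End Fixed.

(** Where the parameters of two points are at least [1 / 4] apart, compactness
    bounds away from 0 their distance and the function [f2], whose zeros are
    the double critical pairs at distance at most 2. Two points with closer
    parameters neither collide nor are critical, as the chord makes an acute
    angle with the tangent. *)
Lemma nearby_curve l g T : closed_unit l g T -> lip1 T ->
  (forall s t, dcp g T s t -> 2 < enorm (g s - g t)) ->
  exists2 e : R, 0 < e & forall h H : R -> V,
    (forall s, vder h s (H s)) -> periodic h l ->
    (forall s, enorm (h s - g s) <= e) -> (forall s, enorm (H s - T s) <= e) ->
    injective_mod l h /\
    (forall s t, dcp h H s t -> 2 <= enorm (h s - h t)).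
Proof.
move=> cu TL hd; case: (cu) => l0 us pg ig.
have cg : vcont g by exact: vder_vcont us.1.
have cT : vcont T by exact: lip1_vcont.
have pT : periodic T l by exact: der_periodic us.1 pg.
pose v (p : R * R) := g (p.1 + p.2) - g p.1.
have cv : vcont v by exact: vcont_chord.
pose f1 (p : R * R) := enorm (v p).
pose f2 (p : R * R) := `|dot (v p) (T p.1)| + `|dot (v p) (T (p.1 + p.2))| + Num.max 0 (enorm (v p) - 2).
have c1 : continuous f1 by exact: vcont_enorm.
have c2 : continuous f2.
  have cn (F : R * R -> R) : continuous F -> continuous (fun p => `|F p|).
    move=> cF p; apply: (@continuous_comp _ _ _ F (fun x : R => `|x|)); first exact: cF.
    exact: norm_continuous.
  have cTs : vcont (fun p : R * R => T p.1) by apply: vcont_comp => //; exact: cont_fst.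
  have cTt : vcont (fun p : R * R => T (p.1 + p.2)) by apply: vcont_comp => //; exact: cont_pair_add.
  move=> p; apply: cvgD; first by apply: cvgD; apply: cn; exact: vcont_dot.
  apply: (@continuous_max _ _ (fun=> 0) (fun p => f1 p - 2)); first exact: cvg_cst.
  by apply: cvgB; [exact: c1|exact: cvg_cst].
have f10 q : 0 <= q.1 <= l -> 1 / 4 <= q.2 <= l - 1 / 4 -> 0 < f1 q.
  move=> _ q2; apply: enorm_gt0; rewrite subr_eq0 eq_sym; apply: (chord_neq cu); lra.
have f20 q : 0 <= q.1 <= l -> 1 / 4 <= q.2 <= l - 1 / 4 -> 0 < f2 q.
  move=> q1 q2; rewrite lt_neqAle; apply/andP; split; last first.
    by rewrite /f2 !addr_ge0 ?normr_ge0 // le_max lexx.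
  apply/eqP => E.
  have n1 := normr_ge0 (dot (v q) (T q.1)).
  have n2 := normr_ge0 (dot (v q) (T (q.1 + q.2))).
  have n3 : 0 <= Num.max 0 (enorm (v q) - 2) by rewrite le_max lexx.
  have E1 : dot (v q) (T q.1) = 0 by apply/normr0_eq0; rewrite /f2 in E; lra.
  have E2 : dot (v q) (T (q.1 + q.2)) = 0 by apply/normr0_eq0; rewrite /f2 in E; lra.
  have E3 : enorm (v q) - 2 <= 0.
    by have : enorm (v q) - 2 <= Num.max 0 (enorm (v q) - 2); [rewrite le_max lexx orbT|rewrite /f2 in E; lra].
  suff D : dcp g T (q.1 + q.2) q.1 by have := hd _ _ D; rewrite -/(v q); lra.
  by split=> //; rewrite eq_sym; apply: (chord_neq cu); lra.
have [m1 m10 H1] := rect_gt0 c1 f10.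
have [m2 m20 H2] := rect_gt0 c2 f20.
pose e := Num.min (1 / 10) (Num.min (m1 / 4) (m2 / 20)).
have e0 : 0 < e by rewrite !lt_min !divr_gt0.
have e1 : e <= 1 / 10 by rewrite ge_min lexx.
have e2 : e <= m1 / 4 by rewrite !ge_min lexx orbT.
have e3 : e <= m2 / 20 by rewrite !ge_min lexx !orbT.
exists e => // h H hder ph hg HT.
have pH : periodic H l by exact: der_periodic hder ph.
have near s t : 0 < t - s <= 1 / 4 -> 0 < dot (h t - h s) (H s).
  move=> /andP[st0 st]; have st' : s <= t by lra.
  have D1 x : s <= x <= t -> is_derive x 1 (fun x => 2^-1 * x) (2^-1).
    by move=> _; apply: (der_eq (derZ _ (der_id x))); rewrite mulr1.
  have D2 x : s <= x <= t -> is_derive x 1 (fun x => dot (h x) (H s)) (dot (H x) (H s)).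
    by move=> _; exact: hder.
  have := der_le st' D1 D2; rewrite dotBl => K.
  suff : 2^-1 * t - 2^-1 * s <= dot (h t) (H s) - dot (h s) (H s) by lra.
  apply: K => x /andP[sx xt].
  have := HT x; have := HT s; move: (H x) (H s) => A B a1 a2.
  have -> : A = T x + (A - T x) by rewrite addrC subrK.
  have -> : B = T s + (B - T s) by rewrite addrC subrK.
  rewrite dotDl (dotDr (T x) (T s)) (dotDr (A - T x) (T s)).
  have b1 := dot_ler_norm (T x) (B - T s).
  have b2 := dot_ler_norm (A - T x) (T s).
  have b3 := dot_ler_norm (A - T x) (B - T s).
  rewrite us.2 mul1r in b1; rewrite us.2 mulr1 in b2.
  move: b1 b2 b3; rewrite !ler_norml => /andP[b1 _] /andP[b2 _] /andP[b3 _].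
  have := TL x s; rewrite ger0_norm ?subr_ge0 // => b4.
  have b5 : enorm (T x - T s) ^+ 2 <= (x - s) ^+ 2.
    by rewrite ler_pXn2r // ?nnegrE ?enorm_ge0 ?subr_ge0.
  rewrite enorm_sq !dotE !(unit_dot _ us.2) (dotC (T s)) in b5.
  have b6 : enorm (A - T x) * enorm (B - T s) <= e * e by apply: ler_pM => //; exact: enorm_ge0.
  have b7 : e * e <= 1 / 100 by nra.
  have b8 : (x - s) ^+ 2 <= 1 / 16 by rewrite expr2; nra.
  lra.
have near_pair s t : 0 < t - s < l -> t - s <= 1 / 4 \/ l - 1 / 4 <= t - s ->
    0 < dot (h t - h s) (H s) \/ 0 < dot (h s - h t) (H t).
  move=> st; case=> c; first by left; apply: near; lra.
  by right; rewrite -(ph s); apply: near; lra.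
have vh s t : enorm ((h t - h s) - (g t - g s)) <= 2 * e.
  have -> : (h t - h s) - (g t - g s) = (h t - g t) - (h s - g s).
    by apply/rowP => i; rewrite !mxE; ring.
  by have := enormBD (h t - g t) (h s - g s); have := hg t; have := hg s; lra.
split.
  move=> s t E; have [k Hk] := mod_shift s t l0.
  have E' : h (t + k%:~R * l) = h s by rewrite periodicz.
  set u := t + _ in Hk E'.
  have [u0|u0] := eqVneq u s; first by exists k.
  exfalso.
  have us0 : 0 < u - s by rewrite lt_neqAle eq_sym subr_eq0 u0; case/andP: Hk.
  have usl : 0 < u - s < l by rewrite us0; case/andP: Hk.
  have nn : ~ (0 < dot (h u - h s) (H s) \/ 0 < dot (h s - h u) (H u)).
    by rewrite E' subrr !dot0l ltxx; case.
  have [c|c] := leP (u - s) (1 / 4); first by apply: nn; apply: near_pair => //; left.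
  have [c'|c'] := leP (l - 1 / 4) (u - s); first by apply: nn; apply: near_pair => //; right.
  have [j Hj] := mod_shift 0 s l0.
  have := H1 (s + j%:~R * l, u - s); rewrite /f1 /v /= [s + _ + (u - s)]addrC addrA subrK (periodicz j u pg) (periodicz j s pg).
  have := vh s u; rewrite E' subrr sub0r enormN => h1 h2.
  have := h2 ltac:(clear -Hj; lra) ltac:(clear -c c'; lra); clear -h1 e0 e2; lra.
move=> s t [N E1 E2]; rewrite leNgt; apply/negP => lt2.
have [k Hk] := mod_shift s t l0.
have hu : h (t + k%:~R * l) = h t by rewrite periodicz.
have Hu : H (t + k%:~R * l) = H t by rewrite periodicz.
set u := t + _ in Hk hu Hu; rewrite -Hu -hu in E2; rewrite -hu in N E1 lt2.
have us0 : 0 < u - s.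
  rewrite lt_neqAle eq_sym subr_eq0; case/andP: Hk => -> _; rewrite andbT.
  by apply: contraNneq N => ->.
have usl : 0 < u - s < l by rewrite us0; case/andP: Hk.
have nn : ~ (0 < dot (h u - h s) (H s) \/ 0 < dot (h s - h u) (H u)).
  by rewrite E2 -opprB dotNl E1 oppr0 ltxx; case.
have [c|c] := leP (u - s) (1 / 4); first by apply: nn; apply: near_pair => //; left.
have [c'|c'] := leP (l - 1 / 4) (u - s); first by apply: nn; apply: near_pair => //; right.
have [j Hj] := mod_shift 0 s l0.
have := H2 (s + j%:~R * l, u - s); rewrite /f2 /v /= [s + _ + (u - s)]addrC addrA subrK (periodicz j u pg) (periodicz j s pg)
  (periodicz j u pT) (periodicz j s pT).
rewrite leNgt => /(_ ltac:(clear -Hj; lra) ltac:(clear -c c'; lra))/negP; apply.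
have := vh s u.
rewrite enormB in lt2; rewrite -opprB dotNl in E1; rewrite -opprB dotNl in E2.
have bd (x : R) : dot (h u - h s) (H x) = 0 -> `|dot (g u - g s) (T x)| <= 4 * e.
  move=> E0.
  have -> : dot (g u - g s) (T x) =
     - dot ((h u - h s) - (g u - g s)) (T x) - dot (h u - h s) (H x - T x).
    by rewrite (dotBl (h u - h s)) (dotBr (h u - h s) (H x)) E0; lra.
  have b1 := dot_ler_norm ((h u - h s) - (g u - g s)) (T x).
  have b2 := dot_ler_norm (h u - h s) (H x - T x).
  rewrite us.2 mulr1 in b1.
  apply: le_trans (ler_normB _ _) _; rewrite normrN.
  have b3 : enorm (h u - h s) * enorm (H x - T x) <= 2 * e.
    by apply: ler_pM; rewrite ?enorm_ge0 // ltW.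
  have := vh s u; move: b1 b2; clear -b3 e0; lra.
have b1 := bd s (ltac:(clear -E1; lra)); have b2 := bd u (ltac:(clear -E2; lra)).
move=> hv; have := enorm_sub_ge (g u - g s) (h u - h s).
rewrite (enormB (g u - g s)) => b3.
have : Num.max 0 (enorm (g u - g s) - 2) <= 2 * e by rewrite ge_max; apply/andP; split; clear -hv lt2 e0 b3; lra.
clear -b1 b2 e0 e3; lra.
Qed.

End ClosedUnit.

(** * Lipschitz functions and periodic tents *)

Section Lipschitz.
Context {R : realType} {n : nat}.
Notation V := 'rV[R]_n.
Implicit Types (a b : R -> R) (f g : R -> V).

Definition Lip a := exists K, forall s t, `|a s - a t| <= K * `|s - t|.
Definition vLip f := exists K, forall s t, enorm (f s - f t) <= K * `|s - t|.
Definition bdd a := exists B, forall s, `|a s| <= B.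
Definition vbdd f := exists B, forall s, enorm (f s) <= B.

Lemma Lip_cont a : Lip a -> continuous a.
Proof.
move=> [K HK] s; apply/cvgrPdist_le => e e0.
have K1 : 0 < `|K| + 1 by have := normr_ge0 K; lra.
exists (e / (`|K| + 1)) => /=; first by rewrite divr_gt0.
move=> t; rewrite /ball /= ltr_pdivlMr // => st.
apply: le_trans (HK s t) _.
have := ler_norm K; have := normr_ge0 (s - t); nra.
Qed.

Lemma vLip_vcont f : vLip f -> vcont f.
Proof.
move=> [K HK] b; apply: Lip_cont; exists (K * enorm b) => s t.
rewrite -dotBl; apply: le_trans (dot_ler_norm _ _) _.
by rewrite mulrAC ler_wpM2r ?enorm_ge0.
Qed.

Lemma Lip_cst (c : R) : Lip (fun=> c).
Proof. by exists 0 => s t; rewrite subrr normr0 mul0r. Qed.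

Lemma LipD a b : Lip a -> Lip b -> Lip (fun s => a s + b s).
Proof.
move=> [K HK] [M HM]; exists (K + M) => s t; rewrite opprD addrACA mulrDl.
by apply: le_trans (ler_normD _ _) _; exact: lerD.
Qed.

Lemma LipN a : Lip a -> Lip (fun s => - a s).
Proof. by move=> [K HK]; exists K => s t; rewrite -opprD normrN. Qed.

Lemma LipZ c a : Lip a -> Lip (fun s => c * a s).
Proof.
move=> [K HK]; exists (`|c| * K) => s t; rewrite -mulrBr normrM -mulrA.
by rewrite ler_wpM2l.
Qed.

Lemma vLipD f g : vLip f -> vLip g -> vLip (fun s => f s + g s).
Proof.
move=> [K HK] [M HM]; exists (K + M) => s t; rewrite opprD addrACA mulrDl.
by apply: le_trans (enormD _ _) _; exact: lerD.
Qed.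

Lemma vLip_cst v : vLip (fun=> v).
Proof. by exists 0 => s t; rewrite subrr enorm0 mul0r. Qed.

Lemma vLip_dot f g : vLip f -> vbdd f -> vLip g -> vbdd g ->
  Lip (fun s => dot (f s) (g s)).
Proof.
move=> [K HK] [B HB] [M HM] [C HC]; exists (K * C + B * M) => s t.
have -> : dot (f s) (g s) - dot (f t) (g t) = dot (f s - f t) (g s) + dot (f t) (g s - g t).
  by rewrite dotBl dotBr; lra.
apply: le_trans (ler_normD _ _) _; rewrite mulrDl; apply: lerD.
  apply: le_trans (dot_ler_norm _ _) _; rewrite mulrAC.
  by apply: ler_pM; rewrite ?enorm_ge0.
apply: le_trans (dot_ler_norm _ _) _; rewrite -mulrA.
by apply: ler_pM; rewrite ?enorm_ge0.
Qed.

Lemma vLip_scale a f : Lip a -> bdd a -> vLip f -> vbdd f ->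
  vLip (fun s => a s *: f s).
Proof.
move=> [K HK] [B HB] [M HM] [C HC]; exists (K * C + B * M) => s t.
have -> : a s *: f s - a t *: f t = (a s - a t) *: f s + a t *: (f s - f t).
  by rewrite scalerBl scalerBr addrA subrK.
apply: le_trans (enormD _ _) _; rewrite !enormZ mulrDl; apply: lerD.
  rewrite mulrAC; by apply: ler_pM; rewrite ?enorm_ge0.
rewrite -mulrA; by apply: ler_pM; rewrite ?enorm_ge0.
Qed.

Lemma vder_vLip f (f' : R -> V) : (forall s, vder f s (f' s)) -> vbdd f' -> vLip f.
Proof. by move=> fd [B HB]; exists B; exact: vder_lip. Qed.

Lemma vder_slope f s v (e : R) : vder f s v -> 0 < e -> exists2 d, 0 < d &
  forall t, `|t - s| < d -> enorm (f t - f s) <= (enorm v + e) * `|t - s|.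
Proof.
move=> fd e0.
have n0 : 0 < n%:R + 1 :> R by rewrite ltr_wpDl.
pose A (i : 'I_n) (t : R) : Prop :=
  `|(f t - f s - (t - s) *: v) ord0 i| <= e / (n%:R + 1) * `|t - s|.
have H (i : 'I_n) : nbhs s (A i).
  have /der_edP/(_ _ (divr_gt0 e0 n0)) [d d0 Hd] := fd (delta_mx ord0 i).
  exists d => //= t; rewrite /ball /= distrC => /Hd.
  by rewrite /A !dot_delta !mxE [v _ _ * _]mulrC.
have {}H := @filter_forall R 'I_n A (nbhs s) _ H.
move: H => [d /= d0 Hd]; exists d => // t ts.
have {Hd} : forall i : 'I_n, `|(f t - f s - (t - s) *: v) ord0 i| <= e / (n%:R + 1) * `|t - s|.
  by apply: Hd; rewrite /ball /= distrC.
set u := f t - f s - _ => Hu.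
have -> : f t - f s = u + (t - s) *: v by rewrite /u subrK.
apply: le_trans (enormD _ _) _; rewrite enormZ mulrDl [enorm v * _]mulrC addrC lerD2l.
apply: le_trans (enorm_le_norm u) _.
have h0 : 0 <= e / (n%:R + 1) * `|t - s|.
  by rewrite mulr_ge0 // divr_ge0 // ltW.
have : `|u| <= e / (n%:R + 1) * `|t - s|.
  rewrite /Num.Def.normr/= mx_normrE; apply: bigmax_le; last by move=> [i j] _; rewrite /= (ord1 i).
  exact: h0.
move=> H; apply: le_trans (ler_wpM2l (ler0n _ _) H) _.
rewrite mulrA ler_wpM2r // mulrCA ger_pMr // ler_pdivrMr //; lra.
Qed.

(** The positive part of a cosine of period [l] minus a constant. *)
Lemma bump_exists (l s0 r : R) : 0 < l -> 0 < r -> r <= l / 4 ->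
  exists beta : R -> R, [/\ periodic beta l, Lip beta, (forall s, 0 <= beta s <= 2),
    (forall s, `|s - s0| < r -> 0 < beta s) &
    (forall s, beta s != 0 -> exists k : int, `|s + k%:~R * l - s0| < r)].
Proof.
move=> l0 r0 rl; have pi0 := pi_gt0 R.
pose c := 2 * pi / l.
have c0 : 0 < c by rewrite divr_gt0 // mulr_gt0.
have cl : c * l = pi *+ 2 by rewrite /c mulr2n mulfVK ?gt_eqF //; lra.
have crpi : c * r <= pi / 2.
  have : c * r <= c * (l / 4) by rewrite ler_pM2l.
  by rewrite mulrA cl mulr2n; lra.
have cr0 : 0 < c * r by rewrite mulr_gt0.
pose beta s := Num.max 0 (cos (c * (s - s0)) - cos (c * r)).
have abs x : `|x| <= l / 2 -> (0 < cos (c * x) - cos (c * r)) = (`|x| < r).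
  move=> xl; rewrite subr_gt0 -(cos_norm (c * x)) normrM (gtr0_norm c0).
  have H : c * `|x| <= pi.
    have : c * `|x| <= c * (l / 2) by rewrite ler_pM2l.
    by rewrite mulrA cl mulr2n; lra.
  have h1 : c * r \in `[0, pi] by rewrite in_itv /=; lra.
  have h2 : c * `|x| \in `[0, pi] by rewrite in_itv /= H mulr_ge0 // ltW.
  by rewrite ltr_cos // ltr_pM2l.
exists beta; split.
- by move=> s; rewrite /beta addrAC mulrDr cl cosD2pi.
- exists c => s t; rewrite /beta.
  have H (x y : R) : `|cos x - cos y| <= `|x - y|.
    have [xy|/ltW yx] := leP x y.
      have D1 z : x <= z <= y -> is_derive z 1 (@cos R) (- sin z).
        by move=> _; exact: is_derive_cos.
      have D2 z : x <= z <= y -> is_derive z 1 (fun t : R => t) 1.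
        by move=> _; exact: der_id.
      have h z : x <= z <= y -> - sin z <= 1 by move=> _; have := sin_geN1 z; lra.
      have h1 := der_le xy D1 D2 h; have h2 := cos_lip xy.
      rewrite (distrC x) (ger0_norm (_ : 0 <= y - x)) ?subr_ge0 // ler_norml; lra.
    have D1 z : y <= z <= x -> is_derive z 1 (@cos R) (- sin z).
      by move=> _; exact: is_derive_cos.
    have D2 z : y <= z <= x -> is_derive z 1 (fun t : R => t) 1.
      by move=> _; exact: der_id.
    have h z : y <= z <= x -> - sin z <= 1 by move=> _; have := sin_geN1 z; lra.
    have h1 := der_le yx D1 D2 h; have h2 := cos_lip yx.
    rewrite (ger0_norm (_ : 0 <= x - y)) ?subr_ge0 // ler_norml; lra.
  have M (x y : R) : `|Num.max 0 x - Num.max 0 y| <= `|x - y|.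
    rewrite /Num.max; case: ifP => hx; case: ifP => hy; rewrite ?subrr ?normr0 ?subr0 ?sub0r ?normrN //.
      rewrite ltNge in hy; move/negPn: hy => hy; rewrite [leRHS]ger0_norm ?gtr0_norm //; lra.
    rewrite ltNge in hx; move/negPn: hx => hx; rewrite (distrC x) [leRHS]ger0_norm ?gtr0_norm //; lra.
  apply: le_trans (M _ _) _.
  have -> : cos (c * (s - s0)) - cos (c * r) - (cos (c * (t - s0)) - cos (c * r))
    = cos (c * (s - s0)) - cos (c * (t - s0)) by lra.
  apply: le_trans (H _ _) _.
  have -> : c * (s - s0) - c * (t - s0) = c * (s - t) by lra.
  by rewrite normrM (gtr0_norm c0).
- move=> s; rewrite /beta le_max lexx /= ge_max.
  by have := cos_le1 (c * (s - s0)); have := cos_geN1 (c * r); lra.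
- by move=> s sr; rewrite /beta lt_max abs ?sr ?orbT //; lra.
- move=> s; rewrite /beta => H.
  have [k Hk] := mod_shift (s0 - l / 2) s l0; exists k.
  rewrite -abs; last by rewrite ler_norml; lra.
  have -> : cos (c * (s + k%:~R * l - s0)) = cos (c * (s - s0)).
    have -> : c * (s + k%:~R * l - s0) = c * (s - s0) + k%:~R * (pi *+ 2) by rewrite -cl; lra.
    exact: (periodicz k _ (@cosD2pi R)).
  rewrite ltNge; apply: contraNN H => H; apply/eqP.
  by apply/max_idPl.
Qed.

End Lipschitz.

(** * Extremality, and straightness where curvature is available *)

Section NoGain.
Context {R : realType} {n : nat}.
Notation V := 'rV[R]_n.
Implicit Types (T P : R -> V) (l s t : R).

(** Extremality in the form used below. A competitor is a closed curve whose
    derivative [w s *: P s] is close to [T]; the factor [w] stretches the curve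
    without turning it. As the direction of [P] has slope [|P'| / |P|] at most,
    the hypothesis on the slopes of [P] says that the competitor has curvature
    at most [k]. The product of length and curvature bound is not lowered. *)
Definition no_gain l T := exists2 e0 : R, 0 < e0 &
  forall (P : R -> V) (w : R -> R) (k : R),
    [/\ periodic P l, periodic w l, vLip P & Lip w] ->
    (forall s, 0 < w s) -> (forall s, P s != 0) -> 1 <= k ->
    (forall s, enorm (w s *: P s - T s) <= e0) ->
    vitg (fun s => w s *: P s) 0 l = 0 ->
    (forall s e, 0 < e -> exists2 d, 0 < d & forall t, `|t - s| < d ->
       enorm (P t - P s) <= (k * w s * enorm (P s) ^+ 2 + e) * `|t - s|) ->
    l <= k * itg (fun s => w s * enorm (P s)) 0 l.

Lemma vitgD (f g : R -> V) a b : vcont f -> vcont g ->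
  vitg (fun s => f s + g s) a b = vitg f a b + vitg g a b.
Proof.
move=> cf cg; apply: dot_eqP => u.
rewrite dotDl !dot_vitg //; last exact: vcontD.
rewrite -itgD; [|exact: cf|exact: cg].
by congr itg; apply/funext => s; rewrite dotDl.
Qed.

Lemma vitgZ (c : R) (f : R -> V) a b : vcont f ->
  vitg (fun s => c *: f s) a b = c *: vitg f a b.
Proof.
move=> cf; apply: dot_eqP => u.
have cc : vcont (fun s => c *: f s) by apply: vcontZ => // x; exact: cvg_cst.
rewrite dotZl !dot_vitg // -itgZ; last exact: cf.
by congr itg; apply/funext => s; rewrite dotZl.
Qed.

Lemma contM (a b : R -> R) : continuous a -> continuous b -> continuous (fun s => a s * b s).
Proof. by move=> ca cb s; apply: cvgM; [exact: ca|exact: cb]. Qed.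

Lemma contD (a b : R -> R) : continuous a -> continuous b -> continuous (fun s => a s + b s).
Proof. by move=> ca cb s; apply: cvgD; [exact: ca|exact: cb]. Qed.

Lemma contB (a b : R -> R) : continuous a -> continuous b -> continuous (fun s => a s - b s).
Proof. by move=> ca cb s; apply: cvgB; [exact: ca|exact: cb]. Qed.

Lemma cont_cst (c : R) : continuous (fun _ : R => c).
Proof. by move=> s; exact: cvg_cst. Qed.

Lemma bump_off (beta : R -> R) l s0 r r' s : r' < r ->
  (forall s, beta s != 0 -> exists k : int, `|s + k%:~R * l - s0| < r') ->
  (forall k : int, r <= `|s + k%:~R * l - s0|) ->
  forall t, `|t - s| < r - r' -> beta t = 0.
Proof.
move=> rr hb hs t ts; apply/eqP/negPn/negP => /hb [k hk].
have := hs k; have -> : s + k%:~R * l - s0 = (s - t) + (t + k%:~R * l - s0) by ring.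
by have := ler_normD (s - t) (t + k%:~R * l - s0); rewrite (distrC s); lra.
Qed.

(** Where the curvature is strictly less than 1 the curve is straight: pushing
    the tangent towards its weighted mean [m] over the interval keeps the curve
    closed, shortens it to first order, and uses curvature that is available. *)
Lemma slack_straight l (g T : R -> V) (s0 r eta : R) :
  closed_unit l g T -> lip1 T -> no_gain l T -> 0 < r -> r <= l / 4 -> 0 < eta ->
  (forall s t, `|s - s0| < r -> `|t - s0| < r ->
     enorm (T s - T t) <= (1 - eta) * `|s - t|) ->
  forall s, `|s - s0| < r / 2 -> T s = T s0.
Proof.
move=> cu TL ng r0 rl eta0 slack s.
case: (cu) => l0 us pg _; have pT : periodic T l := der_periodic us.1 pg.
have T1 := us.2; have cT : vcont T := lip1_vcont TL.
have r2 : 0 < r / 2 by rewrite divr_gt0.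
have rl2 : r / 2 <= l / 4 by move: rl r0; lra.
have [beta [pb [K HK] b02 bpos bsupp]] := @bump_exists R l s0 (r / 2) l0 r2 rl2.
have cb : continuous beta by apply: Lip_cont; exists K.
have b2 s' : 0 <= beta s' by case/andP: (b02 s').
have b3 s' : beta s' <= 2 by case/andP: (b02 s').
have perb (f : R -> R) : continuous f -> periodic f l -> itg f 0 l = itg f (s0 - l / 2) (s0 + l / 2).
  move=> cf pf; have := itg_period 0 (s0 - l / 2) cf pf; rewrite add0r => ->.
  by congr itg; lra.
pose b := itg beta 0 l.
have b0 : 0 < b.
  rewrite /b perb //; apply: (@itg_gt0 _ _ _ _ s0) => //; first by lra.
  by apply: bpos; rewrite subrr normr0.
have cbT : vcont (fun s => beta s *: T s) by exact: vcontZ.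
pose m := b^-1 *: vitg (fun s => beta s *: T s) 0 l.
have bm : vitg (fun s => beta s *: T s) 0 l = b *: m.
  by rewrite /m scalerA mulfV ?scale1r // gt_eqF.
have m1 : enorm m <= 1.
  rewrite -(ler_pM2l b0) mulr1; have -> : b * enorm m = enorm (b *: m).
    by rewrite (enormZ b) gtr0_norm.
  rewrite -bm; apply: enorm_vitg => //; first exact: ltW.
  by move=> x _; rewrite enormZ T1 mulr1 ger0_norm.
clearbody m.
have mm : dot m m = enorm m ^+ 2 by rewrite enorm_sq.
have cbm : continuous (fun s => beta s * dot m (T s)).
  by apply: contM => //; apply: vcont_dot => //; exact: vcont_cst.
have ibm : itg (fun s => beta s * dot m (T s)) 0 l = b * enorm m ^+ 2.
  rewrite -mm -dotZl -bm dot_vitg //; congr itg; apply/funext => x.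
  by rewrite dotZl dotC.
pose xi s := beta s *: (m - T s).
have lT : vLip T by exists 1 => x y; rewrite mul1r.
have bT : vbdd T by exists 1 => x; rewrite T1.
have mT s' : enorm (m - T s') <= 2.
  by apply: le_trans (enormBD _ _) _; rewrite T1; lra.
have lmT : vLip (fun s => m - T s).
  by exists 1 => x y; rewrite mul1r opprB addrC addrA subrK enormB.
have lxi : vLip xi.
  apply: vLip_scale => //; first by exists K.
    by exists 2 => x; rewrite ger0_norm.
  by exists 2.
have cxi : vcont xi := vLip_vcont lxi.
have xi4 s' : enorm (xi s') <= 4.
  rewrite enormZ ger0_norm //; have := enorm_ge0 (m - T s'); have := b3 s'; have := b2 s'; have := mT s'.
  by nra.
have pxi : periodic xi l by move=> x; rewrite /xi pb pT.
have ixi : vitg xi 0 l = 0.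
  have -> : xi = fun s => beta s *: m + (-1) *: (beta s *: T s).
    by apply/funext => x; rewrite /xi scalerBr scaleN1r.
  have c1 : vcont (fun s => beta s *: m) by apply: vcontZ => //; exact: vcont_cst.
  have c2 : vcont (fun s => -1 *: (beta s *: T s)) by apply: vcontZ => //; exact: cont_cst.
  rewrite vitgD // vitgZ // bm.
  suff -> : vitg (fun s => beta s *: m) 0 l = b *: m by rewrite scaleN1r subrr.
  apply: dot_eqP => u; rewrite dot_vitg // dotZl.
  rewrite (_ : (fun s => _) = fun s => dot m u * beta s); first by rewrite itgZ // mulrC.
  by apply/funext => x; rewrite dotZl mulrC.
have [Kx HKx] := lxi.
have iT : vitg T 0 l = 0.
  by rewrite (vitgE 0 l cT us.1) -{1}(add0r l) pg subrr.
have [e0 e00 NG] := ng.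
pose K' := `|Kx|; have K'0 : 0 <= K' by exact: normr_ge0.
pose d1 := Num.min (eta / (8 + K')) (Num.min (e0 / 4) (1 / 100)).
have K8 : 0 < 8 + K' by lra.
have d10 : 0 < d1 by rewrite !lt_min !divr_gt0.
(* The first variation of the length in the direction [xi] with step [d]; the
   error is quadratic. *)
have key d : 0 < d -> d <= d1 -> b * (1 - enorm m ^+ 2) <= 8 * d * l.
  move=> d0 dd1.
  have de1 : d * (8 + K') <= eta by rewrite -ler_pdivlMr // (le_trans dd1) // ge_min lexx.
  have de2 : d <= e0 / 4 by rewrite (le_trans dd1) // !ge_min lexx orbT.
  have de3 : d <= 1 / 100 by rewrite (le_trans dd1) // !ge_min lexx !orbT.
  pose P s := T s + d *: xi s.
  have lP : vLip P by apply: vLipD => //; apply: vLip_scale => //; [exact: Lip_cst|exists `|d| => x|exists 4].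
  have cP : vcont P := vLip_vcont lP.
  have Psq s' : enorm (P s') ^+ 2 = 1 + 2 * d * dot (xi s') (T s') + d ^+ 2 * enorm (xi s') ^+ 2.
    rewrite /P !enorm_sq; move: (xi s') => v; rewrite !dotE (unit_dot _ T1) (dotC (T s') v); ring.
  have Plow s' : 1 - 8 * d <= enorm (P s') ^+ 2.
    rewrite Psq; have := dot_ler_norm (xi s') (T s'); rewrite T1 mulr1 ler_norml => /andP[h _].
    have h2 := xi4 s'; have h3 := sqr_ge0 (enorm (xi s')).
    have : - 4 <= dot (xi s') (T s') by lra.
    have : 0 <= d ^+ 2 * enorm (xi s') ^+ 2 by rewrite mulr_ge0 ?sqr_ge0.
    by nra.
  have H : l <= 1 * itg (fun s => 1 * enorm (P s)) 0 l.
    apply: (NG P (fun=> 1) 1).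
    - by split=> //; [move=> x; rewrite /P pT pxi|exact: Lip_cst].
    - by [].
    - move=> x; apply/eqP => E; have := Plow x; rewrite E enorm0 expr0n /=; lra.
    - by [].
    - move=> x; rewrite scale1r /P addrC addKr enormZ gtr0_norm //.
      by have := xi4 x; nra.
    - rewrite (_ : (fun s => _) = P); last by apply/funext => x; rewrite scale1r.
      rewrite vitgD // ?vitgZ // ?ixi ?iT ?scaler0 ?addr0 //.
      by apply: vcontZ => //; exact: cont_cst.
    - move=> x e ep; rewrite !mul1r.
      have [near|far] := pselect (exists k : int, `|x + k%:~R * l - s0| < r).
        have [k Hk] := near; exists (r - `|x + k%:~R * l - s0|); first by rewrite subr_gt0.
        move=> t tx.
        have Ht : `|t + k%:~R * l - s0| < r.
          have -> : t + k%:~R * l - s0 = (t - x) + (x + k%:~R * l - s0) by ring.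
          by apply: le_lt_trans (ler_normD _ _) _; clear -tx; lra.
        have := slack _ _ Ht Hk; rewrite !(periodicz _ _ pT).
        have -> : t + k%:~R * l - (x + k%:~R * l) = t - x by ring.
        move=> h1; have h2 := HKx t x.
        have -> : P t - P x = (T t - T x) + d *: (xi t - xi x).
          by rewrite /P opprD addrACA -scalerBr.
        apply: le_trans (enormD _ _) _; rewrite enormZ gtr0_norm //.
        have h3 : Kx <= K' := ler_norm Kx.
        have h4 := normr_ge0 (t - x); have h5 := Plow x.
        have h6 : Kx * `|t - x| <= K' * `|t - x| by rewrite ler_wpM2r.
        have h7 : d * enorm (xi t - xi x) <= d * (K' * `|t - x|).
          by rewrite ler_wpM2l ?(ltW d0) // (le_trans h2).
        have h8 : (1 - eta + d * K') * `|t - x| <= (enorm (P x) ^+ 2 + e) * `|t - x|.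
          by rewrite ler_wpM2r //; clear -h5 de1 ep; lra.
        clear -h1 h7 h8; lra.
      have off := @bump_off beta l s0 r (r / 2) x (ltac:(clear -r0; lra)) bsupp.
      have far' (k : int) : r <= `|x + k%:~R * l - s0|.
        by rewrite leNgt; apply/negP => h; apply: far; exists k.
      exists (r - r / 2); first by clear -r0; lra.
      move=> t tx; have hx : beta x = 0 by apply: (off far'); rewrite subrr normr0; clear -r0; lra.
      rewrite /P /xi (off far' t tx) hx !scale0r !scaler0 !addr0 T1 expr1n.
      apply: le_trans (TL t x) _; have := normr_ge0 (t - x); clear -ep; nra.
  have : itg (fun s => 1 * enorm (P s)) 0 l <=
     itg (fun s => (1 + 8 * d ^+ 2) + d * (beta s * dot m (T s) - beta s)) 0 l.
    apply: itg_le.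
    - by apply: contM; [exact: cont_cst|exact: vcont_enorm].
    - apply: contD; first exact: cont_cst.
      by apply: contM; [exact: cont_cst|exact: contB].
    - exact: ltW.
    - move=> x _; rewrite mul1r.
      have h1 := sqr_ge0 (enorm (P x) - 1); have := Psq x.
      have -> : dot (xi x) (T x) = beta x * dot m (T x) - beta x.
        by rewrite /xi dotZl dotBl (unit_dot _ T1); ring.
      have h2 : enorm (xi x) ^+ 2 <= 16 by have := xi4 x; have := enorm_ge0 (xi x); rewrite expr2; clear; nra.
      have h3 : d ^+ 2 * enorm (xi x) ^+ 2 <= d ^+ 2 * 16 by rewrite ler_wpM2l ?sqr_ge0.
      by nra.
  have -> : itg (fun s => (1 + 8 * d ^+ 2) + d * (beta s * dot m (T s) - beta s)) 0 l =
      (1 + 8 * d ^+ 2) * (l - 0) + d * (b * enorm m ^+ 2 - b).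
    rewrite itgD; [|exact: cont_cst|by apply: contM; [exact: cont_cst|exact: contB]].
    rewrite itgZ; last exact: contB.
    by rewrite itgB // ibm itg_cst.
  rewrite mul1r in H; move=> H2; have {H2}H3 := le_trans H H2.
  have H4 : d * (b * (1 - enorm m ^+ 2)) <= d * (8 * d * l) by clear -H3; lra.
  by rewrite ler_pM2l in H4.
have m1' : 1 <= enorm m ^+ 2.
  rewrite leNgt; apply/negP => h.
  have b1 : 0 < b * (1 - enorm m ^+ 2) by rewrite mulr_gt0 // subr_gt0.
  pose d := Num.min d1 (b * (1 - enorm m ^+ 2) / (16 * l)).
  have l16 : 0 < 16 * l by lra.
  have d0 : 0 < d by rewrite lt_min d10 divr_gt0.
  have h1 : d <= d1 by rewrite ge_min lexx.
  have h2 : d * (16 * l) <= b * (1 - enorm m ^+ 2) by rewrite -ler_pdivlMr // ge_min lexx orbT.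
  by have := key d d0 h1; nra.
suff H x : `|x - s0| < r / 2 -> T x = m.
  by move=> hs; rewrite (H s hs) (H s0) // subrr normr0.
move=> hx; have h1 : dot m (T x) <= 1.
  by apply: le_trans (dot_le _ _) _; rewrite T1 mulr1.
have h2 : dot m (T x) = 1.
  apply/eqP; rewrite eq_le h1 leNgt; apply/negP => h3.
  have cf : continuous (fun s => beta s - beta s * dot m (T s)) by exact: contB.
  have : 0 < itg (fun s => beta s - beta s * dot m (T s)) (s0 - l / 2) (s0 + l / 2).
    apply: (@itg_gt0 _ _ _ _ x) => //.
    - by move: hx; rewrite ltr_norml; lra.
    - move=> y _; rewrite -{1}[beta y]mulr1 -mulrBr mulr_ge0 // subr_ge0.
      by apply: le_trans (dot_le _ _) _; rewrite T1 mulr1.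
    - by rewrite -{1}[beta x]mulr1 -mulrBr mulr_gt0 ?subr_gt0 // bpos.
  rewrite -perb //; last by move=> y; rewrite pb pT.
  rewrite itgB // ibm -/b => h4; nra.
apply/eqP; rewrite -subr_eq0; apply/eqP/enorm_eq0/eqP.
rewrite -sqrf_eq0 enorm_sq !dotE (unit_dot _ T1) (dotC (T x) m) h2 mm.
have : enorm m ^+ 2 <= 1 by rewrite expr_le1 // enorm_ge0.
by move=> h; apply/eqP; lra.
Qed.

End NoGain.

(** * Estimates for averaged tangents *)

Section Estimates.
Context {R : realType}.
Implicit Types u X Y Z E p q c N sg : R.

(** The curvature bound for a perturbed tangent: [sg] stands for its slope,
    [1 + X - 2 * Y] for the stretching factor and [p + 2 * Y + q] for its squared
    length. The linear terms cancel, so that the curvature exceeds 1 by a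
    quadratic amount only. *)
Lemma slope_estimate u X Y p q sg : 0 <= u -> u <= 1 / 100 -> `|X| <= u -> `|Y| <= u ->
  1 - 2 * u ^+ 2 <= p -> 0 <= q -> sg ^+ 2 <= 1 + 2 * X + u ^+ 2 ->
  sg <= (1 + 22 * u ^+ 2) * (1 + X - 2 * Y) * (p + 2 * Y + q).
Proof.
move=> u0 u1; rewrite !ler_norml => /andP[X1 X2] /andP[Y1 Y2] hp hq hs.
have uu : u ^+ 2 <= 1 / 100 by rewrite expr2; nra.
have h1 : sg <= 1 + X + u ^+ 2 / 2 by have := sqr_ge0 (sg - 1); lra.
have XY : - (u ^+ 2) <= X * Y by rewrite expr2; nra.
have YY : Y * Y <= u ^+ 2 by rewrite expr2; nra.
have [X3 X4 Y3 Y4] : [/\ - (1 / 100) <= X, X <= 1 / 100, - (1 / 100) <= Y & Y <= 1 / 100].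
  by split; lra.
have := sqr_ge0 u; move: (u ^+ 2) hp uu h1 XY YY => v hp uu h1 XY YY v0.
clear u u0 u1 X1 X2 Y1 Y2 hs.
have w0 : 0 <= 1 + X - 2 * Y by lra.
have h2 : 1 + X - 10 * v <= (1 + X - 2 * Y) * (p + 2 * Y + q).
  have h3 : (1 + X - 2 * Y) * (1 - 2 * v + 2 * Y) <= (1 + X - 2 * Y) * (p + 2 * Y + q).
    by rewrite (ler_wpM2l w0) //; lra.
  have h4 : v * (1 + X - 2 * Y) <= v * 2 by rewrite (ler_wpM2l v0) //; lra.
  clear -h3 h4 XY YY v0; lra.
have w1 : 0 <= 1 + 22 * v by lra.
have h3 := ler_wpM2l w1 h2; rewrite -mulrA; apply: le_trans h3.
have h4 : v * (1 / 2) <= v * (1 + X - 10 * v) by rewrite (ler_wpM2l v0) //; lra.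
clear -h1 h4 v0; lra.
Qed.

(** Expansion of the stretched length [(1 + X - 2 * Y) * N] to first order. The
    second bracket on the right is the change of the component of the derivative
    along a fixed direction, whose integral vanishes for closed curves; this
    removes the closing term [Z] from the first bracket. *)
Lemma length_estimate u X Y Z E p q c N : 0 <= u -> u <= 1 / 100 ->
  `|X| <= u -> `|Y| <= u -> `|Y + Z| <= u -> `|E + Z| <= u -> p <= 1 ->
  q <= u ^+ 2 -> N ^+ 2 = p + 2 * (Y + Z) + q ->
  (1 + X - 2 * Y) * N <= 1 + ((1 - c) * X - E - (1 - 2 * c) * Y) +
    ((1 + X - 2 * Y) * (c + E + Z) - c) + 13 * u ^+ 2.
Proof.
move=> u0 u1; rewrite !ler_norml => /andP[X1 X2] /andP[Y1 Y2] /andP[YZ1 YZ2] /andP[EZ1 EZ2] hp hq hN.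
have u2 := sqr_ge0 u.
have h1 : N <= 1 + (Y + Z) + u ^+ 2 / 2 by have := sqr_ge0 (N - 1); lra.
have h2 : (1 + X - 2 * Y) * N <= (1 + X - 2 * Y) * (1 + (Y + Z) + u ^+ 2 / 2).
  by rewrite ler_wpM2l //; lra.
have h3 : u ^+ 2 * (1 + X - 2 * Y) <= u ^+ 2 * 2 by rewrite ler_wpM2l //; lra.
have bound (a b : R) : `|a| <= 3 * u -> `|b| <= u -> `|a * b| <= 3 * u ^+ 2.
  move=> ha hb; rewrite normrM expr2 mulrA; exact: ler_pM.
have hXY : `|X - 2 * Y| <= 3 * u by rewrite ler_norml; lra.
have hYZ : `|Y + Z| <= u by rewrite ler_norml; lra.
have hEZ : `|E + Z| <= u by rewrite ler_norml; lra.
have := bound _ _ hXY hYZ; have := bound _ _ hXY hEZ.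
rewrite !ler_norml => /andP[h4 h5] /andP[h6 h7].
lra.
Qed.

Lemma gain_bound (l J u : R) : 0 < l ->
  l <= (1 + 22 * u ^+ 2) * (l + J + 14 * u ^+ 2 * l) -> - (36 * u ^+ 2 * l) <= J.
Proof.
move=> l0 H; rewrite leNgt; apply/negP => hJ.
have u2 := sqr_ge0 u.
have : (1 + 22 * u ^+ 2) * (l + J + 14 * u ^+ 2 * l) < (1 + 22 * u ^+ 2) * (l - 22 * u ^+ 2 * l).
  rewrite ltr_pM2l; lra.
have : 0 <= (u ^+ 2) ^+ 2 * l by rewrite mulr_ge0 ?sqr_ge0 // ltW.
by rewrite !expr2; lra.
Qed.

End Estimates.

Section Steklov.
Context {R : realType} {n : nat}.
Notation V := 'rV[R]_n.
Implicit Types (s t h : R).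
Variables (l : R) (g T : R -> V).
Hypotheses (cu : closed_unit l g T) (TL : lip1 T).

Let l0 : 0 < l. Proof. by case: cu. Qed.
Let us : unit_speed g T. Proof. by case: cu. Qed.
Let T1 := us.2.
Let pg : periodic g l. Proof. by case: cu. Qed.
Let pT : periodic T l. Proof. exact: der_periodic us.1 pg. Qed.

(** Average of [T] over an interval of length [h]: a C^1 approximation of the
    Lipschitz map [T], with explicit derivative [Dh]. *)
Definition Th h s : V := h^-1 *: (g (s + h) - g s).
Definition Dh h s : V := h^-1 *: (T (s + h) - T s).

Lemma vder_shift (f : R -> V) h s v : vder f (s + h) v -> vder (fun t => f (t + h)) s v.
Proof.
move=> fd; have d1 : is_derive s 1 (fun t : R => t + h) 1.
  by apply: (der_eq (derD (der_id s) (der_cst h s))); rewrite addr0.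
by apply: (vder_eq (@vder_comp _ _ f (fun t : R => t + h) 1 s _ fd d1)); rewrite scale1r.
Qed.

Lemma vder_Th h s : vder (Th h) s (Dh h s).
Proof.
by apply: vderZ; apply: vderB; [apply: vder_shift|]; exact: us.1.
Qed.

Lemma Dh_le1 h s : 0 < h -> enorm (Dh h s) <= 1.
Proof.
move=> h0; rewrite enormZ gtr0_norm ?invr_gt0 // ler_pdivrMl // mulr1.
by apply: le_trans (TL _ _) _; rewrite addrAC subrr add0r gtr0_norm.
Qed.

Lemma Th_le1 h s : 0 < h -> enorm (Th h s) <= 1.
Proof.
move=> h0; rewrite enormZ gtr0_norm ?invr_gt0 // ler_pdivrMl // mulr1.
have := vder_lip us.1 (fun s => (_ : enorm (T s) <= 1)).
have H s' : enorm (T s') <= 1 by rewrite T1.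
move=> /(_ H) K; apply: le_trans (K _ _) _.
by rewrite mul1r addrAC subrr add0r gtr0_norm.
Qed.

Lemma Th_close h s : 0 < h -> enorm (Th h s - T s) <= h.
Proof.
move=> h0; have -> : Th h s - T s = h^-1 *: ((g (s + h) - h *: T s) - g s).
  by apply/rowP => i; rewrite !mxE; field; rewrite gt_eqF.
rewrite enormZ gtr0_norm ?invr_gt0 // ler_pdivrMl //.
have sh : s <= s + h by lra.
pose f x := g x - (x - s) *: T s.
have fd x : s <= x <= s + h -> vder f x (T x - T s).
  move=> _; apply: vderB; first exact: us.1.
  have d1 : is_derive x 1 (fun t : R => t - s) 1.
    by apply: (der_eq (derB (der_id x) (der_cst s x))); rewrite subr0.
  by apply: (vder_eq (vderM d1 (vder_cst (T s) x))); rewrite scaler0 addr0 scale1r.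
have D x : s <= x <= s + h -> is_derive x 1 (fun x => h * x) h.
  by move=> _; apply: (der_eq (derZ h (der_id x))); rewrite mulr1.
have := vmvt sh fd D; rewrite /f subrr scale0r subr0 [s + h - s]addrAC subrr add0r.
have -> : h * (s + h) - h * s = h * h by ring.
apply => x /andP[sx xh]; apply: le_trans (TL _ _) _.
rewrite ger0_norm; lra.
Qed.

Lemma Th_per h : periodic (Th h) l.
Proof. by move=> s; rewrite /Th addrAC !pg. Qed.

Lemma Dh_per h : periodic (Dh h) l.
Proof. by move=> s; rewrite /Dh addrAC !pT. Qed.

Lemma Dh_vLip h : vLip (Dh h).
Proof.
exists (`|h^-1| * 2) => s t; rewrite -scalerBr enormZ -mulrA ler_wpM2l //.
have -> : T (s + h) - T s - (T (t + h) - T t) = (T (s + h) - T (t + h)) - (T s - T t).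
  by apply/rowP => i; rewrite !mxE; ring.
have h1 := TL (s + h) (t + h); have h2 := TL s t.
have e : s + h - (t + h) = s - t by ring.
rewrite e in h1; apply: le_trans (enormBD _ _) _; lra.
Qed.

Lemma Th_vLip h : 0 < h -> vLip (Th h).
Proof. by move=> h0; apply: (vder_vLip (vder_Th h)); exists 1 => s; exact: Dh_le1. Qed.

Section Straight.
Variables (s0 r : R) (e : V).
Hypotheses (r0 : 0 < r) (strT : forall s, `|s - s0| < 3 * r -> T s = e).

Lemma straight_h h s (k : int) : 0 < h -> h < r -> `|s + k%:~R * l - s0| < 2 * r ->
  Th h s = e /\ Dh h s = 0.
Proof.
move=> h0 hr; set x := s + _ => xs.
have -> : Th h s = Th h x by rewrite /x (periodicz k s (Th_per h)).
have -> : Dh h s = Dh h x by rewrite /x (periodicz k s (Dh_per h)).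
have near y : x <= y <= x + h -> T y = e.
  by move=> xy; apply: strT; move: xs; rewrite !ltr_norml; lra.
have Tx : T x = e by apply: near; lra.
split; last by rewrite /Dh Tx near ?subrr ?scaler0 //; lra.
have xh : x <= x + h by lra.
pose f y := g y - (y - x) *: e.
have fd y : x <= y <= x + h -> vder f y (T y - e).
  move=> _; apply: vderB; first exact: us.1.
  have d1 : is_derive y 1 (fun t : R => t - x) 1.
    by apply: (der_eq (derB (der_id y) (der_cst x y))); rewrite subr0.
  by apply: (vder_eq (vderM d1 (vder_cst e y))); rewrite scaler0 addr0 scale1r.
have D y : x <= y <= x + h -> is_derive y 1 (fun _ : R => 0 : R) 0 by move=> _; exact: der_cst.
have := vmvt xh fd D; rewrite /f !subrr scale0r subr0 [x + h - x]addrAC subrr add0r.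
have H y : x <= y <= x + h -> enorm (T y - e) <= 0 by move=> /near ->; rewrite subrr enorm0.
move=> /(_ H) K; have : g (x + h) - h *: e - g x = 0.
  by apply: enorm_eq0; apply/eqP; rewrite eq_le K enorm_ge0.
rewrite addrAC => /eqP; rewrite subr_eq0 => /eqP E.
by rewrite /Th E scalerA mulVf ?scale1r // gt_eqF.
Qed.

End Straight.

End Steklov.

(** * First variation in the presence of a straight arc *)

Section Cost.
Context {R : realType} {n : nat}.
Notation V := 'rV[R]_n.
Implicit Types (s t h d : R) (a : R -> V).
Variables (l : R) (g T : R -> V) (s0 r : R) (e : V).
Hypotheses (cu : closed_unit l g T) (TL : lip1 T) (ng : no_gain l T).
Hypotheses (r0 : 0 < r) (rl : r <= l / 4).
Hypothesis strT : forall s, `|s - s0| < 3 * r -> T s = e.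

Let l0 : 0 < l. Proof. by case: cu. Qed.
Let us : unit_speed g T. Proof. by case: cu. Qed.
Let T1 := us.2.
Let pg : periodic g l. Proof. by case: cu. Qed.
Let pT : periodic T l. Proof. exact: der_periodic us.1 pg. Qed.
Let cT : vcont T. Proof. exact: lip1_vcont. Qed.

(** First order change of length when the averaged tangent is turned in the
    direction [a], each arc is stretched by the amount that keeps the curvature
    below 1, and the curve is closed up inside the straight interval. *)
Definition cost h a (a' : R -> V) s :=
  (1 - dot e (Th g h s)) * dot (a' s) (Dh T h s)
  - dot (a s) (e + (1 - 2 * dot e (Th g h s)) *: Th g h s).

Lemma e_unit : enorm e = 1.
Proof. by rewrite -(strT (s := s0)) ?T1 // subrr normr0 mulr_gt0. Qed.

Lemma vitg_T : vitg T 0 l = 0.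
Proof. by rewrite (vitgE 0 l cT us.1) -{1}(add0r l) pg subrr. Qed.

Lemma itg_gt0_per (f : R -> R) x : continuous f -> periodic f l ->
  (forall s, 0 <= f s) -> 0 < f x -> 0 < itg f 0 l.
Proof.
move=> cf pf f0 fx; have := itg_period 0 (x - l / 2) cf pf; rewrite add0r => ->.
by apply: (@itg_gt0 _ _ _ _ x) => //; move: l0; lra.
Qed.

End Cost.

(** A direction [a] of size at most [A] is completed by a tent [xi] inside the
    straight arc, which closes the curve without affecting the curvature
    elsewhere; [no_gain] then makes the first variation nonnegative. Averaging
    at scale [d ^+ 2] keeps the error of the averaging quadratic in the step
    [d]. *)
Lemma cost_ge (R : realType) (n : nat) (l : R) (g T : R -> 'rV[R]_n) (s0 r : R)
    (e : 'rV[R]_n) (A : R) :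
  closed_unit l g T -> lip1 T -> no_gain l T -> 0 < r -> r <= l / 4 ->
  (forall s, `|s - s0| < 3 * r -> T s = e) -> 1 <= A ->
  exists C d0 : R, [/\ 0 < d0, 0 <= C &
  forall d, 0 < d -> d < d0 -> forall a a' : R -> 'rV[R]_n,
    (forall s, vder a s (a' s)) ->
    vLip a' -> periodic a l -> (forall s, enorm (a s) <= A) ->
    (forall s, enorm (a' s) <= A) -> - (C * d) <= itg (cost g T e (d ^+ 2) a a') 0 l].
Proof.
move=> cu TL ng r0 rl strT A1; have A0 : 0 < A by lra.
case: (cu) => l0 us pg _; have T1 := us.2.
have pT : periodic T l := der_periodic us.1 pg.
have cT : vcont T := lip1_vcont TL.
have [beta [pb lb b02 bpos bsupp]] := @bump_exists R l s0 r l0 r0 rl.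
have [K HK] := lb.
have b2 s : 0 <= beta s by case/andP: (b02 s).
have b3 s : beta s <= 2 by case/andP: (b02 s).
have cb : continuous beta := Lip_cont lb.
pose b := itg beta 0 l.
have b0 : 0 < b.
  by apply: (@itg_gt0_per _ _ _ _ _ cu beta s0) => //; apply: bpos; rewrite subrr normr0.
have [e0 e00 NG] := ng.
(* [V0] bounds the closing vector [v], and [B] the whole perturbation and its
   slope on the straight arc. *)
pose V0 := 16 * A * l / b.
have V00 : 0 < V0 by rewrite divr_gt0 // mulr_gt0 // mulr_gt0.
pose B := A + (2 + `|K|) * V0.
have K0 : 0 <= `|K| by [].
have BA : A + 2 * V0 <= B by rewrite /B lerD2l ler_wpM2r ?(ltW V00) // lerDl.
have BK : A + `|K| * V0 <= B by rewrite /B lerD2l ler_wpM2r ?(ltW V00) // lerDr.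
have B1 : 1 <= B by move: A1 V00 BA; clear; lra.
have B0 : 0 < B by lra.
have B8 : 0 < 8 * B by lra.
pose d0 := Num.min (1 / 100 / B) (Num.min (e0 / (8 * B)) r).
have d00 : 0 < d0 by rewrite !lt_min r0 !divr_gt0.
exists (36 * B ^+ 2 * l), d0; split=> //.
  by rewrite mulr_ge0 ?(ltW l0) // mulr_ge0 // sqr_ge0.
move=> d dp dd0 a a' ader la' pa aA a'A.
pose u := d * B.
have u100 : u <= 1 / 100.
  by rewrite -ler_pdivlMr // ltW // (lt_le_trans dd0) // ge_min lexx.
have ue0 : 8 * u <= e0.
  rewrite /u mulrCA -ler_pdivlMr // ltW // (lt_le_trans dd0) //.
  by rewrite !ge_min lexx orbT.
have dr : d < r by apply: lt_le_trans dd0 _; rewrite !ge_min lexx !orbT.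
have up : 0 < u by rewrite mulr_gt0.
have du : d <= u by rewrite /u ler_peMr // ltW.
have dAu : d * A <= u by rewrite ler_pM2l //; move: V00 BA; clear; lra.
have dA0 : 0 < d * A by rewrite mulr_gt0.
pose h := d ^+ 2.
have hp : 0 < h by rewrite exprn_gt0.
have hu : h <= u ^+ 2 by rewrite ler_pXn2r // nnegrE ltW.
have hd : h <= d by rewrite /h expr2 ger_pMr //; move: du u100; clear; lra.
have hr : h < r by exact: le_lt_trans hd dr.
have hdA : h <= d * A by apply: le_trans hd _; rewrite ler_peMr // ltW.
have e1 := e_unit cu r0 strT.
pose t := Th g h; pose D := Dh T h.
have t1 s : enorm (t s) <= 1 by exact: (Th_le1 cu).
have D1 s : enorm (D s) <= 1 by exact: (Dh_le1 TL).
have tT s : enorm (t s - T s) <= h by exact: (Th_close cu TL).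
have pt : periodic t l by exact: (Th_per cu).
have pD : periodic D l by exact: (Dh_per cu).
have tD s : vder t s (D s) by exact: (vder_Th cu).
have pa' : periodic a' l by exact: der_periodic ader pa.
have lt : vLip t by exact: (Th_vLip cu TL).
have lD : vLip D by exact: (Dh_vLip TL).
have la : vLip a by apply: vder_vLip ader _; exists A.
have bt : vbdd t by exists 1.
have bD : vbdd D by exists 1.
have ba : vbdd a by exists A.
have ba' : vbdd a' by exists A.
have str s (k : int) : `|s + k%:~R * l - s0| < 2 * r -> t s = e /\ D s = 0.
  exact: (straight_h cu strT).
pose X s := d * dot (a' s) (D s); pose Y s := d * dot (a s) (t s).
have Xb s : `|X s| <= d * A.
  rewrite normrM gtr0_norm // ler_pM2l //; apply: le_trans (dot_ler_norm _ _) _.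
  by rewrite -[leRHS]mulr1; apply: ler_pM; rewrite ?enorm_ge0.
have Yb s : `|Y s| <= d * A.
  rewrite normrM gtr0_norm // ler_pM2l //; apply: le_trans (dot_ler_norm _ _) _.
  by rewrite -[leRHS]mulr1; apply: ler_pM; rewrite ?enorm_ge0.
have LX : Lip X by apply: LipZ; exact: vLip_dot.
have LY : Lip Y by apply: LipZ; exact: vLip_dot.
(* To first order, turning by [d *: a'] increases the slope by [X] and
   lengthening by [d *: a] increases the squared length by [2 * Y]: [w]
   compensates for both. *)
pose w s := 1 + X s - 2 * Y s.
have Lw : Lip w.
  by apply: LipD; [apply: LipD => //; exact: Lip_cst|apply: LipN; exact: LipZ].
have w3 s : `|w s - 1| <= 3 * (d * A).
  have := Xb s; have := Yb s; rewrite /w !ler_norml; clear; lra.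
have w3u s : `|w s - 1| <= 3 * u by apply: le_trans (w3 s) _; rewrite ler_pM2l.
have w12 s : 1 / 2 <= w s by have := w3u s; rewrite ler_norml; move: u100; clear; lra.
have wpos s : 0 < w s by apply: lt_le_trans (w12 s).
have bw : bdd w.
  exists 2 => s; rewrite ger0_norm; last exact: ltW.
  by have := w3u s; rewrite ler_norml; move: u100; clear; lra.
have cw : continuous w := Lip_cont Lw.
have pw : periodic w l by move=> s; rewrite /w /X /Y pa' pD pa pt.
pose f s := t s + d *: a s.
have lf : vLip f.
  by apply: vLipD => //; apply: vLip_scale => //; [exact: Lip_cst|exists `|d|].
have fd s : vder f s (D s + d *: a' s) by apply: vderD => //; exact: vderZ.
have cf : vcont f := vLip_vcont lf.
have cwf : vcont (fun s => w s *: f s) by exact: vcontZ.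
pose U := vitg (fun s => w s *: f s) 0 l.
have Ub : enorm U <= 8 * (d * A) * l.
  have -> : U = vitg (fun s => w s *: f s - T s) 0 l.
    have c1 : vcont (fun s => w s *: f s - T s) by exact: vcontB.
    rewrite -[RHS]addr0 -(vitg_T cu TL) -vitgD //; congr vitg; apply/funext => s.
    by rewrite subrK.
  have -> : 8 * (d * A) * l = itg (fun=> 8 * (d * A)) 0 l by rewrite itg_cst subr0.
  apply: enorm_vitg; [exact: vcontB|exact: cont_cst|exact: ltW|move=> s _].
  have -> : w s *: f s - T s = (w s - 1) *: f s + d *: a s + (t s - T s).
    by apply/rowP => i; rewrite /f !mxE; ring.
  apply: le_trans (enormD _ _) _; apply: le_trans (lerD (enormD _ _) (tT s)) _.
  rewrite !enormZ (gtr0_norm dp).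
  have f2 : enorm (f s) <= 2.
    apply: le_trans (enormD _ _) _; rewrite (enormZ d) (gtr0_norm dp).
    have := ler_wpM2l (ltW dp) (aA s); have := t1 s; move: dAu u100; clear; lra.
  have := ler_wpM2l (ltW dp) (aA s).
  have : `|w s - 1| * enorm (f s) <= 3 * (d * A) * 2.
    by apply: ler_pM; rewrite ?enorm_ge0.
  move: hdA; clear; lra.
have cwb : continuous (fun s => w s * beta s) by exact: contM.
pose Wb := itg (fun s => w s * beta s) 0 l.
have Wbb : b / 2 <= Wb.
  rewrite mulrC /b -itgZ //; apply: itg_le => //; [|exact: ltW|].
    by apply: contM => //; exact: cont_cst.
  by move=> s _; rewrite ler_wpM2r // -[2^-1]mul1r.
have Wb0 : 0 < Wb by apply: lt_le_trans Wbb; rewrite divr_gt0.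
(* [U] is the failure of the stretched curve to close up. *)
pose v := - ((d * Wb)^-1 *: U).
have vV0 : enorm v <= V0.
  rewrite /v enormN enormZ gtr0_norm ?invr_gt0 ?mulr_gt0 //.
  rewrite ler_pdivrMl ?mulr_gt0 //; apply: le_trans Ub _.
  have -> : 8 * (d * A) * l = d * (b / 2) * V0 by rewrite /V0; field; rewrite gt_eqF.
  by rewrite ler_wpM2r ?(ltW V00) // ler_wpM2l // ltW.
have Uv : U + (d * Wb) *: v = 0.
  by rewrite /v scalerN scalerA mulfV ?scale1r ?subrr // gt_eqF // mulr_gt0.
clearbody v.
pose xi s := beta s *: v.
have xiV s : enorm (xi s) <= 2 * V0.
  by rewrite enormZ ger0_norm //; apply: ler_pM; rewrite ?enorm_ge0.
have lxi : vLip xi.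
  apply: vLip_scale => //; [by exists 2 => s; rewrite ger0_norm|exact: vLip_cst|by exists V0].
have bxi : vbdd xi by exists (2 * V0).
pose P s := f s + d *: xi s.
have lP : vLip P.
  by apply: vLipD => //; apply: vLip_scale => //; [exact: Lip_cst|exists `|d|].
have cP : vcont P := vLip_vcont lP.
have pP : periodic P l by move=> s; rewrite /P /f /xi pt pa pb.
have aB s : d * enorm (a s + xi s) <= u.
  rewrite ler_pM2l //; apply: le_trans (enormD _ _) _.
  by have := aA s; have := xiV s; move: BA; clear; lra.
have PE s : P s = t s + d *: (a s + xi s) by rewrite /P /f scalerDr addrA.
have Pt s : enorm (P s - t s) <= u by rewrite PE addrC addKr enormZ gtr0_norm.
have tlow s : 1 - h <= enorm (t s).
  by have := enorm_sub_ge (T s) (t s); rewrite T1 enormB; have := tT s; clear; lra.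
have hu1 : h <= u by apply: le_trans hd du.
have Plow s : 1 - 2 * u <= enorm (P s).
  have := enorm_sub_ge (t s) (P s); rewrite enormB; have := Pt s; have := tlow s.
  by move: hu1; clear; lra.
have Phigh s : enorm (P s) <= 2.
  by have := enorm_sub_ge (P s) (t s); have := Pt s; have := t1 s; move: u100; clear; lra.
have cwP : vcont (fun s => w s *: P s) by exact: vcontZ.
have closing : vitg (fun s => w s *: P s) 0 l = 0.
  rewrite -[RHS]Uv /U.
  have c2 : vcont (fun s => (w s * beta s) *: v) by apply: vcontZ => //; exact: vcont_cst.
  have c3 : vcont (fun s => d *: ((w s * beta s) *: v)) by apply: vcontZ => //; exact: cont_cst.
  have -> : (d * Wb) *: v = vitg (fun s => d *: ((w s * beta s) *: v)) 0 l.
    rewrite vitgZ // -scalerA; congr (_ *: _); apply: dot_eqP => z.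
    rewrite dot_vitg // dotZl /Wb mulrC -itgZ //; congr itg; apply/funext => s.
    by rewrite dotZl mulrC.
  rewrite -vitgD //; congr vitg; apply/funext => s.
  by rewrite /P /xi scalerDr; congr (_ + _); rewrite !scalerA; congr (_ *: _); ring.
(* The constant of [slope_estimate]. *)
pose k := 1 + 22 * u ^+ 2.
have k1 : 1 <= k by rewrite /k lerDl mulr_ge0 // sqr_ge0.
have H : l <= k * itg (fun s => w s * enorm (P s)) 0 l.
  apply: (NG P w k) => //.
  - move=> s; apply/eqP => E; have := Plow s; rewrite E enorm0; move: u100; clear; lra.
  - move=> s.
    have -> : w s *: P s - T s = (w s - 1) *: P s + (P s - t s) + (t s - T s).
      by apply/rowP => i; rewrite !mxE; ring.
    apply: le_trans (enormD _ _) _; apply: le_trans (lerD (enormD _ _) (tT s)) _.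
    rewrite enormZ.
    have : `|w s - 1| * enorm (P s) <= 3 * u * 2 by apply: ler_pM; rewrite ?enorm_ge0.
    by have := Pt s; move: ue0 hu1; clear; lra.
  - move=> x ep ep0.
    have [[j Hj]|far] := pselect (exists j : int, `|x + j%:~R * l - s0| < 2 * r).
      exists (2 * r - `|x + j%:~R * l - s0|); first by rewrite subr_gt0.
      move=> y yx.
      have Hy : `|y + j%:~R * l - s0| < 2 * r.
        have -> : y + j%:~R * l - s0 = (y - x) + (x + j%:~R * l - s0) by ring.
        by apply: le_lt_trans (ler_normD _ _) _; rewrite -ltrBrDr.
      have -> : P y - P x = d *: ((a y - a x) + (beta y - beta x) *: v).
        rewrite !PE (str _ _ Hy).1 (str _ _ Hj).1 /xi scalerBl.
        by apply/rowP => i; rewrite !mxE; ring.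
      rewrite enormZ gtr0_norm //.
      have h1 : enorm (a y - a x) <= A * `|y - x| by exact: (vder_lip ader a'A).
      have h2 : `|beta y - beta x| * enorm v <= `|K| * `|y - x| * V0.
        apply: ler_pM; rewrite ?enorm_ge0 //; apply: le_trans (HK _ _) _.
        by rewrite ler_wpM2r // ler_norm.
      have h3 : enorm ((a y - a x) + (beta y - beta x) *: v) <= B * `|y - x|.
        apply: le_trans (enormD _ _) _; rewrite enormZ; apply: le_trans (lerD h1 h2) _.
        by rewrite mulrAC -mulrDl ler_wpM2r.
      apply: le_trans (ler_wpM2l (ltW dp) h3) _; rewrite mulrA ler_wpM2r //.
      have h4 : 1 / 2 * (1 / 2) <= w x * enorm (P x) ^+ 2.
        apply: ler_pM => //; rewrite expr2; have := Plow x; move: u100; clear; nra.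
      have h5 : 1 * (1 / 2 * (1 / 2)) <= k * (w x * enorm (P x) ^+ 2) by apply: ler_pM.
      by rewrite -/u -mulrA; move: u100 ep0 h5; clear; lra.
    have far' (j : int) : 2 * r <= `|x + j%:~R * l - s0|.
      by rewrite leNgt; apply/negP => hh; apply: far; exists j.
    have rr : r < 2 * r by move: r0; clear; lra.
    have off := @bump_off R beta l s0 (2 * r) r x rr bsupp far'.
    have [q q0 Hq] := vder_slope (fd x) ep0.
    exists (Num.min q (2 * r - r)); first by rewrite lt_min q0 subr_gt0.
    move=> y; rewrite lt_min => /andP[y1 y2].
    have bx : beta x = 0 by apply: off; rewrite subrr normr0 subr_gt0.
    have Px : P x = f x by rewrite /P /xi bx scale0r scaler0 addr0.
    have -> : P y = f y by rewrite /P /xi (off y y2) scale0r scaler0 addr0.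
    rewrite Px; apply: le_trans (Hq y y1) _; rewrite ler_wpM2r // lerD2r.
    have -> : enorm (f x) ^+ 2 = enorm (t x) ^+ 2 + 2 * Y x + d ^+ 2 * enorm (a x) ^+ 2.
      by rewrite /f /Y; move: (t x) (a x) => p q'; rewrite !enorm_sq !dotE (dotC p); ring.
    apply: slope_estimate => //.
    + exact: ltW.
    + exact: le_trans (Xb x) _.
    + exact: le_trans (Yb x) _.
    + have h1 : (1 - h) ^+ 2 <= enorm (t x) ^+ 2.
        rewrite ler_pXn2r // nnegrE ?enorm_ge0 // subr_ge0.
        by move: hu1 u100; clear; lra.
      by have := sqr_ge0 h; move: hu h1; rewrite sqrrB expr1n mul1r mulr2n; clear; lra.
    + by rewrite mulr_ge0 // sqr_ge0.
    + have -> : enorm (D x + d *: a' x) ^+ 2 = enorm (D x) ^+ 2 + 2 * X x + d ^+ 2 * enorm (a' x) ^+ 2.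
        by rewrite /X; move: (D x) (a' x) => p q'; rewrite !enorm_sq !dotE (dotC p); ring.
      have h1 : enorm (D x) ^+ 2 <= 1 by rewrite expr_le1 // enorm_ge0.
      have h2 : d ^+ 2 * enorm (a' x) ^+ 2 <= u ^+ 2.
        have h0 : 0 <= d * enorm (a' x) by rewrite mulr_ge0 ?enorm_ge0 // ltW.
        have h3 : d * enorm (a' x) <= u by apply: le_trans dAu; rewrite ler_pM2l.
        by rewrite -exprMn !expr2; apply: ler_pM.
      by move: h1 h2; clear; lra.
have ccost : continuous (cost g T e h a a').
  have c1 : continuous (fun s => dot e (t s)).
    by apply: vcont_dot; [exact: vcont_cst|exact: vLip_vcont].
  apply: contB.
    apply: contM; first by apply: contB => //; exact: cont_cst.
    by apply: vcont_dot; exact: vLip_vcont.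
  apply: vcont_dot; first exact: vLip_vcont.
  apply: vcontD; first exact: vcont_cst.
  apply: vcontZ; last exact: vLip_vcont.
  by apply: contB; [exact: cont_cst|apply: contM => //; exact: cont_cst].
pose F s := (1 + 14 * u ^+ 2) + d * cost g T e h a a' s + (dot (w s *: P s) e - dot (T s) e).
have c4 : continuous (fun s => dot (w s *: P s) e) by exact: cwP.
have c5 : continuous (fun s => dot (T s) e) by exact: cT.
have c6 : continuous (fun s => d * cost g T e h a a' s) by apply: contM => //; exact: cont_cst.
have c7 : continuous (fun s => (1 + 14 * u ^+ 2) + d * cost g T e h a a' s).
  by apply: contD => //; exact: cont_cst.
have iF : itg F 0 l = (1 + 14 * u ^+ 2) * l + d * itg (cost g T e h a a') 0 l.
  rewrite /F (itgD 0 l c7 (contB c4 c5)) (itgD 0 l (@cont_cst R _) c6).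
  rewrite (itgB 0 l c4 c5) -!dot_vitg // closing (vitg_T cu TL) dot0l subrr addr0 itgZ //.
  by rewrite itg_cst subr0.
have HF : itg (fun s => w s * enorm (P s)) 0 l <= itg F 0 l.
  apply: itg_le.
  - by apply: contM => //; exact: vcont_enorm.
  - by apply: contD => //; exact: contB.
  - exact: ltW.
  - move=> s _.
    pose Z := d * dot (xi s) (t s); pose E := d * dot e (a s); pose c := dot e (t s).
    have Ze : Z = d * dot (xi s) e.
      rewrite /Z /xi; have [->|bn] := eqVneq (beta s) 0; first by rewrite scale0r !dot0l.
      have [j Hj] := bsupp s bn.
      have H2r : `|s + j%:~R * l - s0| < 2 * r.
        by apply: lt_trans Hj _; move: r0; clear; lra.
      by rewrite (str s j H2r).1.
    have hc : h >= dot (T s) e - c.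
      rewrite /c (dotC e) -dotBl; apply: le_trans (dot_le _ _) _.
      by rewrite e1 mulr1 enormB.
    have lenE : enorm (P s) ^+ 2 = enorm (t s) ^+ 2 + 2 * (Y s + Z) + d ^+ 2 * enorm (a s + xi s) ^+ 2.
      rewrite PE !enorm_sq /Y /Z; move: (t s) (xi s) (a s) => t' x' a0.
      by rewrite !dotE !(dotC t'); ring.
    have h1 : `|Y s + Z| <= u.
      rewrite /Y /Z -mulrDr -dotDl normrM gtr0_norm //.
      apply: le_trans (aB s); rewrite ler_pM2l //; apply: le_trans (dot_ler_norm _ _) _.
      by rewrite ler_piMr ?enorm_ge0.
    have h2 : `|E + Z| <= u.
      rewrite /E Ze (dotC e) -mulrDr -dotDl normrM gtr0_norm //.
      apply: le_trans (aB s); rewrite ler_pM2l //; apply: le_trans (dot_ler_norm _ _) _.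
      by rewrite e1 mulr1.
    have h3 : d ^+ 2 * enorm (a s + xi s) ^+ 2 <= u ^+ 2.
      have h0 : 0 <= d * enorm (a s + xi s) by rewrite mulr_ge0 ?enorm_ge0 // ltW.
      by rewrite -exprMn !expr2; apply: ler_pM.
    have h4 : enorm (t s) ^+ 2 <= 1 by rewrite expr_le1 // enorm_ge0.
    have := length_estimate c (ltW up) u100 (le_trans (Xb s) dAu) (le_trans (Yb s) dAu) h1 h2 h4 h3 lenE.
    have -> : (1 + X s - 2 * Y s) * (c + E + Z) = dot (w s *: P s) e.
      rewrite (dotZl (w s)) /w; congr (_ * _).
      rewrite PE Ze /c /E (dotC e (t s)) (dotC e (a s)).
      by move: (t s) (a s) (xi s) => p q z; rewrite !dotE; ring.
    have -> : (1 - c) * X s - E - (1 - 2 * c) * Y s = d * cost g T e h a a' s.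
      rewrite /cost -/(t s) -/(D s) /c /X /Y /E.
      by move: (t s) (D s) (a s) (a' s) => p z q q'; rewrite !dotE (dotC q e); ring.
    rewrite -/(w s) /F; move: hc hu; clear; lra.
have k0 : 0 <= k by apply: le_trans k1.
have H2 := le_trans H (ler_wpM2l k0 HF).
rewrite iF in H2.
have H3 : l <= (1 + 22 * u ^+ 2) * (l + d * itg (cost g T e h a a') 0 l + 14 * u ^+ 2 * l).
  by apply: le_trans H2 _; rewrite /k le_eqVlt; apply/orP; left; apply/eqP; ring.
have := gain_bound l0 H3.
have -> : - (36 * u ^+ 2 * l) = d * - (36 * B ^+ 2 * l * d) by rewrite /u; ring.
by rewrite ler_pM2l.
Qed.

(** * The Euler-Lagrange equation in mean square *)

Lemma le0_small (R : realType) (x K d0 : R) : 0 < d0 ->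
  (forall d, 0 < d -> d < d0 -> x <= K * d) -> x <= 0.
Proof.
move=> d00 H; rewrite leNgt; apply/negP => x0.
have K1 : 0 < `|K| + 1 by rewrite ltr_wpDl.
pose d := Num.min (d0 / 2) (x / (`|K| + 1) / 2).
have dp : 0 < d by rewrite lt_min !divr_gt0.
have dd0 : d < d0 by rewrite gt_min; apply/orP; left; move: d00; clear; lra.
have := H d dp dd0.
have : d * (`|K| + 1) <= x / 2.
  by rewrite -ler_pdivlMr // ge_min mulrAC lexx orbT.
have : K * d <= `|K| * d by rewrite ler_wpM2r ?ler_norm // ltW.
move: x0 dp; clear; lra.
Qed.

Lemma vder0_const (R : realType) (n : nat) (f : R -> 'rV[R]_n) (a b : R) : a <= b ->
  (forall x, a <= x <= b -> vder f x 0) -> f a = f b.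
Proof.
move=> ab H; have D x : a <= x <= b -> is_derive x 1 (fun _ : R => 0 : R) 0.
  by move=> _; exact: der_cst.
have := vmvt ab H D (fun x _ => eq_ind_r (fun y => y <= 0) (lexx 0) enorm0).
rewrite subrr => h; apply/esym/eqP; rewrite -subr_eq0; apply/eqP/enorm_eq0/eqP.
by rewrite eq_le h enorm_ge0.
Qed.

Section Euler.
Context {R : realType} {n : nat}.
Notation V := 'rV[R]_n.
Implicit Types (s t h d : R) (e : V) (T : R -> V).

(** The coefficient of [a] in [cost] in the limit of small averaging scales. *)
Definition qvec e (T : R -> V) s := e + (1 - 2 * dot e (T s)) *: T s.

(** The variable conjugate to [T]: as [qvec e T] integrates to 0 over a period,
    it is periodic, and it vanishes along the straight arc. *)
Definition momentum e (T : R -> V) s0 s := - vitg (qvec e T) s0 s.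

Lemma qvec_vLip e T : enorm e = 1 -> (forall s, enorm (T s) <= 1) -> vLip T ->
  vLip (qvec e T).
Proof.
move=> e1 T1 lT; have bT : vbdd T by exists 1.
have be : vbdd (fun _ : R => e) by exists 1 => s; rewrite e1.
have ld : Lip (fun s => dot e (T s)) by apply: vLip_dot => //; exact: vLip_cst.
apply: vLipD; first exact: vLip_cst.
apply: vLip_scale => //.
  by apply: LipD; [exact: Lip_cst|apply: LipN; exact: LipZ].
exists 3 => s; have := dot_ler_norm e (T s); rewrite e1 mul1r => h1.
have h2 := T1 s; move: (le_trans h1 h2); rewrite !ler_norml; clear; lra.
Qed.

Lemma qvec_close e (u v : V) h : enorm e = 1 -> enorm u <= 1 -> enorm v = 1 ->
  enorm (u - v) <= h ->
  enorm ((e + (1 - 2 * dot e u) *: u) - (e + (1 - 2 * dot e v) *: v)) <= 5 * h.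
Proof.
move=> e1 u1 v1 uv.
have -> : (e + (1 - 2 * dot e u) *: u) - (e + (1 - 2 * dot e v) *: v) =
    (1 - 2 * dot e u) *: (u - v) + (- 2 * dot e (u - v)) *: v.
  by rewrite dotBr; apply/rowP => i; rewrite !mxE; ring.
apply: le_trans (enormD _ _) _; rewrite !enormZ v1 mulr1 normrM normrN.
have h1 : `|dot e (u - v)| <= h.
  by apply: le_trans (dot_ler_norm _ _) _; rewrite e1 mul1r.
have h2 : `|1 - 2 * dot e u| <= 3.
  have := dot_ler_norm e u; rewrite e1 mul1r => k; move: (le_trans k u1).
  by rewrite !ler_norml; clear; lra.
have h3 : `|1 - 2 * dot e u| * enorm (u - v) <= 3 * h.
  by apply: ler_pM; rewrite ?enorm_ge0.
rewrite normr_nat; move: h1 h3; clear; lra.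
Qed.

Lemma qvec_le4 e (u : V) : enorm e = 1 -> enorm u <= 1 ->
  enorm (e + (1 - 2 * dot e u) *: u) <= 4.
Proof.
move=> e1 u1; apply: le_trans (enormD _ _) _; rewrite enormZ e1.
have h2 : `|1 - 2 * dot e u| <= 3.
  have := dot_ler_norm e u; rewrite e1 mul1r => k; move: (le_trans k u1).
  by rewrite !ler_norml; clear; lra.
have h3 : `|1 - 2 * dot e u| * enorm u <= 3 * 1 by apply: ler_pM; rewrite ?enorm_ge0.
move: h3; clear; lra.
Qed.

End Euler.

(** Constant directions [a] in [cost_ge]: the linear form given by the integral of
    [qvec] is nonnegative in every direction. *)
Lemma qvec_closed (R : realType) (n : nat) (l : R) (g T : R -> 'rV[R]_n) (s0 r : R)
    (e : 'rV[R]_n) :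
  closed_unit l g T -> lip1 T -> no_gain l T -> 0 < r -> r <= l / 4 ->
  (forall s, `|s - s0| < 3 * r -> T s = e) -> vitg (qvec e T) 0 l = 0.
Proof.
move=> cu TL ng r0 rl strT; have e1 := e_unit cu r0 strT.
case: (cu) => l0 us pg _; have T1 := us.2.
have lT : vLip T by exists 1 => x y; rewrite mul1r.
have T1' s : enorm (T s) <= 1 by rewrite T1.
have cq : vcont (qvec e T) by apply: vLip_vcont; exact: qvec_vLip.
apply/enorm_eq0/eqP; rewrite eq_le enorm_ge0 andbT.
apply: enorm_le_test => // b b1; rewrite dot_vitg //.
have [C [d0 [d00 C0 H]]] := cost_ge cu TL ng r0 rl strT (lexx 1).
apply: (@le0_small _ _ (C + 5 * l) (Num.min d0 1)); first by rewrite lt_min d00 ltr01.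
move=> d dp; rewrite lt_min => /andP[dd0 d1].
have hp : 0 < d ^+ 2 by rewrite exprn_gt0.
have hd : d ^+ 2 <= d by rewrite expr2 ger_pMr // ltW.
have lh : vLip (Th g (d ^+ 2)) by exact: (Th_vLip cu TL).
have t1 s : enorm (Th g (d ^+ 2) s) <= 1 by exact: (Th_le1 cu).
have ch : vcont (qvec e (Th g (d ^+ 2))) by apply: vLip_vcont; exact: qvec_vLip.
have := H d dp dd0 (fun=> b) (fun=> 0) (fun s => vder_cst b s) (vLip_cst 0) (fun s => erefl)
  (fun s => eq_ind_r (fun x => x <= 1) (lexx 1) b1)
  (fun s => eq_ind_r (fun x => x <= 1) ler01 enorm0).
have -> : cost g T e (d ^+ 2) (fun=> b) (fun=> 0) =
    fun s => (-1) * dot (qvec e (Th g (d ^+ 2)) s) b.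
  by apply/funext => s; rewrite /cost dot0l mulr0 sub0r mulN1r (dotC b).
rewrite itgZ // => K.
have : itg (fun s => dot (qvec e T s) b) 0 l <=
    itg (fun s => dot (qvec e (Th g (d ^+ 2)) s) b + 5 * d ^+ 2) 0 l.
  apply: itg_le => //; [by apply: contD => //; exact: cont_cst|exact: ltW|move=> s _].
  have := qvec_close e1 (t1 s) (T1 s) (Th_close cu TL s hp); rewrite enormB => h1.
  have := dot_le (qvec e T s - qvec e (Th g (d ^+ 2)) s) b; rewrite b1 mulr1 dotBl => h2.
  have h3 := le_trans h2 h1; move: h3; clear; lra.
rewrite (itgD 0 l (ch b) (@cont_cst R _)) itg_cst subr0.
have : 5 * d ^+ 2 * l <= 5 * d * l by rewrite ler_wpM2r ?(ltW l0) // ler_wpM2l.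
move: K; clear; lra.
Qed.

Section Momentum.
Context {R : realType} {n : nat}.
Notation V := 'rV[R]_n.
Variables (l : R) (g T : R -> V) (s0 r : R) (e : V).
Hypotheses (cu : closed_unit l g T) (TL : lip1 T) (ng : no_gain l T).
Hypotheses (r0 : 0 < r) (rl : r <= l / 4).
Hypothesis strT : forall s, `|s - s0| < 3 * r -> T s = e.
Notation Q := (momentum e T s0).

Let l0 : 0 < l. Proof. by case: cu. Qed.
Let us : unit_speed g T. Proof. by case: cu. Qed.
Let T1 := us.2.
Let pg : periodic g l. Proof. by case: cu. Qed.
Let pT : periodic T l. Proof. exact: der_periodic us.1 pg. Qed.
Let e1 : enorm e = 1. Proof. exact: e_unit cu r0 strT. Qed.
Let T1' s : enorm (T s) <= 1. Proof. by rewrite T1. Qed.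

Lemma cont_qvec : vcont (qvec e T).
Proof. by apply: vLip_vcont; apply: qvec_vLip => //; exists 1 => x y; rewrite mul1r. Qed.

Lemma per_qvec : periodic (qvec e T) l.
Proof. by move=> s; rewrite /qvec pT. Qed.

Lemma vder_Q s : vder Q s (- qvec e T s).
Proof.
move=> b; have := derN (vder_vitg s0 s cont_qvec b); rewrite dotNl.
by apply: der_near; exists 1 => // t _; rewrite /momentum dotNl.
Qed.

Lemma Q_per : periodic Q l.
Proof.
move=> s; congr (- _); apply: dot_eqP => b; rewrite !dot_vitg; try exact: cont_qvec.
apply: prim_periodic; [exact: cont_qvec|by move=> x; rewrite per_qvec|].
rewrite -dot_vitg; last exact: cont_qvec.
by rewrite (qvec_closed cu TL ng r0 rl strT) dot0l.
Qed.

Lemma Q_straight s : `|s - s0| < 3 * r -> Q s = 0.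
Proof.
have Q0 : Q s0 = 0 by rewrite /momentum vitg_xx oppr0.
have dQ x : `|x - s0| < 3 * r -> vder Q x 0.
  move=> xs; apply: (vder_eq (vder_Q x)); rewrite /qvec strT // -enorm_sq e1 expr1n.
  by apply/rowP => i; rewrite !mxE; ring.
rewrite -Q0 => ss; have [sle|/ltW sle] := leP s s0.
  apply: vder0_const => // x /andP[x1 x2]; apply: dQ.
  by move: ss; rewrite !ltr_norml; lra.
apply/esym; apply: vder0_const => // x /andP[x1 x2]; apply: dQ.
by move: ss; rewrite !ltr_norml; lra.
Qed.

Lemma Q_bound s : enorm (Q s) <= 4 * l.
Proof.
have [k Hk] := mod_shift s0 s l0.
rewrite -(periodicz k s Q_per); set x := s + _ in Hk *.
rewrite /momentum enormN; apply: (@le_trans _ _ (itg (fun=> 4) s0 x)).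
  apply: enorm_vitg; [exact: cont_qvec|exact: cont_cst|by move: Hk; lra|].
  by move=> y _; exact: qvec_le4.
by rewrite itg_cst ler_pM2l //; move: Hk; lra.
Qed.

Lemma Q_vLip : vLip Q.
Proof. by apply: (vder_vLip vder_Q); exists 4 => s; rewrite enormN; exact: qvec_le4. Qed.

(** The amount by which the averaged curve fails to satisfy the Euler-Lagrange
    equation [(1 - dot e T) T' = Q]. *)
Definition defect h s := (1 - dot e (Th g h s)) *: Dh T h s - Q s.

Lemma defect_vLip h : 0 < h -> vLip (defect h).
Proof.
move=> h0; apply: vLipD.
  have lt := Th_vLip cu TL h0.
  apply: vLip_scale; last by exists 1 => s; exact: Dh_le1.
  - apply: LipD; first exact: Lip_cst.
    apply: LipN; apply: vLip_dot => //; first exact: vLip_cst.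
      by exists 1 => s; rewrite e1.
    by exists 1 => s; exact: (Th_le1 cu).
  - exists 2 => s; have := dot_ler_norm e (Th g h s); rewrite e1 mul1r.
    by have := Th_le1 cu s h0; rewrite !ler_norml; lra.
  - exact: Dh_vLip.
have [K HK] := Q_vLip; exists K => s t.
by rewrite -opprD enormN HK.
Qed.

Lemma defect_bound h s : 0 < h -> enorm (defect h s) <= 2 + 4 * l.
Proof.
move=> h0; apply: le_trans (enormBD _ _) _; apply: lerD; last exact: Q_bound.
rewrite enormZ -[leRHS]mulr1; apply: ler_pM; rewrite ?enorm_ge0 ?Dh_le1 //.
have := dot_ler_norm e (Th g h s); rewrite e1 mul1r.
by have := Th_le1 cu s h0; rewrite !ler_norml; lra.
Qed.

Lemma defect_per h : periodic (defect h) l.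
Proof. by move=> s; rewrite /defect (Th_per cu) (Dh_per cu) Q_per. Qed.

Lemma defect_straight h s (k : int) : 0 < h -> h < r ->
  `|s + k%:~R * l - s0| < 2 * r -> defect h s = 0.
Proof.
move=> h0 hr ks; rewrite /defect (straight_h cu strT h0 hr ks).2 scaler0 sub0r.
rewrite -(periodicz k s Q_per) Q_straight ?oppr0 //.
by apply: lt_trans ks _; move: r0; lra.
Qed.

End Momentum.

(** Testing [cost_ge] against a primitive of minus the defect shows that the
    defect of the Euler-Lagrange equation tends to 0 in mean square. *)
Lemma defect_small (R : realType) (n : nat) (l : R) (g T : R -> 'rV[R]_n) (s0 r : R)
    (e : 'rV[R]_n) :
  closed_unit l g T -> lip1 T -> no_gain l T -> 0 < r -> r <= l / 4 ->
  (forall s, `|s - s0| < 3 * r -> T s = e) ->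
  exists C d0 : R, [/\ 0 < d0, 0 <= C & forall d, 0 < d -> d < d0 ->
    itg (fun s => enorm (defect g T s0 e (d ^+ 2) s) ^+ 2) 0 l <= C * d].
Proof.
move=> cu TL ng r0 rl strT; have e1 := e_unit cu r0 strT.
case: (cu) => l0 us pg _; have T1 := us.2.
have pT : periodic T l := der_periodic us.1 pg.
have T1' s : enorm (T s) <= 1 by rewrite T1.
have [beta [pb lb b02 bpos bsupp]] := @bump_exists R l s0 r l0 r0 rl.
have b2 s : 0 <= beta s by case/andP: (b02 s).
have b3 s : beta s <= 2 by case/andP: (b02 s).
have cb : continuous beta := Lip_cont lb.
pose b := itg beta 0 l.
have b0 : 0 < b.
  by apply: (@itg_gt0_per _ _ _ _ _ cu beta s0) => //; apply: bpos; rewrite subrr normr0.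
pose N := 2 + 4 * l; have N0 : 0 < N by rewrite /N; move: l0; clear; lra.
pose A1 := 2 / b * (N * l) + N.
have A10 : 0 < A1 by rewrite addr_gt0 // mulr_gt0 ?divr_gt0 // mulr_gt0.
pose A := 1 + A1 + A1 * l.
have A1l : 0 < A1 * l by rewrite mulr_gt0.
have hA : 1 <= A by rewrite /A; move: A10 A1l; clear; lra.
have A0 : 0 < A by move: hA; clear; lra.
have [C [d0 [d00 C0 H]]] := cost_ge cu TL ng r0 rl strT hA.
pose Q := momentum e T s0.
have cQ : vcont Q by apply: vder_vcont (vder_Q cu TL r0 strT).
have cq : vcont (qvec e T) := cont_qvec cu TL r0 strT.
exists (C + 5 * A * l), (Num.min d0 (Num.min 1 r)); split.
- by rewrite !lt_min d00 ltr01.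
- by rewrite addr_ge0 // mulr_ge0 ?(ltW l0) // mulr_ge0 // ltW.
move=> d dp; rewrite !lt_min => /andP[dd0 /andP[d1 dr]].
pose h := d ^+ 2.
have hp : 0 < h by rewrite exprn_gt0.
have hd : h <= d by rewrite /h expr2 ger_pMr // ltW.
have hr : h < r by exact: le_lt_trans hd dr.
pose M := defect g T s0 e h.
have lM : vLip M := defect_vLip cu TL r0 strT hp.
have cM : vcont M := vLip_vcont lM.
have MN s : enorm (M s) <= N := defect_bound cu TL ng r0 rl strT s hp.
have pM : periodic M l := defect_per cu TL ng r0 rl strT h.
have bM s : beta s *: M s = 0.
  have [->|bn] := eqVneq (beta s) 0; first by rewrite scale0r.
  have [k Hk] := bsupp s bn; rewrite /M (defect_straight cu TL ng r0 rl strT hp hr (k := k)) ?scaler0 //.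
  by apply: lt_trans Hk _; move: r0; clear; lra.
pose m := vitg M 0 l.
have mN : enorm m <= N * l.
  have -> : N * l = itg (fun=> N) 0 l by rewrite itg_cst subr0.
  by apply: enorm_vitg => //; [exact: cont_cst|exact: ltW].
pose psi s := (b^-1 * beta s) *: m - M s.
have cbm : vcont (fun s => (b^-1 * beta s) *: m).
  by apply: vcontZ; [apply: contM => //; exact: cont_cst|exact: vcont_cst].
have lpsi : vLip psi.
  apply: vLipD.
    apply: vLip_scale; [exact: LipZ| |exact: vLip_cst|by exists (enorm m)].
    exists (b^-1 * 2) => s; rewrite normrM !ger0_norm ?invr_ge0 ?(ltW b0) //.
    by rewrite ler_pM2l ?invr_gt0.
  by have [K HK] := lM; exists K => s t; rewrite -opprD enormN HK.
have cpsi : vcont psi := vLip_vcont lpsi.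
have psiA s : enorm (psi s) <= A1.
  apply: le_trans (enormBD _ _) _; apply: lerD => //.
  rewrite enormZ; apply: ler_pM; rewrite ?enorm_ge0 //.
  by rewrite normrM !ger0_norm ?invr_ge0 ?(ltW b0) // mulrC ler_pM2r ?invr_gt0.
have ppsi : periodic psi l by move=> s; rewrite /psi pb pM.
have ipsi : vitg psi 0 l = 0.
  have -> : vitg psi 0 l = vitg (fun s => (b^-1 * beta s) *: m) 0 l - m.
    have c1 : vcont (fun s => -1 *: M s) by apply: vcontZ => //; exact: cont_cst.
    rewrite -scaleN1r -vitgZ // -vitgD //; congr vitg; apply/funext => s.
    by rewrite scaleN1r.
  apply/eqP; rewrite subr_eq0; apply/eqP; apply: dot_eqP => z; rewrite dot_vitg //.
  rewrite (_ : (fun s => _) = fun s => (b^-1 * dot m z) * beta s); last first.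
    by apply/funext => s; rewrite dotZl; ring.
  by rewrite itgZ // -/b mulrAC mulVf ?mul1r // gt_eqF.
pose a s := vitg psi s0 s.
have ader s : vder a s (psi s) by exact: vder_vitg.
have pa : periodic a l.
  move=> s; apply: dot_eqP => z; rewrite !dot_vitg //.
  apply: prim_periodic; [exact: cpsi|by move=> x; rewrite ppsi|].
  by rewrite -dot_vitg // ipsi dot0l.
have aA s : enorm (a s) <= A1 * l.
  have [k Hk] := mod_shift s0 s l0.
  rewrite -(periodicz k s pa); set x := s + _ in Hk *.
  apply: (@le_trans _ _ (itg (fun=> A1) s0 x)).
    apply: enorm_vitg => //; [exact: cont_cst|by move: Hk; clear; lra].
  by rewrite itg_cst ler_pM2l //; move: Hk; clear; lra.
have aA' s : enorm (a s) <= A by apply: le_trans (aA s) _; rewrite /A; move: A10; clear; lra.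
have psiA' s : enorm (psi s) <= A by apply: le_trans (psiA s) _; rewrite /A; move: A1l; clear; lra.
have K := H d dp dd0 a psi ader lpsi pa aA' psiA'.
have ca : vcont a := vder_vcont ader.
have caQ : continuous (fun s => dot (psi s) (Q s) - dot (a s) (qvec e T s)).
  by apply: contB; apply: vcont_dot.
have iaQ : itg (fun s => dot (psi s) (Q s) - dot (a s) (qvec e T s)) 0 l = 0.
  have D (s : R) : is_derive s 1 (fun s => dot (a s) (Q s)) (dot (psi s) (Q s) - dot (a s) (qvec e T s)).
    by apply: (der_eq (vder_dot (ader s) (vder_Q cu TL r0 strT s))); rewrite dotNr.
  rewrite (itgE 0 l caQ D) -{1}(add0r l) pa -{1}(add0r l).
  by rewrite /Q (Q_per cu TL ng r0 rl strT) subrr.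
have cM2 : continuous (fun s => enorm (M s) ^+ 2).
  by rewrite (_ : (fun s => _) = fun s => dot (M s) (M s)); [exact: vcont_dot|apply/funext => s; rewrite enorm_sq].
have t1 s : enorm (Th g h s) <= 1 by exact: (Th_le1 cu).
have lt : vLip (Th g h) := Th_vLip cu TL hp.
have cc : continuous (fun s => dot e (Th g h s)).
  by apply: vcont_dot; [exact: vcont_cst|exact: vLip_vcont].
have ccost : continuous (cost g T e h a psi).
  apply: contB.
    apply: contM; first by apply: contB => //; exact: cont_cst.
    by apply: vcont_dot => //; apply: vLip_vcont; exact: (Dh_vLip TL).
  apply: vcont_dot => //; apply: (vLip_vcont (f := qvec e (Th g h))).
  exact: qvec_vLip.
have : itg (cost g T e h a psi) 0 l <=
  itg (fun s => (5 * h * A + (-1) * enorm (M s) ^+ 2) +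
     (dot (psi s) (Q s) - dot (a s) (qvec e T s))) 0 l.
  apply: itg_le => //; [|exact: ltW|move=> s _].
    apply: contD => //; apply: contD; first exact: cont_cst.
    by apply: contM => //; exact: cont_cst.
  have h1 : dot (psi s) (M s) = - enorm (M s) ^+ 2.
    rewrite /psi dotBl dotZl -mulrA -dotZr.
    by rewrite bM dot0r mulr0 sub0r enorm_sq.
  have h2 : cost g T e h a psi s = dot (psi s) (M s) + dot (psi s) (Q s) - dot (a s) (qvec e (Th g h) s).
    by rewrite /cost /M /defect -/(Q s) (dotBr (psi s)) (dotZr (1 - dot e (Th g h s)) (psi s)) subrK.
  have h3 := qvec_close e1 (t1 s) (T1 s) (Th_close cu TL s hp).
  have h4 := dot_le (a s) (qvec e T s - qvec e (Th g h) s).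
  have h5 : enorm (a s) * enorm (qvec e T s - qvec e (Th g h) s) <= A * (5 * h).
    by apply: ler_pM; rewrite ?enorm_ge0 // enormB.
  rewrite h2 h1; rewrite dotBr in h4; move: (le_trans h4 h5); clear; lra.
have c1 : continuous (fun s => -1 * enorm (M s) ^+ 2) by apply: contM => //; exact: cont_cst.
have c2 : continuous (fun s => 5 * h * A + -1 * enorm (M s) ^+ 2).
  by apply: contD => //; exact: cont_cst.
rewrite (itgD 0 l c2 caQ) iaQ addr0 (itgD 0 l (@cont_cst R _) c1) itg_cst subr0 itgZ //.
have : 5 * h * A * l <= 5 * A * l * d.
  have -> : 5 * h * A * l = 5 * A * l * h by ring.
  by rewrite ler_wpM2l // mulr_ge0 ?(ltW l0) // mulr_ge0 // ltW.
rewrite -/M; move: K; clear; lra.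
Qed.

(** * The Euler-Lagrange differential equation *)

(** The defect is integrated from [s] to [t] and its mean square tends to 0 with
    the averaging scale. Replacing the coefficient [1 - dot e (T u)] by its value
    at [x] costs at most [(t - s) ^+ 2], because [T] is 1-Lipschitz. *)
Lemma euler_eq (R : realType) (n : nat) (l : R) (g T : R -> 'rV[R]_n) (s0 r : R)
    (e : 'rV[R]_n) :
  closed_unit l g T -> lip1 T -> no_gain l T -> 0 < r -> r <= l / 4 ->
  (forall s, `|s - s0| < 3 * r -> T s = e) ->
  forall x s t, s <= x -> x <= t -> t <= s + l ->
  enorm ((1 - dot e (T x)) *: (T t - T s) - vitg (momentum e T s0) s t) <= (t - s) ^+ 2.
Proof.
move=> cu TL ng r0 rl strT x s t sx xt tl; have e1 := e_unit cu r0 strT.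
case: (cu) => l0 us pg _; have T1 := us.2.
have st : s <= t by exact: le_trans xt.
have ts0 : 0 <= t - s by rewrite subr_ge0.
have [C [d0 [d00 C0 H]]] := defect_small cu TL ng r0 rl strT.
pose Q := momentum e T s0.
have cQ : vcont Q by apply: vder_vcont (vder_Q cu TL r0 strT).
apply: enorm_le_test; first exact: sqr_ge0.
move=> b b1; rewrite dotBl dotZl dot_vitg // -/Q.
set W := _ - _.
have cx : `|1 - dot e (T x)| <= 2.
  have := dot_ler_norm e (T x); rewrite e1 T1 mul1r !ler_norml; clear; lra.
suff S p : 0 < p -> W - (t - s) ^+ 2 - p / 2 * (t - s) <= 0.
  apply/ler_addgt0Pr => p p0.
  have tp : 0 < t - s + 1 by rewrite ltr_wpDl.
  have := S (2 * (p / (t - s + 1))); rewrite mulr_gt0 ?divr_gt0 // => /(_ isT).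
  have : p / (t - s + 1) * (t - s) <= p.
    by rewrite mulrAC ler_pdivrMr // ler_pM2l //; clear; lra.
  clear; lra.
move=> p0.
apply: (@le0_small _ _ (8 + (t - s) + C / (2 * p)) (Num.min d0 1)).
  by rewrite lt_min d00 ltr01.
move=> d dp; rewrite lt_min => /andP[dd0 d1].
pose h := d ^+ 2.
have hp : 0 < h by rewrite exprn_gt0.
have hd : h <= d by rewrite /h expr2 ger_pMr // ltW.
pose M := defect g T s0 e h.
have cM : vcont M by apply: vLip_vcont; exact: (defect_vLip cu TL r0 strT hp).
have cM2 : continuous (fun s => enorm (M s) ^+ 2).
  rewrite (_ : (fun s => _) = fun s => dot (M s) (M s)); first exact: vcont_dot.
  by apply/funext => y; rewrite enorm_sq.
have iM : itg (fun s => enorm (M s) ^+ 2) s t <= C * d.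
  apply: le_trans (H d dp dd0); rewrite -/h -/M.
  have pM2 : periodic (fun s => enorm (M s) ^+ 2) l.
    by move=> y; rewrite /M (defect_per cu TL ng r0 rl strT).
  have := itg_period 0 s cM2 pM2; rewrite add0r => ->.
  rewrite -(itg_cat _ s t (s + l)) lerDl; apply: itg_ge0 => // y _; exact: sqr_ge0.
pose D := Dh T h.
have cD : vcont D by apply: vLip_vcont; exact: (Dh_vLip TL).
pose F u := (1 - dot e (T x)) * dot (D u) b - dot (Q u) b.
have cF : continuous F.
  by apply: contB; [apply: contM; [exact: cont_cst|exact: cD]|exact: cQ].
have iF : itg F s t = (1 - dot e (T x)) * dot (Th g h t - Th g h s) b
    - itg (fun u => dot (Q u) b) s t.
  rewrite itgB; [|by apply: contM; [exact: cont_cst|exact: cD]|exact: cQ].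
  rewrite itgZ; last exact: cD.
  congr (_ * _ - _); rewrite dotBl.
  have DD (y : R) : is_derive y 1 (fun y => dot (Th g h y) b) (dot (D y) b).
    exact: (vder_Th cu h y b).
  by rewrite (itgE s t (cD b) DD).
have : itg F s t <= itg (fun u => (2 * p)^-1 * enorm (M u) ^+ 2 + (p / 2 + h + (t - s))) s t.
  apply: itg_le => //.
    by apply: contD; [apply: contM => //; exact: cont_cst|exact: cont_cst].
  move=> u /andP[su ut].
  have -> : F u = dot (M u) b + (dot e (Th g h u) - dot e (T x)) * dot (D u) b.
    by rewrite /F /M /defect -/(Q u) -/(D u) dotBl (dotZl (1 - dot e (Th g h u))); ring.
  have h1 : dot (M u) b <= (2 * p)^-1 * enorm (M u) ^+ 2 + p / 2.
    apply: le_trans (dot_le _ _) _; rewrite b1 mulr1.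
    have sq := sqr_ge0 (enorm (M u) - p).
    have p2 : 0 < 2 * p by rewrite mulr_gt0.
    rewrite -(ler_pM2l p2) mulrDr mulrA mulfV ?gt_eqF // mul1r.
    by move: sq; rewrite !expr2; clear; lra.
  have h2 : `|dot e (Th g h u) - dot e (T x)| <= h + (t - s).
    rewrite -dotBr; apply: le_trans (dot_ler_norm _ _) _; rewrite e1 mul1r.
    apply: le_trans (enorm_tri (T u) _ _) _; apply: lerD; first exact: (Th_close cu TL).
    by apply: le_trans (TL _ _) _; rewrite ler_norml; move: su ut sx xt; clear; lra.
  have h3 : `|dot (D u) b| <= 1.
    by apply: le_trans (dot_ler_norm _ _) _; rewrite b1 mulr1; exact: (Dh_le1 TL).
  have h4 : (dot e (Th g h u) - dot e (T x)) * dot (D u) b <= (h + (t - s)) * 1.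
    by apply: le_trans (ler_norm _) _; rewrite normrM; apply: ler_pM.
  move: h1 h4; clear; lra.
have c1 : continuous (fun u => (2 * p)^-1 * enorm (M u) ^+ 2).
  by apply: contM => //; exact: cont_cst.
rewrite (itgD s t c1 (@cont_cst R _)) (itgZ _ s t cM2) itg_cst iF => K.
have K2 : (2 * p)^-1 * itg (fun s => enorm (M s) ^+ 2) s t <= C / (2 * p) * d.
  rewrite [leLHS]mulrC -[C / _ * _]mulrAC; rewrite ler_pM2r // invr_gt0.
  by rewrite mulr_gt0.
have K3 : W <= (1 - dot e (T x)) * dot (Th g h t - Th g h s) b
    - itg (fun u => dot (Q u) b) s t + 4 * h.
  have -> : W = (1 - dot e (T x)) * dot (Th g h t - Th g h s) b
     - itg (fun u => dot (Q u) b) s t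
     - (1 - dot e (T x)) * dot ((Th g h t - T t) - (Th g h s - T s)) b.
    rewrite /W; move: (Th g h t) (Th g h s) => v1 v2; rewrite !dotBl; ring.
  rewrite lerD2l; apply: le_trans (ler_norm _) _; rewrite normrN normrM.
  have : `|dot ((Th g h t - T t) - (Th g h s - T s)) b| <= 2 * h.
    apply: le_trans (dot_ler_norm _ _) _; rewrite b1 mulr1.
    apply: le_trans (enormBD _ _) _.
    by have := Th_close cu TL t hp; have := Th_close cu TL s hp; clear; lra.
  have -> : 4 * h = 2 * (2 * h) by ring.
  by move=> h5; apply: ler_pM.
have K4 : (t - s) * h <= (t - s) * d by rewrite ler_wpM2l.
have ts2 : (t - s) ^+ 2 = (t - s) * (t - s) by rewrite expr2.
rewrite ts2; move: K K2 K3 K4 hd dp; clear; lra.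
Qed.

Lemma der_O2 {R : realType} (f phi : R -> R) (s m K d0 : R) : 0 < d0 ->
  (forall t, `|t - s| < d0 -> `|(f t - f s) - (phi t - phi s)| <= K * `|t - s| ^+ 2) ->
  is_derive s 1 phi m -> is_derive s 1 f m.
Proof.
move=> d00 H /der_edP Hp; apply/der_edP => e e0.
have e2 : 0 < e / 2 by rewrite divr_gt0.
have [d dp Hd] := Hp _ e2.
have K1 : 0 < `|K| + 1 by rewrite ltr_wpDl.
pose d' := Num.min d (Num.min d0 (e / 2 / (`|K| + 1))).
exists d'; first by rewrite !lt_min dp d00 divr_gt0.
move=> t; rewrite !lt_min => /andP[t1 /andP[t2 t3]].
have -> : f t - f s - m * (t - s) =
  ((f t - f s) - (phi t - phi s)) + (phi t - phi s - m * (t - s)) by ring.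
apply: le_trans (ler_normD _ _) _.
have h1 := Hd t t1; have h2 := H t t2.
have h3 : K * `|t - s| ^+ 2 <= e / 2 * `|t - s|.
  rewrite expr2 mulrA ler_wpM2r //.
  rewrite ltr_pdivlMr // in t3.
  have : K * `|t - s| <= `|K| * `|t - s| by rewrite ler_wpM2r // ler_norm.
  by have := normr_ge0 (t - s); move: t3; lra.
move: h1 h2 h3; lra.
Qed.

(** The supremum of the zeros of [f] in the interval. *)
Lemma last_zero {R : realType} (f : R -> R) (a b : R) : continuous f -> a < b -> f a = 0 -> f b != 0 ->
  exists x, [/\ a <= x, x < b, f x = 0 & forall y, x < y -> y <= b -> f y != 0].
Proof.
move=> cf ab fa fb.
pose A := [set t | a <= t <= b /\ f t = 0].
have Aa : A a by split; rewrite ?lexx ?ltW.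
have hs : has_sup A by split; [exists a|exists b => t [/andP[]]].
have sab : a <= sup A <= b.
  rewrite (sup_upper_bound hs) //=; apply: sup_le_ub; first by exists a.
  by move=> t [/andP[]].
have fs : f (sup A) = 0.
  apply/eqP/negPn/negP => fn.
  have /cvgrPdist_lt/(_ `|f (sup A)|) := cf (sup A).
  rewrite normr_gt0 => /(_ fn) [d /= d0 Hd].
  have [t At st] := sup_adherent d0 hs.
  have tle := sup_upper_bound hs At.
  have := Hd t; rewrite /ball /= ger0_norm ?subr_ge0 // => /(_ ltac:(lra)).
  by case: At => _ ->; rewrite subr0 ltxx.
case/andP: sab => sa sb; exists (sup A); split=> //.
  by rewrite lt_neqAle sb andbT; apply: contraNneq fb => <-; rewrite fs.
move=> y sy yb; apply/eqP => fy; have : A y by split=> //; rewrite yb andbT (le_trans sa) // ltW.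
by move=> /(sup_upper_bound hs); rewrite leNgt sy.
Qed.

Section ODE.
Context {R : realType} {n : nat}.
Notation V := 'rV[R]_n.
Implicit Types (s t x : R).
Variables (l : R) (g T : R -> V) (s0 r : R) (e : V).
Hypotheses (cu : closed_unit l g T) (TL : lip1 T) (ng : no_gain l T).
Hypotheses (r0 : 0 < r) (rl : r <= l / 4).
Hypothesis strT : forall s, `|s - s0| < 3 * r -> T s = e.
Notation Q := (momentum e T s0).
Notation c s := (dot e (T s)).

Let l0 : 0 < l. Proof. by case: cu. Qed.
Let us : unit_speed g T. Proof. by case: cu. Qed.
Let T1 := us.2.
Let pg : periodic g l. Proof. by case: cu. Qed.
Let pT : periodic T l. Proof. exact: der_periodic us.1 pg. Qed.
Let e1 : enorm e = 1. Proof. exact: e_unit cu r0 strT. Qed.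
Let cT : vcont T. Proof. exact: lip1_vcont. Qed.
Let dQ s : vder Q s (- qvec e T s). Proof. exact: (vder_Q cu TL r0 strT). Qed.
Let cQ : vcont Q. Proof. exact: vder_vcont dQ. Qed.
Let ee : dot e e = 1. Proof. by rewrite -enorm_sq e1 expr1n. Qed.

Lemma c_le1 s : c s <= 1.
Proof. by apply: le_trans (dot_le _ _) _; rewrite e1 T1 mulr1. Qed.

Lemma c_eq1 s : c s = 1 -> T s = e.
Proof.
move=> cs; apply/eqP; rewrite -subr_eq0; apply/eqP/dot_eq0.
by rewrite !dotE (unit_dot _ T1) (dotC _ e) cs ee; lra.
Qed.

(** The Euler-Lagrange equation with the coefficient evaluated at [s], on both
    sides of [s]. *)
Lemma euler_at s t b : `|t - s| < l ->
  `|(1 - c s) * (dot (T t) b - dot (T s) b) - itg (fun x => dot (Q x) b) s t| <= enorm b * `|t - s| ^+ 2.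
Proof.
move=> ts.
have key x y : x <= y -> y <= x + l -> x <= s -> s <= y ->
  `|(1 - c s) * (dot (T y) b - dot (T x) b) - itg (fun x => dot (Q x) b) x y| <= enorm b * `|y - x| ^+ 2.
  move=> xy yl xs sy; rewrite (ger0_norm (_ : 0 <= y - x)) ?subr_ge0 //.
  have h := dot_ler_norm ((1 - c s) *: (T y - T x) - vitg Q x y) b.
  rewrite dotBl dotZl dotBl dot_vitg // in h; apply: le_trans h _.
  rewrite mulrC ler_wpM2l ?enorm_ge0 //.
  exact: (euler_eq cu TL ng r0 rl strT xs sy yl).
have [st|/ltW st] := leP s t.
  by apply: key => //; move: ts; rewrite ger0_norm ?subr_ge0 //; lra.
rewrite distrC in ts; have ts' : s - t < l by rewrite ger0_norm ?subr_ge0 // in ts.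
have := key t s st (ltac:(lra)) st (lexx _); rewrite (distrC t).
have -> : (1 - c s) * (dot (T s) b - dot (T t) b) - itg (fun x => dot (Q x) b) t s =
    - ((1 - c s) * (dot (T t) b - dot (T s) b) - itg (fun x => dot (Q x) b) s t).
  by rewrite (itg_opp _ t s); ring.
by rewrite normrN.
Qed.

Let cle1 s : c s <= 1. Proof. exact: (c_le1 s). Qed.
Let ceq1 s : c s = 1 -> T s = e. Proof. exact: c_eq1. Qed.

Let cgeN1 s : -1 <= c s.
Proof. by have := dot_ler_norm e (T s); rewrite e1 T1 mulr1 ler_norml => /andP[]. Qed.

Lemma circle_alg (f k : R) (t m : V) : 1 - f != 0 ->
  (- (0 - (1 - f) * k / (1 - f)) / (1 - f) ^+ 2) *: ((1 - f) *: m) +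
    (1 - f)^-1 *: - (f *: t + k *: m + (1 - 2 * f) *: t) = - t.
Proof. by move=> f0; apply/rowP => i; rewrite !mxE; field. Qed.

(** Away from the parameters where [T = e] the Euler-Lagrange equation can be
    solved for the derivative of [T]. *)
Lemma vder_T s : c s < 1 -> vder T s ((1 - c s)^-1 *: Q s).
Proof.
move=> cs b; have f0 : 1 - c s != 0 by rewrite subr_eq0 eq_sym lt_eqF.
pose phi t := (1 - c s)^-1 * itg (fun x => dot (Q x) b) s t.
have dphi : is_derive s 1 phi (dot ((1 - c s)^-1 *: Q s) b).
  by rewrite dotZl; apply: derZ; apply: der_itg; exact: cQ.
apply: (der_O2 (K := `|(1 - c s)^-1| * enorm b) l0) dphi => t ts.
have := euler_at b ts.
have -> : dot (T t) b - dot (T s) b - (phi t - phi s) =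
   (1 - c s)^-1 * ((1 - c s) * (dot (T t) b - dot (T s) b) - itg (fun x => dot (Q x) b) s t).
  by rewrite /phi itg_xx; field.
by rewrite normrM -mulrA => h; rewrite ler_wpM2l.
Qed.

(** Where [T = e] the equation degenerates and reduces to the vanishing of [Q]. *)
Lemma Q_at1 s : c s = 1 -> Q s = 0.
Proof.
move=> cs; apply: dot_eqP => b; rewrite dot0l.
have d1 : is_derive s 1 (fun t => itg (fun x => dot (Q x) b) s t) (dot (Q s) b).
  by apply: der_itg; exact: cQ.
apply: (der_unique d1).
apply: (der_O2 (K := enorm b) l0) (der_cst 0 s) => t ts.
have := euler_at b ts; rewrite cs subrr mul0r sub0r normrN.
by rewrite itg_xx !subr0.
Qed.

Lemma c_at1 s t : c s = 1 -> 0 <= 1 - c t <= `|t - s| ^+ 2 / 2.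
Proof.
move=> cs; rewrite subr_ge0 cle1 /=.
have : enorm (T t - T s) ^+ 2 <= `|t - s| ^+ 2.
  by rewrite ler_pXn2r ?nnegrE ?enorm_ge0 // TL.
rewrite (ceq1 cs) enorm_sq !dotE ee (unit_dot _ T1) (dotC (T t)); lra.
Qed.

Lemma der_c s : c s < 1 -> is_derive s 1 (fun s => c s) (dot e (Q s) / (1 - c s)).
Proof.
move=> cs; have := vder_T cs e; rewrite dotZl (dotC (Q s)) mulrC.
by apply: der_near; exists 1 => // t _; rewrite dotC.
Qed.

Lemma der_k s : is_derive s 1 (fun s => dot e (Q s)) (- (1 + (1 - 2 * c s) * c s)).
Proof.
have := dQ s e; rewrite dotNl /qvec dotDl dotZl ee (dotC (T s)).
by apply: der_near; exists 1 => // t _; rewrite dotC.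
Qed.

Lemma QT0 s : c s < 1 -> dot (Q s) (T s) = 0.
Proof.
move=> cs; have d1 := vder_dot (vder_T cs) (vder_T cs).
have d2 : is_derive s 1 (fun t => dot (T t) (T t)) 0.
  rewrite (_ : (fun t => _) = fun=> 1); first exact: der_cst.
  by apply/funext => t; exact: unit_dot.
have := der_unique d1 d2; rewrite !dotE (dotC (T s)) => /eqP.
rewrite -mulr2n mulrn_eq0 /= mulf_eq0 invr_eq0 subr_eq0 eq_sym lt_eqF //=.
by move=> /eqP.
Qed.

(** First integral of the system. Where [T = e] both sides vanish to second order,
    so that the derivative of the difference is 0 there as well. *)
Lemma Q_norm s : dot (Q s) (Q s) = (1 - c s) ^+ 2.
Proof.
suff H x : is_derive x 1 (fun s => dot (Q s) (Q s) - (1 - c s) ^+ 2) 0.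
  have := @der0_const _ (fun s => dot (Q s) (Q s) - (1 - c s) ^+ 2) s s0 H.
  have s00 : `|s0 - s0| < 3 * r by rewrite subrr normr0 mulr_gt0.
  rewrite (Q_straight cu TL r0 strT s00) (strT s00) ee dot0l subrr expr0n subr0 => /eqP.
  by rewrite subr_eq0 => /eqP.
have dQQ := vder_dot (dQ x) (dQ x).
have := cle1 x; rewrite le_eqVlt => /orP[/eqP cx|cx].
  rewrite (Q_at1 cx) dot0l dot0r addr0 in dQQ; rewrite -[X in is_derive _ _ _ X](subrr 0).
  apply: derB => //; apply: (der_O2 (K := 1) ltr01) (der_cst 0 x) => t _.
  rewrite cx subrr expr0n !subr0 mul1r ger0_norm ?sqr_ge0 //.
  by have := c_at1 t cx; have := cgeN1 t; rewrite (expr2 (1 - _)); nra.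
have f0 : 1 - c x != 0 by rewrite subr_eq0 eq_sym lt_eqF.
have d1 := derB (der_cst 1 x) (der_c cx).
apply: (der_eq (derB dQQ (derM d1 d1))).
rewrite (dotC (Q x)) dotNl /qvec dotDl dotZl (dotC (T x)) (QT0 cx) mulr0 addr0 sub0r.
by field.
Qed.

(** A second first integral, again degenerate to second order where [T = e]. *)
Lemma k_sq s : dot e (Q s) ^+ 2 = (1 - c s) ^+ 2 * (1 - c s ^+ 2).
Proof.
pose G x := (1 - c x) ^+ 2 * (1 - c x ^+ 2) - dot e (Q x) ^+ 2.
suff H x : is_derive x 1 G 0.
  have := @der0_const _ G s s0 H; rewrite /G.
  have s00 : `|s0 - s0| < 3 * r by rewrite subrr normr0 mulr_gt0.
  rewrite (Q_straight cu TL r0 strT s00) (strT s00) ee dot0r !(subrr, expr0n, expr1n, mul0r, subr0) /=.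
  by move=> /eqP; rewrite subr_eq0 => /eqP.
have dk2 := derM (der_k x) (der_k x).
have := cle1 x; rewrite le_eqVlt => /orP[/eqP cx|cx].
  rewrite (Q_at1 cx) dot0r mulr0 mul0r addr0 in dk2.
  rewrite -[X in is_derive _ _ _ X](subrr 0); apply: derB => //.
  apply: (der_O2 (K := 1) ltr01) (der_cst 0 x) => t _.
  rewrite cx subrr expr0n mul0r !subr0 mul1r.
  have h := c_at1 t cx; have h' := cgeN1 t; have h2 : c t <= 1 := cle1 t.
  have h3 : 0 <= 1 - c t ^+ 2 <= 1 by rewrite expr2; nra.
  have h4 : (1 - c t) ^+ 2 <= `|t - x| ^+ 2 by rewrite (expr2 (1 - _)); nra.
  rewrite ger0_norm; last by rewrite mulr_ge0 ?sqr_ge0 //; case/andP: h3.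
  rewrite -[leRHS]mulr1; apply: ler_pM => //; [exact: sqr_ge0|by case/andP: h3..].
have f0 : 1 - c x != 0 by rewrite subr_eq0 eq_sym lt_eqF.
have dc := der_c cx; have d1 := derB (der_cst 1 x) dc.
have d2 := derB (der_cst 1 x) (derM dc dc).
apply: (der_eq (derB (derM (derM d1 d1) d2) dk2)).
by field.
Qed.

(** The normal of the curve: where [T <> e] it is the derivative of [T]. *)
Definition nvec s := (1 - c s)^-1 *: Q s.

Lemma nvec_unit s : c s < 1 -> dot (nvec s) (nvec s) = 1.
Proof.
move=> cs; have f0 : 1 - c s != 0 by rewrite subr_eq0 eq_sym lt_eqF.
by rewrite dotZl dotZr Q_norm; field.
Qed.

(** By the two first integrals [e] lies in the plane spanned by [T] and [nvec],
    which turns the system into that of the unit circle, [T' = nvec] and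
    [nvec' = - T]. *)
Lemma vder_nvec s : c s < 1 -> vder nvec s (- T s).
Proof.
move=> cs; have f0 : 1 - c s != 0 by rewrite subr_eq0 eq_sym lt_eqF.
have d1 := @derV _ (fun t => 1 - c t) s _ f0 (derB (der_cst 1 s) (der_c cs)).
apply: (vder_eq (vderM d1 (dQ s))).
pose k := dot e (nvec s).
have kE : dot e (Q s) = (1 - c s) * k by rewrite /k dotZr mulrA mulfV // mul1r.
have NT : dot (nvec s) (T s) = 0 by rewrite dotZl (QT0 cs) mulr0.
have k2 : k ^+ 2 = 1 - c s ^+ 2.
  have := k_sq s; rewrite kE exprMn => /mulfI; apply.
  by rewrite expf_neq0.
have E : e = c s *: T s + k *: nvec s.
  apply/eqP; rewrite -subr_eq0; apply/eqP/dot_eq0.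
  have := unit_dot s T1; have := nvec_unit cs; move: k2 NT; rewrite /k.
  move: (T s) (nvec s) => t m; rewrite !dotE ee (dotC t e) (dotC t m) (dotC m e) => k2 NT mm tt.
  by rewrite NT mm tt; ring: k2.
have QN : Q s = (1 - c s) *: nvec s by rewrite /nvec scalerA mulfV // scale1r.
have qE : qvec e T s = c s *: T s + k *: nvec s + (1 - 2 * c s) *: T s.
  by rewrite /qvec {1}E.
rewrite qE kE [X in _ *: X + _]QN.
exact: circle_alg.
Qed.

End ODE.

(** * Extremal curves have curvature 1 everywhere *)

Lemma der0_const_on (R : realType) (f : R -> R) (a b : R) : a <= b ->
  (forall x, a <= x <= b -> is_derive x 1 f 0) -> f a = f b.
Proof.
move=> ab H; have D (x : R) : a <= x <= b -> is_derive x 1 (fun _ : R => 0 : R) 0.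
  by move=> _; exact: der_cst.
have h1 := der_le ab H D (fun _ _ => lexx 0); have h2 := der_le ab D H (fun _ _ => lexx 0).
by move: h1 h2; clear; lra.
Qed.

Section Circle.
Context {R : realType} {n : nat}.
Notation V := 'rV[R]_n.
Variables (u : R) (p q : V).

Definition circ s := cos (s - u) *: p + sin (s - u) *: q.
Definition circ' s := - sin (s - u) *: p + cos (s - u) *: q.

Lemma der_cos_sub (s : R) : is_derive s 1 (fun s => cos (s - u)) (- sin (s - u)).
Proof.
have d1 : is_derive s 1 (fun x => x - u) 1.
  by apply: (der_eq (derB (der_id s) (der_cst u s))); rewrite subr0.
have d2 : is_derive (s - u) 1 (@cos R) (- sin (s - u)) by exact: is_derive_cos.
by apply: (der_eq (@der_comp _ (@cos R) (fun x => x - u) s _ _ d2 d1)); rewrite mulr1.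
Qed.

Lemma der_sin_sub (s : R) : is_derive s 1 (fun s => sin (s - u)) (cos (s - u)).
Proof.
have d1 : is_derive s 1 (fun x => x - u) 1.
  by apply: (der_eq (derB (der_id s) (der_cst u s))); rewrite subr0.
have d2 : is_derive (s - u) 1 (@sin R) (cos (s - u)) by exact: is_derive_sin.
by apply: (der_eq (@der_comp _ (@sin R) (fun x => x - u) s _ _ d2 d1)); rewrite mulr1.
Qed.

Lemma vder_circ (s : R) : vder circ s (circ' s).
Proof.
apply: (vder_eq (vderD (vderM (der_cos_sub s) (vder_cst p s)) (vderM (der_sin_sub s) (vder_cst q s)))).
by rewrite !scaler0 !addr0.
Qed.

Lemma vder_circ' s : vder circ' s (- circ s).
Proof.
apply: (vder_eq (vderD (vderM (derN (der_sin_sub s)) (vder_cst p s)) (vderM (der_cos_sub s) (vder_cst q s)))).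
by rewrite !scaler0 !addr0 /circ opprD !scaleNr.
Qed.

Lemma circ_lip : enorm p = 1 -> enorm q = 1 -> forall s t, enorm (circ s - circ t) <= 2 * `|s - t|.
Proof.
move=> p1 q1; apply: (vder_lip vder_circ) => s.
apply: le_trans (enormD _ _) _; rewrite !enormZ p1 q1 !mulr1 normrN.
by have := sin_max (s - u); have := cos_max (s - u); lra.
Qed.

Lemma circ_return s t : dot p p = 1 -> dot q q = 1 -> dot p q = 0 ->
  dot (circ s) (circ t) = 1 -> circ' s = circ' t.
Proof.
move=> pp qq pq; rewrite /circ !dotE pp qq (dotC q) pq !mulr0 !mulr1 addr0 add0r -cosB => C.
have {}C : cos (t - s) = 1 by apply: etrans C; rewrite -cosN; congr cos; ring.
have S : sin (t - s) = 0.
  by apply/eqP; rewrite -sqrf_eq0 sin2cos2 C expr1n subrr.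
have E : t - u = (t - s) + (s - u) by ring.
by rewrite /circ' E (sinD (t - s)) (cosD (t - s)) C S !mul1r !mul0r add0r subr0.
Qed.

End Circle.

(** Being closed, the curve leaves the straight arc, at a parameter [a], and
    has the same tangent again at a parameter [b]. In between it is an arc of a
    unit circle with the same tangent at both ends: it returns to its starting
    point, and is not simple. *)
Lemma straight_false (R : realType) (n : nat) (l : R) (g T : R -> 'rV[R]_n) (s0 r : R)
    (e : 'rV[R]_n) :
  closed_unit l g T -> lip1 T -> no_gain l T -> 0 < r -> r <= l / 4 ->
  (forall s, `|s - s0| < 3 * r -> T s = e) -> False.
Proof.
move=> cu TL ng r0 rl strT; have e1 := e_unit cu r0 strT.
case: (cu) => l0 us pg _; have T1 := us.2.
have pT : periodic T l := der_periodic us.1 pg.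
have cT : vcont T := lip1_vcont TL.
have ee : dot e e = 1 by rewrite -enorm_sq e1 expr1n.
pose f s := 1 - dot e (T s).
have cf : continuous f.
  by apply: contB; [exact: cont_cst|apply: vcont_dot => //; exact: vcont_cst].
have pf : periodic f l by move=> s; rewrite /f pT.
have flt s : f s != 0 -> dot e (T s) < 1.
  rewrite /f subr_eq0 eq_sym => h; rewrite lt_neqAle h /=; exact: (c_le1 cu r0 strT).
have fe s : f s = 0 -> T s = e.
  by move=> /eqP; rewrite subr_eq0 eq_sym => /eqP; exact: (c_eq1 cu r0 strT).
have ef s : T s = e -> f s = 0 by rewrite /f => ->; rewrite ee subrr.
have [s1 fs1] : exists s1, f s1 != 0.
  apply: contrapT => H.
  have Te s : T s = e by apply: fe; apply/eqP/negPn/negP => h; apply: H; exists s.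
  have := vitg_T cu TL; move/(congr1 (fun v => dot v e)); rewrite dot_vitg // dot0l.
  rewrite (_ : (fun s => _) = fun=> 1); last by apply/funext => s; rewrite Te ee.
  by rewrite itg_cst mul1r subr0 => l00; move: l0; rewrite l00 ltxx.
have [k Hk] := mod_shift s0 s1 l0.
pose u := s1 + k%:~R * l; rewrite -/u in Hk.
have fu : f u != 0 by rewrite /u (periodicz k s1 pf).
have u3 : s0 + 3 * r <= u.
  rewrite leNgt; apply/negP => h; move/eqP: fu; apply; apply/ef/strT.
  by rewrite ger0_norm; move: Hk h; clear; lra.
have ar : s0 + r < u by move: r0 u3; clear; lra.
have far : f (s0 + r) = 0.
  by apply/ef/strT; rewrite addrAC subrr add0r gtr0_norm //; move: r0; clear; lra.
have [a [ra au fa fau]] := last_zero cf ar far fu.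
(* The next zero after [u] is the last one before [- u] of the reversed
   function. *)
pose f2 x := f (- x).
have cf2 : continuous f2.
  move=> x; apply: (@continuous_comp _ _ _ (fun x : R => - x) f); last exact: cf.
  by apply: cvgN; exact: cvg_id.
have b1 : - (s0 + l) < - u by rewrite ltrN2; move: Hk; clear; lra.
have fb1 : f2 (- (s0 + l)) = 0.
  by rewrite /f2 opprK pf; apply/ef/strT; rewrite subrr normr0 mulr_gt0.
have fb2 : f2 (- u) != 0 by rewrite /f2 opprK.
have [b' [lb bu fb fbu]] := last_zero cf2 b1 fb1 fb2.
pose b := - b'; have {}lb : b <= s0 + l by rewrite lerNl.
have {}bu : u < b by rewrite ltrNr.
have cc x : a < x -> x < b -> dot e (T x) < 1.
  move=> ax xb; apply: flt; have [xu|ux] := leP x u; first exact: fau.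
  rewrite -[x]opprK; apply: fbu; first by rewrite ltrNr.
  by rewrite lerN2 ltW.
have cu1 : dot e (T u) < 1 by exact: cc.
pose p := T u; pose q := nvec T s0 e u.
have pp : dot p p = 1 by exact: unit_dot.
have qq : dot q q = 1 by exact: (nvec_unit cu TL ng r0 rl strT).
have pq : dot p q = 0 by rewrite dotC /q /nvec dotZl (QT0 cu TL ng r0 rl strT) // mulr0.
have p1 : enorm p = 1 by exact: T1.
have q1 : enorm q = 1 by rewrite /enorm qq sqrtr1.
(* Both [(T, nvec)] and [(circ, circ')] solve the linear system of the circle,
   whose flow is isometric: [H] is constant. *)
pose H x := dot (T x - circ u p q x) (T x - circ u p q x)
   + dot (nvec T s0 e x - circ' u p q x) (nvec T s0 e x - circ' u p q x).
have dH x : a < x -> x < b -> is_derive x 1 H 0.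
  move=> ax xb; have cx := cc x ax xb.
  have d1 := vderB (vder_T cu TL ng r0 rl strT cx) (vder_circ u p q x).
  have d2 := vderB (vder_nvec cu TL ng r0 rl strT cx) (vder_circ' u p q x).
  apply: (der_eq (derD (vder_dot d1 d1) (vder_dot d2 d2))).
  rewrite -/(nvec T s0 e x); move: (T x) (nvec _ _ _ _) (circ _ _ _ _) (circ' _ _ _ _) => v1 v2 v3 v4.
  by rewrite !dotE (dotC v2 v1) (dotC v4 v1) (dotC v2 v3) (dotC v4 v3); ring.
have Hu : H u = 0.
  by rewrite /H /circ /circ' subrr cos0 sin0 oppr0 !scale1r !scale0r addr0 add0r !subrr !dot0l addr0.
have TS x : a < x -> x < b -> T x = circ u p q x.
  move=> ax xb; have : H x = 0.
    rewrite -Hu; have [xu|/ltW ux] := leP x u.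
      by apply: der0_const_on => // y /andP[xy yu]; apply: dH; [exact: lt_le_trans xy|exact: le_lt_trans bu].
    by apply/esym/der0_const_on => // y /andP[xy yu]; apply: dH; [exact: lt_le_trans xy|exact: le_lt_trans xb].
  move=> /eqP; rewrite paddr_eq0 ?dot_ge0 // => /andP[/eqP/dot_eq0/eqP + _].
  by rewrite subr_eq0 => /eqP.
have Sl := circ_lip u p1 q1.
have lim x0 : (forall d, 0 < d -> d < Num.min (u - a) (b - u) -> exists2 y, T y = circ u p q y & `|x0 - y| <= d) ->
    T x0 = circ u p q x0.
  move=> Hy; apply/eqP; rewrite -subr_eq0; apply/eqP/enorm_eq0/eqP.
  rewrite eq_le enorm_ge0 andbT.
  apply: (@le0_small _ _ 3 (Num.min (u - a) (b - u))); first by rewrite lt_min !subr_gt0 au.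
  move=> d d0 dlt; have [y Ey yd] := Hy d d0 dlt.
  apply: le_trans (enorm_tri (T y) _ _) _; have h1 := TL x0 y.
  have h2 := Sl x0 y; rewrite enormB -Ey in h2.
  by rewrite enormB in h2; rewrite enormB (enormB (T y)) in h2 *; move: h1 h2 yd; lra.
have Ta : T a = circ u p q a.
  apply: lim => d d0; rewrite lt_min => /andP[d1 d2]; exists (a + d).
    by apply: TS; move: d0 d1 bu; clear; lra.
  by rewrite opprD addrA subrr sub0r normrN gtr0_norm.
have Tb : T b = circ u p q b.
  apply: lim => d d0; rewrite lt_min => /andP[d1 d2]; exists (b - d).
    by apply: TS; move: d0 d2 au; clear; lra.
  by rewrite opprB addrC subrK gtr0_norm.
have TS' x : a <= x <= b -> T x = circ u p q x.
  move=> /andP[]; rewrite le_eqVlt => /orP[/eqP <- //|ax].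
  by rewrite le_eqVlt => /orP[/eqP -> //|xb]; exact: TS.
have ab : a < b by exact: lt_trans bu.
have ret : circ' u p q a = circ' u p q b.
  apply: circ_return => //; by rewrite -Ta -Tb (fe a fa) (fe b fb).
(* The centre of the circle is constant. *)
have : g a + circ' u p q a = g b + circ' u p q b.
  apply: (@vder0_const _ _ (fun x => g x + circ' u p q x)); first exact: ltW.
  move=> x xab; apply: (vder_eq (vderD (us.1 x) (vder_circ' u p q x))).
  by rewrite (TS' x xab) subrr.
rewrite ret => /addIr gab.
have abl : 0 < b - a < l by move: ab ra lb r0; clear; lra.
by have := chord_neq cu abl; rewrite gab eqxx.
Qed.

(** The arc would be straight by [slack_straight], which [straight_false]
    excludes. *)
Theorem no_slack (R : realType) (n : nat) (l : R) (g T : R -> 'rV[R]_n) (s0 r eta : R) :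
  closed_unit l g T -> lip1 T -> no_gain l T -> 0 < r -> 0 < eta ->
  (forall s t, `|s - s0| < r -> `|t - s0| < r ->
    enorm (T s - T t) <= (1 - eta) * `|s - t|) -> False.
Proof.
move=> cu TL ng r0 eta0 slack; have [l0 _ _ _] := cu.
pose r1 := Num.min r (l / 4).
have r10 : 0 < r1 by rewrite lt_min r0 divr_gt0.
have r1r : r1 <= r by rewrite ge_min lexx.
have r1l : r1 <= l / 4 by rewrite ge_min lexx orbT.
have slack1 s t : `|s - s0| < r1 -> `|t - s0| < r1 ->
    enorm (T s - T t) <= (1 - eta) * `|s - t|.
  by move=> hs ht; apply: slack; [exact: lt_le_trans hs r1r|exact: lt_le_trans ht r1r].
have str := slack_straight cu TL ng r10 r1l eta0 slack1.
apply: (@straight_false _ _ l g T s0 (r1 / 6) (T s0)) => //.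
- by rewrite divr_gt0.
- by move: r10 r1l; clear; lra.
- by move=> s hs; apply: str; apply: lt_le_trans hs _; clear; lra.
Qed.

(** * Parametrization by arc length *)

Section Links.
Context {R : realType} {n : nat}.
Notation V := 'rV[R]_n.
Implicit Types (f g : R -> V) (s t : R).

Lemma derivable_vder g s : derivable g s 1 -> vder g s (derive1 g s).
Proof.
move=> dg b; have dc i := (derivable_mxP g s 1).1 dg ord0 i.
rewrite derive1E derive_mx // /dot.
apply: der_sum => i; rewrite mxE.
have D : is_derive s 1 (fun t => g t ord0 i) ('D_1 (fun t => g t ord0 i) s) by exact: derivableP.
by apply: (der_eq (derM D (der_cst (b ord0 i) s))); rewrite mulr0 addr0.
Qed.

Lemma vder_derivable g s v : vder g s v -> derivable g s 1 /\ derive1 g s = v.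
Proof.
move=> H; have D i : is_derive s 1 (fun t => g t ord0 i) (v ord0 i).
  rewrite -dot_delta; have := H (delta_mx ord0 i).
  by apply: der_near; exists 1 => // t _; rewrite dot_delta.
have dg : derivable g s 1.
  by apply/derivable_mxP => i j; rewrite (ord1 i); case: (D j).
split=> //; rewrite derive1E derive_mx //; apply/rowP => i; rewrite mxE.
by case: (D i).
Qed.

Lemma continuous_vcont f : continuous f -> vcont f.
Proof.
move=> cf b s; apply: cvg_big => [|i _]; first by move=> p; exact: add_continuous.
apply: cvgM; last exact: cvg_cst.
apply: (@continuous_comp _ _ _ f (fun M : V => M ord0 i)); first exact: cf.
exact: coord_continuous.
Qed.

Lemma vcont_continuous f : vcont f -> continuous f.
Proof.
move=> cf s; apply/cvgrPdist_le => e e0.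
have c1 : continuous (fun t => enorm (f t - f s)).
  by apply: vcont_enorm; apply: vcontB => //; exact: vcont_cst.
have /cvgrPdist_le/(_ e e0) := c1 s; rewrite subrr enorm0.
apply: filterS => t; rewrite sub0r normrN ger0_norm ?enorm_ge0 // => h.
by rewrite distrC; apply: le_trans h; exact: norm_le_enorm.
Qed.

(** The Euclidean norm and the supremum norm are equivalent. *)
Lemma lipschitz_vLip f : [lipschitz f s | s in setT] <-> vLip f.
Proof.
split=> [[M [_ HM]]|[K HK]].
  have M1 : M < M + 1 by rewrite ltrDl.
  have H s t : `|f s - f t| <= (M + 1) * `|s - t| by exact: (HM (M + 1) M1 (s, t)).
  exists (n%:R * (M + 1)) => s t; apply: le_trans (enorm_le_norm _) _.
  by rewrite -mulrA ler_wpM2l.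
exists K; split; first exact: num_real.
move=> M KM [s t] _ /=; apply: le_trans (norm_le_enorm _) _.
by apply: le_trans (HK s t) _; rewrite ler_wpM2r // ltW.
Qed.

End Links.

Section ArcParam.
Context {R : realType} {n : nat}.
Notation V := 'rV[R]_n.
Implicit Types (g : R -> V) (s t : R).

Definition utan g t := unitv (derive1 g t).

Lemma arc_lengthE g a b : continuous (fun t => enorm (derive1 g t)) ->
  arc_length g a b = `|itg (fun t => enorm (derive1 g t)) a b|.
Proof.
move=> cg; set f := fun t => enorm (derive1 g t).
suff H x y : x <= y -> (\int[lebesgue_measure]_(z in `[x, y]) f z)%R = itg f x y.
  have pos x y : x <= y -> 0 <= itg f x y.
    by move=> xy; apply: itg_ge0 => // z _; exact: enorm_ge0.
  rewrite /arc_length; have [ab|/ltW ba] := leP a b.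
    by rewrite H // ger0_norm // pos.
  by rewrite H // (itg_opp _ a b) normrN ger0_norm // pos.
rewrite le_eqVlt => /orP[/eqP ->|xy].
  rewrite itg_xx set_itv1 /Rintegral integral_set1 //.
have D (z : R) : is_derive z 1 (prim f) (f z) by exact: der_prim.
have cp : continuous (prim f) by move=> z; exact: der_cont (D z).
rewrite /Rintegral (@continuous_FTC2 _ f (prim f)) //=.
- exact: continuous_subspaceT.
- split; first by move=> z _; case: (D z).
  + exact/cvg_at_right_filter/cp.
  + exact/cvg_at_left_filter/cp.
- by move=> z _; rewrite derive1E; case: (D z).
Qed.

(** [g] traced at constant speed, scaled so that the speed is 1 and curvature
    [k] becomes curvature 1: [S] is [k] times the arc length. *)
Definition normal_form (k L : R) g (l : R) (h T : R -> V) (S Si : R -> R) :=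
  [/\ closed_unit l h T, (forall t, is_derive t 1 S (k * enorm (derive1 g t))),
      cancel S Si, cancel Si S &
   [/\ forall t, g t = k^-1 *: h (S t), forall t, T (S t) = utan g t,
       forall t, S (t + L) = S t + l, l = k * loop_length L g &
       continuous Si /\ forall a b, k * arc_length g a b = `|S a - S b|]].

Lemma speed_cont L g : C1_loop L g -> continuous (fun t => enorm (derive1 g t)).
Proof. by move=> [_ _ c]; apply: vcont_enorm; exact: continuous_vcont. Qed.

Lemma C1_loop_der_per L g : C1_loop L g -> periodic (derive1 g) L.
Proof.
move=> [pg dg _]; apply: (@der_periodic _ _ g) => // s.
exact/derivable_vder.
Qed.

Lemma normal_form_exists k L g : 0 < k -> 0 < L -> C1_loop L g -> injective_mod L g ->
  (forall s, derive1 g s != 0) ->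
  exists l h T S Si, normal_form k L g l h T S Si.
Proof.
move=> k0 L0 cg ig g0; have cs := speed_cont cg; have pg' := C1_loop_der_per cg.
pose v t := enorm (derive1 g t).
have v0 t : 0 < v t by exact: enorm_gt0.
pose S t := k * itg v 0 t.
have DS (t : R) : is_derive t 1 S (k * v t) by apply: derZ; exact: der_itg.
have cS : continuous S by move=> t; exact: der_cont (DS t).
have S0 : S 0 = 0 by rewrite /S itg_xx mulr0.
have Sinc a b : a < b -> S a < S b.
  move=> ab; rewrite -subr_gt0 /S -mulrBr mulr_gt0 //.
  have -> : itg v 0 b - itg v 0 a = itg v a b by rewrite /itg; ring.
  apply: (@itg_gt0 _ _ _ _ ((a + b) / 2)) => //; first by lra.
  by move=> x _; exact: ltW.
have Sinj : injective S.
  by move=> a b E; case: (ltgtP a b) => // /Sinc; rewrite E ltxx.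
pose l := S L.
have l0 : 0 < l by rewrite /l -S0 Sinc.
have pv : periodic v L by move=> t; rewrite /v pg'.
have SL t : S (t + L) = S t + l.
  rewrite /l /S -mulrDr; congr (_ * _); rewrite -(itg_cat v 0 t (t + L)); congr (_ + _).
  by rewrite (@itg_period _ _ L t 0) // add0r.
have SLz t (j : int) : S (t + j%:~R * L) = S t + j%:~R * l.
  have nat_case (m : nat) x : S (x + m%:R * L) = S x + m%:R * l.
    elim: m x => [|m IH] x; first by rewrite !mul0r !addr0.
    by rewrite -natr1 !mulrDl !mul1r addrA SL IH addrA.
  case: j => m; first exact: nat_case.
  have := nat_case m.+1 (t + (Negz m)%:~R * L).
  rewrite NegzE mulrNz !mulNr subrK => ->; by rewrite addrK.
have Ssurj y : exists x, S x = y.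
  pose m := Num.bound (`|y| / l).
  have ym : `|y| <= m%:R * l.
    by rewrite -ler_pdivrMr // ltW // archi_boundP // divr_ge0 // ltW.
  have e1 : S (m%:R * L) = m%:R * l by have := SLz 0 m; rewrite !add0r S0 add0r.
  have e2 : S (- (m%:R * L)) = - (m%:R * l).
    by have := SLz 0 (- m%:Z); rewrite mulrNz !mulNr !sub0r S0 sub0r.
  have mL : - (m%:R * L) <= m%:R * L by have : 0 <= m%:R * L; [rewrite mulr_ge0 // ltW|lra].
  have [||x _ Sx] := @IVT R S (- (m%:R * L)) (m%:R * L) y mL; last by exists x.
    exact: continuous_subspaceT.
  move: ym; rewrite ler_norml => /andP[ym1 ym2]; rewrite e1 e2 ge_min le_max ym1 ym2 orbT //.
pose Si y := sval (cid (Ssurj y)).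
have SiK y : S (Si y) = y by rewrite /Si; case: cid.
have SK t : Si (S t) = t by apply: Sinj; rewrite SiK.
have DSi (y : R) : is_derive y 1 Si (k * v (Si y))^-1.
  have n0 : k * v (Si y) != 0 by rewrite gt_eqF // mulr_gt0.
  have H1 : {near Si y, cancel S Si} by exists 1 => //= t _; exact: SK.
  have H2 : {near Si y, continuous S} by exists 1 => //= t _; exact: cS.
  by have := is_derive_inverse H1 H2 (DS (Si y)) n0; rewrite SiK.
pose h s := k *: g (Si s).
pose T s := utan g (Si s).
have gd t : vder g t (derive1 g t) by apply: derivable_vder; case: cg.
have hd s : vder h s (T s).
  have := vderZ k (vder_comp (gd (Si s)) (DSi s)).
  move=> /vder_eq; apply; rewrite /T /utan /unitv scalerA invfM mulrA mulfV ?mul1r //.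
  by rewrite gt_eqF.
have T1 s : enorm (T s) = 1 by exact: enorm_unitv.
have SiL s : Si (s + l) = Si s + L by apply: Sinj; rewrite SL !SiK.
have [pg _ _] := cg.
have al a b : k * arc_length g a b = `|S a - S b|.
  rewrite arc_lengthE // -/v /S -mulrBr normrM (gtr0_norm k0) distrC; congr (_ * `|_|).
  by rewrite /itg; ring.
have kn0 : k != 0 by rewrite gt_eqF.
have hp : periodic h l by move=> s; rewrite /h SiL pg.
have hi : injective_mod l h.
  move=> s t /(scalerI kn0) /ig [j E].
  by exists j; rewrite -(SiK s) E SLz SiK.
have hS t : g t = k^-1 *: h (S t) by rewrite /h SK scalerA mulVf ?scale1r.
have TS t : T (S t) = utan g t by rewrite /T SK.
have ll : l = k * loop_length L g by rewrite /loop_length al S0 sub0r normrN gtr0_norm.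
have cSi : continuous Si by move=> y; exact: der_cont (DSi y).
exists l, h, T, S, Si; split; [|exact: DS|exact: SK|exact: SiK|].
  by split; [exact: l0|split; [exact: hd|exact: T1]|exact: hp|exact: hi].
by split; [exact: hS|exact: TS|exact: SL|exact: ll|split; [exact: cSi|exact: al]].
Qed.

End ArcParam.

(** * Generalized curvature and the tangent *)

Section Angle.
Context {R : realType} {n : nat}.
Notation V := 'rV[R]_n.
Implicit Types (u v : V).

Lemma angleE u v : angle u v = acos (dot (unitv u) (unitv v)).
Proof. by rewrite /angle /unitv dotZl dotZr invfM; congr acos; ring. Qed.

Lemma dot_unitv_bound u v : u != 0 -> v != 0 -> -1 <= dot (unitv u) (unitv v) <= 1.
Proof.
move=> u0 v0; have := dot_ler_norm (unitv u) (unitv v).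
by rewrite !enorm_unitv // mulr1 ler_norml.
Qed.

(** Bisecting the angle [t] between two unit vectors gives the chord
    [2 * sin (t / 2)]. *)
Lemma chord_angle u v : u != 0 -> v != 0 ->
  enorm (unitv u - unitv v) = 2 * sin (angle u v / 2).
Proof.
move=> u0 v0; have d1 := dot_unitv_bound u0 v0.
have a0 : 0 <= angle u v by rewrite angleE acos_ge0.
have a1 : angle u v <= pi by rewrite angleE acos_lepi.
have s0 : 0 <= sin (angle u v / 2) by apply: sin_ge0_pi; have := pi_ge0 R; lra.
apply/eqP; rewrite -(@eqrXn2 _ 2) ?enorm_ge0 ?mulr_ge0 //; apply/eqP.
have u1 : dot (unitv u) (unitv u) = 1 by rewrite -enorm_sq enorm_unitv // expr1n.
have v1 : dot (unitv v) (unitv v) = 1 by rewrite -enorm_sq enorm_unitv // expr1n.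
rewrite enorm_sq exprMn sin2cos2.
have : cos (angle u v) = dot (unitv u) (unitv v) by rewrite angleE acosK // in_itv.
rewrite {1}(_ : angle u v = angle u v / 2 *+ 2); last by rewrite mulr2n; lra.
move: u1 v1; move: (unitv u) (unitv v) => p q p1 q1.
by rewrite cos_mulr2n !dotE p1 q1 (dotC q) mulr2n; lra.
Qed.

Lemma sin_le_id (x : R) : 0 <= x -> sin x <= x.
Proof.
move=> x0; have D1 t : 0 <= t <= x -> is_derive t 1 (@sin R) (cos t).
  by move=> _; exact: is_derive_sin.
have D2 t : 0 <= t <= x -> is_derive t 1 (fun t : R => t) 1 by move=> _; exact: der_id.
by have := der_le x0 D1 D2 (fun t _ => cos_le1 t); rewrite sin0 !subr0.
Qed.

Lemma chord_le_angle u v : u != 0 -> v != 0 -> enorm (unitv u - unitv v) <= angle u v.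
Proof.
move=> u0 v0; rewrite chord_angle //; have d1 := dot_unitv_bound u0 v0.
have a0 : 0 <= angle u v by rewrite angleE acos_ge0.
by have := @sin_le_id (angle u v / 2); lra.
Qed.

(** From [x <= (1 + e) * sin x] for small [x]. *)
Lemma angle_le_chord (e : R) : 0 < e -> exists2 c : R, 0 < c & forall u v, u != 0 -> v != 0 ->
  enorm (unitv u - unitv v) < c -> angle u v <= (1 + e) * enorm (unitv u - unitv v).
Proof.
move=> e0; have e1 : 0 < 1 + e by lra.
have pi0 := pi_gt0 R.
have : is_derive (0 : R) 1 sin 1 by apply: (der_eq (is_derive_sin 0)); exact: cos0.
move/der_edP => /(_ (e / (1 + e))); rewrite divr_gt0 // => /(_ isT) [d d0 Hd].
pose y0 := Num.min d (pi / 2); have y00 : 0 < y0 by rewrite lt_min d0 divr_gt0.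
have y0d : y0 <= d by rewrite ge_min lexx.
have y0pi : y0 <= pi / 2 by rewrite ge_min lexx orbT.
have s0 : 0 < sin y0 by apply: sin_gt0_pi; lra.
exists (2 * sin y0); first by rewrite mulr_gt0.
move=> u v un vn; rewrite chord_angle // ltr_pM2l //.
have d1 := dot_unitv_bound un vn.
have a0 : 0 <= angle u v by rewrite angleE acos_ge0.
have a1 : angle u v <= pi by rewrite angleE acos_lepi.
rewrite ltr_sin ?in_itv /=; [|lra|lra] => ay.
have yd : `|angle u v / 2 - 0| < d by rewrite subr0 ger0_norm; lra.
have := Hd _ yd; rewrite sin0 !subr0 mul1r ler_norml => /andP[h _].
rewrite ger0_norm in h; last by lra.
have E : e / (1 + e) = 1 - (1 + e)^-1 by field; rewrite gt_eqF.
rewrite E in h.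
have h2 : (1 + e)^-1 * (angle u v / 2) <= sin (angle u v / 2) by lra.
by rewrite ler_pdivrMl // in h2; lra.
Qed.

End Angle.

Lemma cont_ed {R : realType} (f : R -> R) : continuous f -> forall s e, 0 < e ->
  exists2 d, 0 < d & forall x, `|x - s| < d -> `|f x - f s| < e.
Proof.
move=> cf s e e0; have /cvgrPdist_lt Q := cf s.
have [d /= d0 Hd] := Q _ e0; exists d => // x xs.
by rewrite distrC; apply: Hd; rewrite /ball /= distrC.
Qed.

(** For a chord of squared half-length [x] and a tangent with scalar product [z]
    with its direction, the squared distance between tangent and direction is
    [2 * (1 - z)]; the right-hand side is [x] to leading order. *)
Lemma cap_bound (R : realType) (x z : R) : 0 < z -> z <= 1 -> 1 - z ^+ 2 <= x ->
  2 * (1 - z) <= x * (1 + 4 * x) ^+ 2.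
Proof.
move=> z0 z1 zx; have q0 : 0 <= 1 - z by lra.
have qx : 1 - z <= x by rewrite expr2 in zx; nra.
have x0 : 0 <= x by lra.
have qq : (1 - z) * (1 - z) <= x * x by exact: ler_pM.
have x3 : 0 <= x * x * x by rewrite !mulr_ge0.
have x2 : 0 <= x * x by rewrite mulr_ge0.
rewrite !expr2 in zx *; lra.
Qed.

Section NormalForm.
Context {R : realType} {n : nat}.
Notation V := 'rV[R]_n.
Variables (k L : R) (g : R -> V) (l : R) (h T : R -> V) (S Si : R -> R).
Hypotheses (k0 : 0 < k) (g0 : forall t, derive1 g t != 0).
Hypothesis nf : normal_form k L g l h T S Si.
Implicit Types (s t a b : R).

Let cu : closed_unit l h T. Proof. by case: nf. Qed.
Let l0 : 0 < l. Proof. by case: cu. Qed.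
Let us : unit_speed h T. Proof. by case: cu. Qed.
Let T1 := us.2.
Let DS t : is_derive t 1 S (k * enorm (derive1 g t)). Proof. by case: nf. Qed.
Let SK : cancel S Si. Proof. by case: nf. Qed.
Let SiK : cancel Si S. Proof. by case: nf. Qed.
Let gh t : g t = k^-1 *: h (S t). Proof. by case: nf => _ _ _ _ []. Qed.
Let TS t : T (S t) = utan g t. Proof. by case: nf => _ _ _ _ []. Qed.
Let cSi : continuous Si. Proof. by case: nf => _ _ _ _ [_ _ _ _ []]. Qed.
Let al a b : k * arc_length g a b = `|S a - S b|.
Proof. by case: nf => _ _ _ _ [_ _ _ _ []]. Qed.
Let cS : continuous S. Proof. by move=> t; exact: der_cont (DS t). Qed.

Lemma arcE a b : arc_length g a b = `|S a - S b| / k.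
Proof. by rewrite -al mulrAC mulfV ?mul1r // gt_eqF. Qed.

Lemma arc_gt0 a b : a != b -> 0 < arc_length g a b.
Proof.
move=> ab; rewrite arcE divr_gt0 // normr_gt0 subr_eq0.
by apply: contra_neq ab => /(can_inj SK).
Qed.

Lemma near_pair (P : R -> R -> Prop) s :
  nbhs (s, s) [set p : R * R | P p.1 p.2] ->
  exists2 d : R, 0 < d & forall a b, `|a - s| < d -> `|b - s| < d -> P a b.
Proof.
move=> /nbhs_ballP [d /= d0 Hd]; exists d => // a b as_ bs.
by apply: (Hd (a, b)); split; rewrite /ball /= distrC.
Qed.

Lemma near_pair_rev (P : R -> R -> Prop) s d : 0 < d ->
  (forall a b, `|a - s| < d -> `|b - s| < d -> P a b) ->
  nbhs (s, s) [set p : R * R | P p.1 p.2].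
Proof.
move=> d0 H; apply/nbhs_ballP; exists d => //= -[a b] []; rewrite /ball /= => h1 h2.
by apply: H; rewrite distrC.
Qed.

Lemma curvature_lt s (kk : R) : (curvature g s < kk%:E)%E ->
  exists k' d : R, [/\ k' < kk, 0 < d & forall a b, `|a - s| < d -> `|b - s| < d ->
    enorm (utan g a - utan g b) <= k' * arc_length g a b].
Proof.
move=> /ereal_inf_lt [x [W FW <-] xk].
have FW' : nbhs (s, s) [set p : R * R | p.1 != p.2 -> W (p.1, p.2)].
  by apply: filterS FW => -[a b] /=.
have [d d0 Hd] := @near_pair (fun a b => a != b -> W (a, b)) s FW'.
have [k' k'k Hk'] : exists2 k' : R, k' < kk & forall a b, W (a, b) ->
    angle (derive1 g a) (derive1 g b) / arc_length g a b <= k'.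
  move: xk; set sp := ereal_sup _ => xk.
  have ub a b : W (a, b) -> ((angle (derive1 g a) (derive1 g b) / arc_length g a b)%:E <= sp)%E.
    by move=> Wab; apply: ereal_sup_ubound; exists (a, b).
  case E : sp xk ub => [r| |] // xk ub.
    by exists r => // a b /ub; rewrite lee_fin.
  by exists (kk - 1) => [|a b /ub]; [rewrite ltrBlDr ltrDl|rewrite leNgt ltNyr].
exists k', d; split=> // a b ha hb.
have [->|ab] := eqVneq a b.
  by rewrite subrr enorm0 arcE subrr normr0 mul0r mulr0.
apply: le_trans (chord_le_angle (g0 a) (g0 b)) _.
by rewrite -ler_pdivrMr ?arc_gt0 //; apply: Hk'; exact: Hd.
Qed.

(** The chords of the hypothesis are compared with the angles in the definition of
    [curvature] by [angle_le_chord], at a cost which tends to 0 with [e]. *)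
Lemma curvature_le s (kk : R) : 0 <= kk ->
  (forall e, 0 < e -> exists2 d, 0 < d & forall a b, `|a - s| < d -> `|b - s| < d ->
    enorm (utan g a - utan g b) <= (kk + e) * arc_length g a b) ->
  (curvature g s <= kk%:E)%E.
Proof.
move=> kk0 H; apply/lee_addgt0Pr => e e0; rewrite -EFinD.
pose e1 := Num.min 1 (e / (kk + 2)).
have kk2 : 0 < kk + 2 by lra.
have e10 : 0 < e1 by rewrite lt_min ltr01 divr_gt0.
have e11 : e1 <= 1 by rewrite ge_min lexx.
have e12 : e1 * (kk + 2) <= e by rewrite -ler_pdivlMr // ge_min lexx orbT.
have [c c0 Hc] := @angle_le_chord R n e1 e10.
have [d1 d10 Hd1] := H e1 e10.
have kk1 : 0 < kk + 1 by lra.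
have q0 : 0 < c * k / (kk + 1) / 2 by rewrite !divr_gt0 // mulr_gt0.
have [d2 d20 Hd2] := cont_ed cS s q0.
pose d := Num.min d1 d2; have d0 : 0 < d by rewrite lt_min d10.
apply: ge_ereal_inf.
exists (ereal_sup ((fun p : R * R => (angle (derive1 g p.1) (derive1 g p.2) / arc_length g p.1 p.2)%:E) @`
  [set p : R * R | p.1 != p.2 /\ (`|p.1 - s| < d /\ `|p.2 - s| < d)])).
  exists [set p : R * R | p.1 != p.2 /\ (`|p.1 - s| < d /\ `|p.2 - s| < d)] => //.
  apply: (@near_pair_rev (fun a b => a != b -> a != b /\ (`|a - s| < d /\ `|b - s| < d)) s d) => //.
apply: ge_ereal_sup => _ [[a b] /= [ab [+ +]] <-]; rewrite !lt_min => /andP[a1 a2] /andP[b1 b2].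
rewrite lee_fin ler_pdivrMr ?arc_gt0 //.
have K := Hd1 a b a1 b1.
have al0 := arc_gt0 ab.
have small : arc_length g a b < c / (kk + 1).
  rewrite arcE ltr_pdivrMr //.
  have h1 := Hd2 a a2; have h2 := Hd2 b b2.
  rewrite [X in _ < X](_ : _ = c * k / (kk + 1) / 2 + c * k / (kk + 1) / 2); last by field; rewrite gt_eqF.
  have -> : S a - S b = (S a - S s) - (S b - S s) by ring.
  by apply: le_lt_trans (ler_normB _ _) _; exact: ltrD.
have chordc : enorm (utan g a - utan g b) < c.
  apply: le_lt_trans K _.
  have : (kk + e1) * arc_length g a b <= (kk + 1) * arc_length g a b.
    by rewrite ler_wpM2r ?(ltW al0) // lerD2l.
  by rewrite ltr_pdivlMr // in small; rewrite mulrC in small; move: small; lra.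
have hh := Hc _ _ (g0 a) (g0 b) chordc.
apply: le_trans hh _; rewrite -/(utan g a) -/(utan g b).
have h2 : (1 + e1) * enorm (utan g a - utan g b) <= (1 + e1) * ((kk + e1) * arc_length g a b).
  by rewrite ler_wpM2l //; lra.
apply: le_trans h2 _; rewrite mulrA ler_wpM2r ?(ltW al0) //.
nra.
Qed.

(** By [curvature_lt] the local slopes of [T] are at most [1 + e]; [slope_le]
    integrates them. *)
Lemma nf_lip1 : (forall s, (curvature g s <= k%:E)%E) -> lip1 T.
Proof.
move=> Hk; have slope s e : 0 < e -> exists2 d, 0 < d & forall t, `|t - s| < d ->
    enorm (T t - T s) <= (1 + e) * `|t - s|.
  move=> e0; have ke : 0 < k * e by rewrite mulr_gt0.
  have kl : (curvature g (Si s) < (k + k * e)%:E)%E.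
    by apply: le_lt_trans (Hk _) _; rewrite lte_fin ltrDl.
  have [k' [d [k'k d0 Hd]]] := curvature_lt kl.
  have [d2 d20 Hd2] := cont_ed cSi s d0.
  exists d2 => // t ts.
  have h1 := Hd2 t ts.
  have := Hd (Si t) (Si s) h1; rewrite subrr normr0 => /(_ d0).
  rewrite -!TS !SiK => h2; apply: le_trans h2 _.
  rewrite arcE !SiK mulrA mulrAC ler_wpM2r // ler_pdivrMr //.
  by rewrite mulrDl mul1r [e * k]mulrC ltW.
have D (s : R) : is_derive s 1 (fun s : R => s) 1 by exact: der_id.
move=> s t; have [st|/ltW st] := leP s t.
  rewrite enormB distrC (ger0_norm (_ : 0 <= t - s)) ?subr_ge0 //.
  exact: (slope_le st D slope).
rewrite (ger0_norm (_ : 0 <= s - t)) ?subr_ge0 //.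
exact: (slope_le st D slope).
Qed.

Lemma nf_slack t0 : (curvature g t0 < k%:E)%E -> exists r eta : R, [/\ 0 < r, 0 < eta &
  forall s t, `|s - S t0| < r -> `|t - S t0| < r -> enorm (T s - T t) <= (1 - eta) * `|s - t|].
Proof.
move=> /curvature_lt [k' [d [k'k d0 Hd]]].
have [r r0 Hr] := cont_ed cSi (S t0) d0.
exists r, (1 - k' / k); split=> //; first by rewrite subr_gt0 ltr_pdivrMr // mul1r.
move=> s t hs ht; rewrite subKr.
have near x : `|x - S t0| < r -> `|Si x - t0| < d.
  by move=> /Hr; rewrite SK.
have := Hd (Si s) (Si t) (near s hs) (near t ht); rewrite -!TS !SiK arcE !SiK.
by rewrite mulrA mulrAC.
Qed.

Lemma nf_curvature_le t0 (kk : R) : 0 <= kk ->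
  (forall e, 0 < e -> exists2 d, 0 < d & forall s t, `|s - S t0| < d -> `|t - S t0| < d ->
    enorm (T s - T t) <= (kk + e) * `|s - t|) ->
  (curvature g t0 <= (kk * k)%:E)%E.
Proof.
move=> kk0 H; apply: curvature_le; first by rewrite mulr_ge0 // ltW.
move=> e e0; have ek : 0 < e / k by rewrite divr_gt0.
have [d d0 Hd] := H _ ek.
have [r r0 Hr] := cont_ed cS t0 d0.
exists r => // a b ha hb; rewrite -!TS arcE.
have near x : `|x - t0| < r -> `|S x - S t0| < d.
  exact: Hr.
apply: le_trans (Hd _ _ (near a ha) (near b hb)) _.
by rewrite [X in _ <= X](_ : _ = (kk + e / k) * `|S a - S b|) //; field; rewrite gt_eqF.
Qed.

(** The tangent balls of radius 1 at two nearby points force both tangents to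
    make with the chord an angle which is, to leading order, at most half the
    length of the arc between them. *)
Lemma ball_curvature :
  (forall s t (a : V), dot a (T s) = 0 -> enorm a <= 1 ->
     2 * dot a (h t - h s) <= enorm (h t - h s) ^+ 2) ->
  vcont T -> forall t0, (curvature g t0 <= k%:E)%E.
Proof.
move=> ball cT t0; rewrite -[k]mul1r; apply: nf_curvature_le => // e e0.
have cn : continuous (fun s => enorm (T s - T (S t0))).
  by apply: vcont_enorm; apply: vcontB => //; exact: vcont_cst.
have q0 : 0 < 1 / 4 :> R by lra.
have [d1 d10 Hd1] := cont_ed cn (S t0) q0.
pose d := Num.min d1 (Num.min (e / 2) (1 / 4)).
have d0 : 0 < d by rewrite !lt_min d10 !divr_gt0.
exists d => // s t; rewrite !lt_min => /andP[s1 /andP[s2 s3]] /andP[t1 /andP[t2 t3]].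
have nearT x : `|x - S t0| < d1 -> enorm (T x - T (S t0)) < 1 / 4.
  move=> /Hd1; rewrite subrr enorm0 subr0.
  by rewrite ger0_norm ?enorm_ge0.
wlog st : s t s1 s2 s3 t1 t2 t3 / s < t.
  move=> W; have [/W H|/W H|->] := ltgtP s t; first exact: H.
    by rewrite enormB distrC; exact: H.
  by rewrite subrr enorm0 mulr_ge0 // addr_ge0 // ltW.
rewrite distrC gtr0_norm ?subr_gt0 //.
pose v := h t - h s; pose c := enorm v.
have ts2 : t - s < e.
  by move: s2 t2; rewrite !ltr_norml => /andP[? ?] /andP[? ?]; lra.
have ts1 : t - s < 1 / 2.
  by move: s3 t3; rewrite !ltr_norml => /andP[? ?] /andP[? ?]; lra.
have TT x : s <= x <= t -> forall y, s <= y <= t -> 1 / 2 <= dot (T x) (T y).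
  have near x' : s <= x' <= t -> `|x' - S t0| < d1.
    move=> /andP[h1 h2]; move: s1 t1; rewrite !ltr_norml => /andP[? ?] /andP[? ?].
    by apply/andP; split; lra.
  move=> hx y hy; have h1 := nearT x (near x hx); have h2 := nearT y (near y hy).
  have h3 := enorm_tri (T (S t0)) (T x) (T y); rewrite (enormB (T (S t0))) in h3.
  have h4 : enorm (T x - T y) <= 1 / 2 by lra.
  have h5 : enorm (T x - T y) ^+ 2 <= (1 / 2) ^+ 2.
    by rewrite ler_pXn2r // ?nnegrE ?enorm_ge0 //; lra.
  by rewrite enorm_sq !dotE !(unit_dot _ T1) (dotC (T y)) !expr2 in h5; lra.
have pos y : s <= y <= t -> 0 < dot v (T y).
  move=> hy; have st' := ltW st.
  have D1 x : s <= x <= t -> is_derive x 1 (fun x => 1 / 2 * x) (1 / 2).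
    by move=> _; apply: (der_eq (derZ _ (der_id x))); rewrite mulr1.
  have D2 x : s <= x <= t -> is_derive x 1 (fun x => dot (h x) (T y)) (dot (T x) (T y)).
    by move=> _; exact: us.1.
  have := der_le st' D1 D2 (fun x hx => TT x hx y hy); rewrite /v dotBl; lra.
have ss : s <= s <= t by rewrite lexx ltW.
have tt : s <= t <= t by rewrite lexx ltW.
have vn0 : v != 0.
  by apply/eqP => v0; have := pos s ss; rewrite v0 dot0l ltxx.
have c0 : 0 < c by exact: enorm_gt0.
have cts : c <= t - s.
  have T1' x : enorm (T x) <= 1 by rewrite T1.
  by have := vder_lip us.1 T1' t s; rewrite mul1r gtr0_norm ?subr_gt0.
have [w w1 vw] : exists2 w, enorm w = 1 & v = c *: w.
  exists (c^-1 *: v); last by rewrite scalerA mulfV ?scale1r // gt_eqF.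
  by rewrite enormZ gtr0_norm ?invr_gt0 // mulVf // gt_eqF.
have ww : dot w w = 1 by rewrite -enorm_sq w1 expr1n.
pose B := c / 2 * (1 + c ^+ 2).
have est y (sg : R) : s <= y <= t -> (sg = 1 \/ sg = -1) ->
   (forall a : V, dot a (T y) = 0 -> enorm a <= 1 -> 2 * dot a (sg *: v) <= enorm v ^+ 2) ->
   enorm (T y - w) <= B.
  move=> hy hsg Hb; pose z := dot w (T y).
  have z0 : 0 < z by have := pos y hy; rewrite vw dotZl pmulr_rgt0.
  have z1 : z <= 1 by apply: le_trans (dot_le _ _) _; rewrite w1 T1 mulr1.
  pose p := w - z *: T y.
  have pT : dot p (T y) = 0 by rewrite /p dotBl (dotZl z) (unit_dot _ T1) mulr1 subrr.
  have pp : dot p p = 1 - z ^+ 2.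
    by rewrite /p !dotE ww (unit_dot _ T1) (dotC (T y)) -/z; ring.
  have pw : dot p w = 1 - z ^+ 2 by rewrite /p !dotE ww (dotC (T y)) -/z; ring.
  have pc : enorm p <= c / 2.
    have [p0|pn] := eqVneq p 0; first by rewrite p0 enorm0 divr_ge0 // ltW.
    have pg := enorm_gt0 pn.
    pose a := sg *: unitv p.
    have aT : dot a (T y) = 0 by rewrite /a /unitv !dotZl pT !mulr0.
    have a1 : enorm a <= 1.
      by rewrite /a enormZ enorm_unitv // mulr1; case: hsg => ->; rewrite ?normrN normr1.
    have pv : dot p v = c * enorm p ^+ 2 by rewrite vw dotZr pw -pp -enorm_sq.
    have := Hb a aT a1; rewrite /a !dotZl dotZr pv.
    have -> : 2 * (sg * ((enorm p)^-1 * (sg * (c * enorm p ^+ 2)))) = sg ^+ 2 * (2 * (c * enorm p)).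
      by field; rewrite gt_eqF.
    have -> : sg ^+ 2 = 1 by case: hsg => ->; rewrite ?sqrrN expr1n.
    by rewrite -/c expr2 mul1r mulrCA ler_pM2l // => ?; lra.
  have B0 : 0 <= B by rewrite /B mulr_ge0 ?divr_ge0 ?(ltW c0) // ler_wpDr // sqr_ge0.
  apply: enorm_le_dot => //; rewrite !dotE ww (unit_dot _ T1) (dotC (T y)) -/z.
  have pc2 : 1 - z ^+ 2 <= (c / 2) ^+ 2.
    by rewrite -pp -enorm_sq ler_pXn2r // nnegrE ?enorm_ge0 // divr_ge0 // ltW.
  rewrite [X in X <= _](_ : _ = 2 * (1 - z)); last by ring.
  have -> : B ^+ 2 = (c / 2) ^+ 2 * (1 + 4 * (c / 2) ^+ 2) ^+ 2 by rewrite /B; field.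
  exact: cap_bound.
have e1 : enorm (T s - w) <= B.
  apply: (est s 1) => //; first by left.
  by move=> a aT a1; rewrite scale1r; exact: ball.
have e2 : enorm (T t - w) <= B.
  apply: (est t (-1)) => //; first by right.
  by move=> a aT a1; rewrite scaleN1r /v opprB (enormB (h t)); exact: ball.
have e3 := enorm_tri w (T s) (T t); rewrite (enormB w) in e3.
have c1 : c ^+ 2 <= e.
  have c1 : c <= 1 by apply: le_trans cts _; apply: le_trans (ltW ts1) _; rewrite ler_pdivrMr // mul1r ler1n.
  have ce : c <= e by exact: le_trans cts (ltW ts2).
  by rewrite expr2 -[e]mul1r; apply: ler_pM; rewrite ?(ltW c0).
have : 2 * B <= (1 + e) * (t - s).
  have -> : 2 * B = (1 + c ^+ 2) * c by rewrite /B; field.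
  by apply: ler_pM; rewrite ?addr_ge0 ?sqr_ge0 ?(ltW c0) //; lra.
lra.
Qed.

End NormalForm.

(** * Ball radius, thickness and double critical pairs *)

Lemma periodic_ge {R : realType} (L : R) (f : R -> R) : 0 < L -> continuous f -> periodic f L ->
  (forall t, 0 < f t) -> exists2 m, 0 < m & forall t, m <= f t.
Proof.
move=> L0 cf pf f0; have c2 : continuous (fun p : R * R => f p.1).
  by move=> p; apply: (@continuous_comp _ _ _ fst f); [exact: cvg_fst|exact: cf].
have [m m0 Hm] := @rect_gt0 _ _ 0 L 0 0 c2 (fun q _ _ => f0 q.1).
exists m => // t; have [j /andP[j0 j1]] := mod_shift 0 t L0.
rewrite -(periodicz j t pf); have := Hm (t + j%:~R * L, 0) => /=; apply; last by rewrite lexx.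
by rewrite subr0 in j0 j1; rewrite j0 ltW.
Qed.

Lemma periodic_le {R : realType} (L : R) (f : R -> R) : 0 < L -> continuous f -> periodic f L ->
  (forall t, 0 < f t) -> exists2 M, 0 < M & forall t, f t <= M.
Proof.
move=> L0 cf pf f0; have [|||m m0 Hm] := @periodic_ge R L (fun t => (f t)^-1) L0.
- by move=> t; apply: cvgV; [rewrite gt_eqF|exact: cf].
- by move=> t; rewrite pf.
- by move=> t; rewrite invr_gt0.
exists m^-1; first by rewrite invr_gt0.
by move=> t; rewrite -[f t]invrK lef_pV2 ?posrE ?invr_gt0.
Qed.

(** Squared form of [|a| <= |g t - (g s + a)|]: the curve does not enter the ball
    centred at [g s + a] that touches it at [g s]. *)
Definition ball_free {R : realType} {n : nat} (g : R -> 'rV[R]_n) (r : R) :=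
  forall s t (a : 'rV[R]_n), dot a (derive1 g s) = 0 -> enorm a <= r ->
  2 * dot a (g t - g s) <= enorm (g t - g s) ^+ 2.

Section Radii.
Context {R : realType} {n : nat}.
Notation V := 'rV[R]_n.
Implicit Types (g : R -> V) (s t r L : R) (a v : V).

Lemma ball_free_radius g r : ball_free g r -> (r%:E <= ball_radius g)%E.
Proof.
move=> bf; apply: le_ereal_inf_tmp => _ [r' [r'0 [y [[x _ [u [z [ut uz z1 yxz]]]] [t _ E]]]] <-].
rewrite lee_fin leNgt; apply/negP => r'r.
case: ut => u1 [s [xs [c uc]]].
have c0 : c != 0.
  apply/eqP => c0; move: u1; rewrite uc c0 scale0r enorm0 => /esym/eqP.
  by rewrite oner_eq0.
have aT : dot (r' *: z) (derive1 g s) = 0.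
  move/eqP: uz; rewrite uc (dotZl c) mulf_eq0 (negPf c0) /= => /eqP uz.
  by rewrite dotZl (dotC z) uz mulr0.
have a1 : enorm (r' *: z) <= r by rewrite enormZ z1 mulr1 gtr0_norm // ltW.
have := bf s t _ aT a1; move: yxz; rewrite -E xs; move: (g t - g s) => v.
have -> : (enorm (v - r' *: z) < r') = (enorm (v - r' *: z) ^+ 2 < r' ^+ 2).
  by rewrite ltr_pXn2r // nnegrE ?enorm_ge0 // ltW.
have zz : dot z z = 1 by rewrite -enorm_sq z1 expr1n.
by rewrite !enorm_sq !dotE zz (dotC v) !expr2; lra.
Qed.

Lemma radius_ball_free g r : (forall s, derive1 g s != 0) -> (r%:E < ball_radius g)%E ->
  ball_free g r.
Proof.
move=> g0 rb s t a aT ar.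
have [->|a0] := eqVneq a 0; first by rewrite dot0l mulr0 sqr_ge0.
have ag := enorm_gt0 a0.
rewrite leNgt; apply/negP => bad.
have : (ball_radius g <= (enorm a)%:E)%E.
  apply: ereal_inf_lbound; exists (enorm a) => //; split=> //.
  exists (g t); split; last by exists t.
  exists (g s); first by exists s.
  exists (unitv (derive1 g s)), (unitv a); split.
  - by split; [exact: enorm_unitv|exists s; split=> //; exists (enorm (derive1 g s))^-1].
  - by rewrite /unitv dotZl dotZr (dotC _ a) aT !mulr0.
  - exact: enorm_unitv.
  - rewrite -unitvE //; move: bad; move: (g t - g s) => v bad.
    rewrite -(@ltr_pXn2r _ 2) // ?nnegrE ?enorm_ge0 //.
    by move: bad; rewrite !enorm_sq !dotE (dotC v) => ?; lra.
by move/(lt_le_trans rb); rewrite lte_fin ltNge ar.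
Qed.

(** Lengthening [a] to the norm [r] leaves room for a strict inequality. *)
Lemma ball_free_strict g r s t a : ball_free g r -> dot a (derive1 g s) = 0 -> enorm a < r ->
  g t != g s -> 2 * dot a (g t - g s) < enorm (g t - g s) ^+ 2.
Proof.
rewrite -subr_eq0 => bf aT ar v0; set v := g t - g s in v0 *.
have vg : 0 < enorm v ^+ 2 by rewrite exprn_gt0 // enorm_gt0.
have [av|av] := leP (dot a v) 0; first lra.
have a0 : a != 0 by apply: contraTneq av => ->; rewrite dot0l ltxx.
have ag := enorm_gt0 a0.
have bT : dot ((r / enorm a) *: a) (derive1 g s) = 0 by rewrite dotZl aT mulr0.
have b1 : enorm ((r / enorm a) *: a) <= r.
  rewrite enormZ ger0_norm; last by rewrite divr_ge0 ?enorm_ge0 // ltW // (lt_trans ag).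
  by rewrite divfK // gt_eqF.
apply: lt_le_trans (bf s t _ bT b1); rewrite -/v dotZl ltr_pM2l //.
by rewrite ltr_pMl // ltr_pdivlMr // mul1r.
Qed.

(** If two normals of length less than [r] met, each of them would be shorter than
    the other by [ball_free_strict]. *)
Lemma ball_free_thickness g r : 0 < r -> ball_free g r -> (r%:E <= thickness g)%E.
Proof.
move=> r0 bf; apply: ereal_sup_ubound; right; exists r => //; split=> //.
have key p q : p \in normal_bundle g `&` [set p | enorm p.2 < r] ->
    q \in normal_bundle g `&` [set p | enorm p.2 < r] ->
    normal_exp p = normal_exp q -> p.1 != q.1 -> dot p.2 p.2 < dot q.2 q.2.
  rewrite !inE => -[[s [ps pT]] /= pr] [[t [qt qT]] /= qr] E pq.
  have v0 : g t != g s by rewrite -ps -qt eq_sym.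
  have := ball_free_strict bf pT pr v0.
  have Ev : g t - g s = p.2 - q.2.
    by apply/eqP; rewrite -ps -qt subr_eq addrAC eq_sym subr_eq addrC; exact/eqP.
  rewrite Ev enorm_sq !dotE (dotC q.2); lra.
move=> p q pA qA E; have [pq|pq] := eqVneq p.1 q.1.
  move: E; rewrite /normal_exp pq => /addrI; move: pq.
  by case: p {pA} => ? ?; case: q {qA} => ? ? /= -> ->.
have h1 := key _ _ pA qA E pq.
have h2 := key _ _ qA pA (esym E); rewrite eq_sym in h2.
by have := lt_trans h1 (h2 pq); rewrite ltxx.
Qed.

Lemma MDC_ge0 g : (0 <= (2^-1)%:E * MDC g)%E.
Proof.
apply: mule_ge0; first by rewrite lee_fin.
by apply: le_ereal_inf_tmp => _ [p _ <-]; rewrite lee_fin enorm_ge0.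
Qed.

(** The two normals from a double critical pair to its midpoint collide. *)
Lemma thickness_le_MDC g : (thickness g <= (2^-1)%:E * MDC g)%E.
Proof.
apply: ge_ereal_sup => _ [->|[r [r0 inj] <-]]; first exact: MDC_ge0.
rewrite lee_pdivlMl //; apply: le_ereal_inf_tmp => _ [[x y] /= [xy [s [t [xs yt ds dt]]]] <-].
rewrite -EFinM lee_fin leNgt; apply/negP => d.
pose a := 2^-1 *: (x - y).
have ha : enorm a < r by rewrite /a enormZ ger0_norm // ltr_pdivrMl.
have aa : a + a = x - y by rewrite /a -scalerDl (_ : 2^-1 + 2^-1 = 1 :> R) ?scale1r //; field.
have E : normal_exp (x, - a) = normal_exp (y, a).
  by rewrite /normal_exp /=; apply/eqP; rewrite subr_eq -addrA aa addrC subrK.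
have /(congr1 fst)/= xy' : (x, - a) = (y, a).
  apply: inj => //; rewrite inE; split=> /=.
  - by exists s; split; [exact: xs|rewrite /= dotNl dotZl ds mulr0 oppr0].
  - by rewrite enormN.
  - by exists t; split; [exact: yt|rewrite /= dotZl dt mulr0].
  - exact: ha.
by rewrite xy' eqxx in xy.
Qed.

Lemma nf_ball_free k L g l h T S Si : 0 < k -> (forall t, derive1 g t != 0) ->
  normal_form k L g l h T S Si ->
  (forall s t (a : V), dot a (T s) = 0 -> enorm a <= 1 ->
     2 * dot a (h t - h s) <= enorm (h t - h s) ^+ 2) <-> ball_free g k^-1.
Proof.
move=> k0 g0 [_ _ _ SiK [gh TS _ _ _]]; have ki : 0 < k^-1 by rewrite invr_gt0.
have gd s t : g t - g s = k^-1 *: (h (S t) - h (S s)) by rewrite !gh scalerBr.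
have dT a s : dot a (T (S s)) = (enorm (derive1 g s))^-1 * dot a (derive1 g s).
  by rewrite TS /utan /unitv dotZr.
split=> H s t a aT ha.
- have a1 : enorm (k *: a) <= 1 by rewrite enormZ gtr0_norm // -ler_pdivlMl // mulr1.
  have aT' : dot (k *: a) (T (S s)) = 0 by rewrite dotZl dT aT !mulr0.
  have := H (S s) (S t) (k *: a) aT' a1; rewrite gd.
  rewrite dotZl dotZr enormZ gtr0_norm // exprMn => h1.
  have ki2 : 0 < k^-1 ^+ 2 by rewrite exprn_gt0.
  rewrite -(ler_pM2l ki2) in h1; apply: le_trans h1.
  by rewrite le_eqVlt; apply/orP; left; apply/eqP; field; rewrite gt_eqF.
- rewrite -(SiK s) -(SiK t) in aT *; move: (Si s) (Si t) aT => {}s {}t.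
  rewrite dT => /eqP; rewrite mulf_eq0 invr_eq0 gt_eqF ?enorm_gt0 //= => /eqP aT.
  have aT' : dot (k^-1 *: a) (derive1 g s) = 0 by rewrite dotZl aT mulr0.
  have a1 : enorm (k^-1 *: a) <= k^-1 by rewrite enormZ gtr0_norm // ler_piMr // ltW.
  have := H s t (k^-1 *: a) aT' a1; rewrite gd.
  rewrite dotZl dotZr enormZ gtr0_norm // exprMn mulrA -mulrA => h1.
  have ki2 : 0 < k^-1 ^+ 2 by rewrite exprn_gt0.
  rewrite -(ler_pM2l ki2); apply: le_trans h1.
  by rewrite le_eqVlt; apply/orP; left; apply/eqP; ring.
Qed.

(** The speed is bounded below by periodicity, so that the unit tangent is
    Lipschitz as a function of arc length. *)
Lemma curvature_bounded L g : 0 < L -> simple_C11 L g ->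
  exists M, forall s, (curvature g s <= M%:E)%E.
Proof.
move=> L0 [cg ig g0 /lipschitz_vLip [C HC]].
have cs := speed_cont cg; have pg' := C1_loop_der_per cg.
have [m m0 Hm] : exists2 m, 0 < m & forall t, m <= enorm (derive1 g t).
  by apply: (periodic_ge L0 cs) => t; rewrite ?pg' //; exact: enorm_gt0.
have [l [h [T [S [Si nf]]]]] := normal_form_exists ltr01 L0 cg ig g0.
have ar (a b : R) : m * `|a - b| <= arc_length g a b.
  rewrite arc_lengthE //.
  have H x y : x <= y -> m * (y - x) <= itg (fun t => enorm (derive1 g t)) x y.
    by move=> xy; rewrite -itg_cst; apply: itg_le => // ; exact: cont_cst.
  have [ab|/ltW ab] := leP a b.
    rewrite distrC ger0_norm ?subr_ge0 //; apply: le_trans (H _ _ ab) _; exact: ler_norm.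
  rewrite ger0_norm ?subr_ge0 // itg_opp normrN; apply: le_trans (H _ _ ab) _; exact: ler_norm.
exists (`|C| / m / m) => s.
have M0 : 0 <= `|C| / m / m by rewrite !divr_ge0 // ltW.
apply: (curvature_le ltr01 g0 nf M0) => // e e0; exists 1 => // a b _ _.
have h1 : enorm (utan g a - utan g b) <= `|C| / m * `|a - b|.
  rewrite -(@ler_pXn2r _ 2) // ?nnegrE ?enorm_ge0 //; last by rewrite mulr_ge0 // divr_ge0 // ltW.
  have := unitv_dist (g0 a) (g0 b); rewrite -/(utan g a) -/(utan g b).
  have C2 : enorm (derive1 g a - derive1 g b) ^+ 2 <= (`|C| * `|a - b|) ^+ 2.
    rewrite ler_pXn2r // ?nnegrE ?enorm_ge0 ?mulr_ge0 //; apply: le_trans (HC a b) _.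
    by rewrite ler_wpM2r // ler_norm.
  move=> /le_trans/(_ C2) h1.
  have m2 : 0 < m ^+ 2 by rewrite exprn_gt0.
  rewrite -(ler_pM2r m2) [X in _ <= X](_ : _ = (`|C| * `|a - b|) ^+ 2); last first.
    by field; rewrite gt_eqF.
  apply: le_trans h1; rewrite ler_wpM2l ?sqr_ge0 // expr2.
  by apply: ler_pM; rewrite ?Hm // ltW.
apply: le_trans h1 _.
have := ar a b; rewrite -ler_pdivlMl // => h2.
apply: (@le_trans _ _ (`|C| / m * (m^-1 * arc_length g a b))).
  by rewrite ler_wpM2l // divr_ge0 // ltW.
rewrite mulrA; apply: ler_wpM2r; last by rewrite lerDl ltW.
by apply: le_trans (ar a b); rewrite mulr_ge0 // ltW.
Qed.

(** A negative upper limit would bound a norm by a negative number. *)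
Lemma curvature_ge0 L g s : 0 < L -> simple_C11 L g -> (0 <= curvature g s)%E.
Proof.
move=> L0 [cg ig g0 _].
have [l [h [T [S [Si nf]]]]] := normal_form_exists ltr01 L0 cg ig g0.
rewrite leNgt; apply/negP => /(curvature_lt ltr01 g0 nf) [k' [d [k'0 d0 Hd]]].
have s1 : `|s - s| < d by rewrite subrr normr0.
have s2 : `|s + d / 2 - s| < d by rewrite addrAC subrr add0r gtr0_norm; lra.
have ss : s != s + d / 2 by rewrite lt_eqF // ltrDl; lra.
have := le_trans (enorm_ge0 _) (Hd _ _ s1 s2).
by rewrite leNgt nmulr_rlt0 // (arc_gt0 ltr01 nf ss).
Qed.

Lemma nf_double_critical k L g l h T S Si s t : 0 < k -> (forall t, derive1 g t != 0) ->
  normal_form k L g l h T S Si -> dcp h T s t -> double_critical g (g (Si s)) (g (Si t)).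
Proof.
move=> k0 g0 [_ _ _ SiK [gh TS _ _ _]].
rewrite -{1}(SiK s) -{1}(SiK t); move: (Si s) (Si t) => {}s {}t [hst ds dt].
have gE : g s - g t = k^-1 *: (h (S s) - h (S t)) by rewrite !gh scalerBr.
have normal x : dot (h (S s) - h (S t)) (T (S x)) = 0 -> dot (g s - g t) (derive1 g x) = 0.
  by rewrite gE dotZl (unitvE (g0 x)) -/(utan g x) -TS dotZr => ->; rewrite !mulr0.
split; first by rewrite -subr_eq0 gE scaler_eq0 invr_eq0 gt_eqF //= subr_eq0.
by exists s, t; split=> //; exact: normal.
Qed.

(** [ball_sep] for the curve scaled by [r^-1]. *)
Lemma curvature_MDC_ball_free L g r : 0 < L -> simple_C11 L g -> 0 < r ->
  (forall s, (curvature g s <= (r^-1)%:E)%E) -> (r%:E <= (2^-1)%:E * MDC g)%E ->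
  ball_free g r.
Proof.
move=> L0 [cg ig g0 _] r0 Hk; rewrite lee_pdivlMl // => rM.
have k0 : 0 < r^-1 by rewrite invr_gt0.
have [l [h [T [S [Si nf]]]]] := normal_form_exists k0 L0 cg ig g0.
rewrite -[r]invrK; apply/(nf_ball_free k0 g0 nf).
have T1 := nf_lip1 k0 g0 nf Hk.
have [cu _ _ SiK [gh TS _ _ _]] := nf.
apply: (ball_sep cu T1) => s t hd.
have d := nf_double_critical k0 g0 nf hd.
have : (MDC g <= (enorm (g (Si s) - g (Si t)))%:E)%E.
  by apply: ereal_inf_lbound; exists (g (Si s), g (Si t)).
move=> /(le_trans rM); rewrite -EFinM lee_fin !gh !SiK invrK -scalerBr enormZ gtr0_norm //.
by rewrite mulrC ler_pM2l.
Qed.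

End Radii.

(** * Perturbed curves *)

(** By [unitv_dist], passing to directions divides slopes by [|P|] to first
    order; [slope_le] integrates the result. *)
Lemma unit_slope {R : realType} {n : nat} (P : R -> 'rV[R]_n) (w : R -> R) (k : R) :
  vLip P -> (forall s, P s != 0) -> continuous w -> (forall s, 0 < w s) -> 0 < k ->
  (forall s e, 0 < e -> exists2 d, 0 < d & forall t, `|t - s| < d ->
     enorm (P t - P s) <= (k * w s * enorm (P s) ^+ 2 + e) * `|t - s|) ->
  forall a b, enorm (unitv (P a) - unitv (P b)) <= k * `|itg (fun s => w s * enorm (P s)) a b|.
Proof.
move=> LP P0 cw w0 k0 HP; set f := fun s => w s * enorm (P s).
have cP : continuous (fun s => enorm (P s)) by apply: vcont_enorm; exact: vLip_vcont.
have cf : continuous f by exact: contM.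
have D (s : R) : is_derive s 1 (fun s => k * prim f s) (k * f s) by apply: derZ; exact: der_prim.
have slope s e : 0 < e -> exists2 d, 0 < d & forall t, `|t - s| < d ->
    enorm (unitv (P t) - unitv (P s)) <= (k * f s + e) * `|t - s|.
  move=> e0; have p0 := enorm_gt0 (P0 s); set p := enorm (P s) in p0.
  set c := k * f s; have c0 : 0 < c by rewrite /c /f !mulr_gt0.
  pose q := ((c + e / 2) / (c + e)) ^+ 2.
  have ce : 0 < c + e by lra.
  have q1 : q < 1.
    by rewrite /q -[X in _ < X](expr1n _ 2) ltr_pXn2r ?nnegrE // ?ltr_pdivrMr ?divr_ge0 //; lra.
  have ep : 0 < e * p / 2 by rewrite divr_gt0 // mulr_gt0.
  have pq : 0 < p * (1 - q) by rewrite mulr_gt0 // subr_gt0.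
  have [d1 d10 H1] := HP s _ ep.
  have [d2 d20 H2] := cont_ed cP s pq.
  exists (Num.min d1 d2); first by rewrite lt_min d10.
  move=> t; rewrite lt_min => /andP[/H1 {}H1 /H2]; rewrite -/p ltr_norml => /andP[H2' _].
  have Pt : p * q <= enorm (P t) by lra.
  have {}H1 : enorm (P t - P s) <= p * (c + e / 2) * `|t - s|.
    by rewrite [X in X * _](_ : _ = k * w s * p ^+ 2 + e * p / 2) // /c /f -/p; ring.
  have := unitv_dist (P0 t) (P0 s); rewrite -/p => H3.
  have ce0 : 0 <= (c + e) * `|t - s| by rewrite mulr_ge0 // ltW.
  rewrite -(@ler_pXn2r _ 2) // ?nnegrE ?enorm_ge0 //.
  have pt : 0 < enorm (P t) * p by rewrite mulr_gt0 // enorm_gt0.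
  rewrite -(ler_pM2r pt); apply: le_trans H3 _.
  have {}H1 : enorm (P t - P s) ^+ 2 <= (p * (c + e / 2) * `|t - s|) ^+ 2.
    by rewrite ler_pXn2r ?nnegrE ?enorm_ge0 // !mulr_ge0 //; lra.
  apply: le_trans H1 _.
  have -> : (p * (c + e / 2) * `|t - s|) ^+ 2 = ((c + e) * `|t - s|) ^+ 2 * (p * q * p).
    by rewrite /q; field; rewrite gt_eqF.
  by rewrite ler_wpM2l ?sqr_ge0 // ler_wpM2r // ltW.
move=> a b; wlog ab : a b / a <= b.
  move=> H; have [ab|/ltW ba] := leP a b; first exact: H.
  by rewrite enormB itg_opp normrN; exact: H.
rewrite enormB; apply: le_trans (slope_le ab D slope) _.
by rewrite -mulrBr ler_wpM2l ?(ltW k0) // ler_norm.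
Qed.

Section Perturbation.
Context {R : realType} {n : nat}.
Notation V := 'rV[R]_n.
Variables (k L : R) (g : R -> V) (l : R) (h T : R -> V) (S Si : R -> R).
Hypotheses (k0 : 0 < k) (L0 : 0 < L) (sg : simple_C11 L g).
Hypothesis nf : normal_form k L g l h T S Si.
Variables (G gam : R -> V).
Hypotheses (Dgam : forall s, vder gam s (G s)) (pgam : periodic gam l).
Hypotheses (LG : vLip G) (G0 : forall s, G s != 0).
Implicit Types (s t a b : R).

Let cg : C1_loop L g. Proof. by case: sg. Qed.
Let g0 : forall t, derive1 g t != 0. Proof. by case: sg. Qed.
Let l0 : 0 < l. Proof. by case: nf => -[]. Qed.
Let DS t : is_derive t 1 S (k * enorm (derive1 g t)). Proof. by case: nf. Qed.
Let SK : cancel S Si. Proof. by case: nf. Qed.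
Let SL t : S (t + L) = S t + l. Proof. by case: nf => _ _ _ _ []. Qed.
Let TS t : T (S t) = utan g t. Proof. by case: nf => _ _ _ _ []. Qed.
Let gh t : g t = k^-1 *: h (S t). Proof. by case: nf => _ _ _ _ []. Qed.
Let cv : continuous (fun t => enorm (derive1 g t)). Proof. exact: speed_cont cg. Qed.
Let cG : continuous (fun s => enorm (G s)). Proof. by apply: vcont_enorm; exact: vLip_vcont. Qed.
Let pG : periodic G l. Proof. exact: der_periodic Dgam pgam. Qed.
Let cS : continuous S. Proof. by move=> t; exact: der_cont (DS t). Qed.

(** The curve [gam], scaled back and followed with the parameter of [g]. *)
Definition pull t := k^-1 *: gam (S t).

Lemma pull_vder t : vder pull t (enorm (derive1 g t) *: G (S t)).
Proof.
apply: (vder_eq (vderZ k^-1 (vder_comp (Dgam (S t)) (DS t)))).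
by rewrite scalerA mulrA mulVf ?mul1r // gt_eqF.
Qed.

Lemma pull_der : derive1 pull = fun t => enorm (derive1 g t) *: G (S t).
Proof. by apply/funext => t; case: (vder_derivable (pull_vder t)). Qed.

Lemma pull_der_neq0 t : derive1 pull t != 0.
Proof. by rewrite pull_der scaler_eq0 negb_or G0 andbT gt_eqF // enorm_gt0. Qed.

Lemma SLz t (j : int) : S (t + j%:~R * L) = S t + j%:~R * l.
Proof.
have pf : periodic (fun t => S t - t * (l / L)) L.
  by move=> x /=; rewrite SL; field; rewrite gt_eqF.
have := periodicz j t pf => /=; have E : L * (l / L) = l by field; rewrite gt_eqF.
by rewrite mulrDl -mulrA E; lra.
Qed.

Lemma pull_injective (f : R -> V) : injective_mod l f -> injective_mod L (fun t => k^-1 *: f (S t)).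
Proof.
have kn0 : k^-1 != 0 by rewrite invr_eq0 gt_eqF.
move=> inj s t /(scalerI kn0) /inj [j E]; exists j.
by apply: (can_inj SK); rewrite SLz.
Qed.

Lemma speed_le : exists2 M, 0 < M & forall t, enorm (derive1 g t) <= M.
Proof.
apply: (periodic_le L0 cv) => t; last exact: enorm_gt0.
by rewrite (C1_loop_der_per cg).
Qed.

Lemma pull_simple : injective_mod l gam -> simple_C11 L pull.
Proof.
move=> inj; have [M M0 HM] := speed_le.
have vG : vbdd G.
  have [B B0 HB] := periodic_le l0 cG (fun s => congr1 enorm (pG s)) (fun s => enorm_gt0 (G0 s)).
  by exists B.
have LS : Lip S.
  have H a b : a <= b -> `|S b - S a| <= k * M * (b - a).
    move=> ab; have D1 x : a <= x <= b -> is_derive x 1 (fun x : R => k * M * x) (k * M).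
      by move=> _; apply: (der_eq (derZ (k * M) (der_id x))); rewrite mulr1.
    have D0 x : a <= x <= b -> is_derive x 1 (fun x : R => 0 : R) 0 by move=> _; exact: der_cst.
    have D2 x : a <= x <= b -> is_derive x 1 S (k * enorm (derive1 g x)) by move=> _; exact: DS.
    have h1 := der_le ab D2 D1 (fun x _ => ler_wpM2l (ltW k0) (HM x)).
    have h2 := der_le ab D0 D2 (fun x _ => mulr_ge0 (ltW k0) (enorm_ge0 _)).
    by rewrite ger0_norm; lra.
  exists (k * M) => s t; have [st|/ltW st] := leP s t.
    by rewrite distrC [`|s - t|]distrC (ger0_norm (_ : 0 <= t - s)) ?subr_ge0 // H.
  by rewrite (ger0_norm (_ : 0 <= s - t)) ?subr_ge0 // H.
have Lp : vLip (derive1 pull).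
  rewrite pull_der; apply: vLip_scale.
  - have [_ _ _ /lipschitz_vLip [C HC]] := sg; exists C => s t.
    have h1 := enorm_sub_ge (derive1 g s) (derive1 g t).
    have h2 := enorm_sub_ge (derive1 g t) (derive1 g s); rewrite (enormB (derive1 g t)) in h2.
    apply: le_trans _ (HC s t); rewrite ler_norml h1 andbT.
    by rewrite -subr_ge0 opprK addrC; move: h2; rewrite -subr_ge0 opprB addrA addrAC.
  - by exists M => s; rewrite ger0_norm ?enorm_ge0.
  - have [A HA] := LG; have [B HB] := LS; exists (`|A| * B) => s t.
    apply: le_trans (HA _ _) _; apply: (@le_trans _ _ (`|A| * `|S s - S t|)).
      by rewrite ler_wpM2r // ler_norm.
    by rewrite -mulrA ler_wpM2l.
  - by have [B HB] := vG; exists B.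
split.
- split.
  + by move=> t; rewrite /pull SL pgam.
  + by move=> t; case: (vder_derivable (pull_vder t)).
  + by apply: vcont_continuous; exact: vLip_vcont.
- exact: pull_injective.
- exact: pull_der_neq0.
- exact/lipschitz_vLip.
Qed.

Lemma pull_arc a b : arc_length pull a b = k^-1 * `|itg (fun s => enorm (G s)) (S a) (S b)|.
Proof.
pose f t := enorm (derive1 g t) * enorm (G (S t)).
have Ef t : enorm (derive1 pull t) = f t by rewrite pull_der enormZ ger0_norm ?enorm_ge0.
have cf : continuous f.
  by apply: contM => //; move=> t; apply: (@continuous_comp _ _ _ S (fun s => enorm (G s))); [exact: cS|exact: cG].
rewrite arc_lengthE; last by under eq_fun do rewrite Ef.
under eq_fun do rewrite Ef.
have D (t : R) : is_derive t 1 (fun t => k^-1 * prim (fun s => enorm (G s)) (S t)) (f t).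
  apply: (der_eq (derZ k^-1 (der_comp (der_prim (S t) cG) (DS t)))).
  by rewrite /f; field; rewrite gt_eqF.
rewrite (itgE a b cf D) -mulrBr normrM gtr0_norm ?invr_gt0 //.
Qed.

Lemma pull_length : loop_length L pull = k^-1 * itg (fun s => enorm (G s)) 0 l.
Proof.
have pE : periodic (fun s => enorm (G s)) l by move=> s; rewrite pG.
rewrite /loop_length pull_arc -{1}[L]add0r SL (itg_period _ 0 cG pE) add0r ger0_norm //.
by apply: itg_ge0 => //; [exact: ltW|move=> s _; exact: enorm_ge0].
Qed.

Lemma pull_near (e1 e2 M : R) t : (forall s, enorm (gam s - h s) <= e1) ->
  (forall s, enorm (G s - T s) <= e2) -> (forall t, enorm (derive1 g t) <= M) ->
  enorm (pull t - g t) <= k^-1 * e1 /\ enorm (derive1 pull t - derive1 g t) <= M * e2.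
Proof.
move=> H1 H2 HM; split.
  by rewrite gh /pull -scalerBr enormZ ger0_norm ?invr_ge0 ?(ltW k0) // ler_wpM2l // invr_ge0 ltW.
rewrite pull_der [X in _ - X](unitvE (g0 t)) -/(utan g t) -TS -scalerBr enormZ.
by rewrite ger0_norm ?enorm_ge0 //; apply: ler_pM; rewrite ?enorm_ge0.
Qed.

(** [ball_sep] for the curve [pull] scaled by [k * c]: the slope hypothesis makes
    its unit tangent 1-Lipschitz, and as [1 <= c] its double critical pairs are
    at distance at least 2. *)
Lemma pull_ball_free c : 1 <= c -> injective_mod l gam ->
  (forall s t, enorm (unitv (G s) - unitv (G t)) <= c * `|itg (fun s => enorm (G s)) s t|) ->
  (forall s t, dcp gam G s t -> 2 <= enorm (gam s - gam t)) ->
  ball_free pull (k * c)^-1.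
Proof.
move=> c1 inj Hs Hd; have [cp ip p0 _] := pull_simple inj.
have c0 : 0 < c by lra.
have kc : 0 < k * c by rewrite mulr_gt0.
have [l' [h' [T' [S' [Si' nf']]]]] := normal_form_exists kc L0 cp ip p0.
apply/(nf_ball_free kc p0 nf').
have [cu _ _ SiK' [gh' TS' _ _ [_ al']]] := nf'.
have uE t : T' (S' t) = unitv (G (S t)).
  by rewrite TS' /utan pull_der unitvZ // enorm_gt0.
apply: (ball_sep cu).
  move=> s t; rewrite -(SiK' s) -(SiK' t) -al' !uE pull_arc; apply: le_trans (Hs _ _) _.
  by rewrite mulrA [k * c * _](_ : _ = c) //; field; rewrite gt_eqF.
move=> s t; rewrite -(SiK' s) -(SiK' t); move: (Si' s) (Si' t) => {}s {}t [hst ds dt].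
have gE : h' (S' s) - h' (S' t) = c *: (gam (S s) - gam (S t)).
  have E x : h' (S' x) = c *: gam (S x).
    have := gh' x; rewrite /pull => /(congr1 (fun y => (k * c) *: y)).
    rewrite !scalerA mulfV ?gt_eqF // scale1r => <-; congr (_ *: _).
    by field; rewrite gt_eqF.
  by rewrite !E scalerBr.
have normal x : dot (h' (S' s) - h' (S' t)) (T' (S' x)) = 0 ->
    dot (gam (S s) - gam (S t)) (G (S x)) = 0.
  rewrite gE uE (dotZl c) => /eqP; rewrite mulf_eq0 gt_eqF //= => /eqP h1.
  by rewrite (unitvE (G0 (S x))) dotZr h1 mulr0.
have h2 : 2 <= enorm (gam (S s) - gam (S t)).
  apply: Hd; split; [|exact: normal|exact: normal].
  by move: hst; rewrite -subr_eq0 gE scaler_eq0 gt_eqF //= subr_eq0.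
rewrite gE enormZ gtr0_norm //; apply: le_trans h2 _.
by rewrite ler_peMl // enorm_ge0.
Qed.

(** The straight-line homotopy. *)
Lemma pull_knot_class :
  (forall x : R, 0 <= x <= 1 -> injective_mod l (fun s => (1 - x) *: h s + x *: gam s)) ->
  knot_class L g pull.
Proof.
move=> inj.
have [[_ us ph _] _ _ _ _] := nf.
have ch : continuous (fun t => h (S t)).
  move=> t; apply: (@continuous_comp _ _ _ S h); first exact: cS.
  by apply: vcont_continuous; exact: (vder_vcont us.1).
have cgam : continuous (fun t => gam (S t)).
  move=> t; apply: (@continuous_comp _ _ _ S gam); first exact: cS.
  by apply: vcont_continuous; exact: (vder_vcont Dgam).
pose H (x t : R) : V := k^-1 *: ((1 - x) *: h (S t) + x *: gam (S t)).
have cH : continuous (fun p : R * R => H p.1 p.2).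
  move=> p; apply: cvgZr; apply: cvgD; apply: cvgZ.
  - by apply: cvgB; [exact: cvg_cst|exact: cvg_fst].
  - by apply: (@continuous_comp _ _ _ snd (fun t => h (S t))); [exact: cvg_snd|exact: ch].
  - exact: cvg_fst.
  - by apply: (@continuous_comp _ _ _ snd (fun t => gam (S t))); [exact: cvg_snd|exact: cgam].
exists H; split.
- exact: continuous_subspaceT.
- move=> x x01; split.
  + by move=> t; rewrite /H SL ph pgam.
  + by move=> t; apply: cvgZr; apply: cvgD; apply: cvgZr; [exact: ch|exact: cgam].
  + exact: (pull_injective (inj x x01)).
- by apply/funext => t; rewrite /H subr0 scale1r scale0r addr0 gh.
- by apply/funext => t; rewrite /H subrr scale0r scale1r add0r.
Qed.

End Perturbation.

(** * Relatively extremal knots *)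

Section Extremal.
Context {R : realType} {n : nat}.
Notation V := 'rV[R]_n.
Implicit Types (k L l s t : R) (g h T : R -> V).

(** The competitor is followed with the parameter of [g]. By [nearby_curve] the
    straight-line homotopy to it stays among embeddings and its double critical
    pairs stay far apart, so that its ball radius is at least [(k * c)^-1] and
    the comparison of ropelengths reads as the inequality of [no_gain]. *)
Lemma extremal_no_gain k L g l h T S Si : 0 < k -> 0 < L -> relatively_extremal L g ->
  normal_form k L g l h T S Si -> lip1 T -> ball_radius g = (k^-1)%:E ->
  (forall s t, dcp h T s t -> 2 < enorm (h s - h t)) -> no_gain l T.
Proof.
move=> k0 L0 [sg [U [[UC Uo] Ug Umin]]] nf T1 rb hd.
have [cu DS SK SiK [gh TS SL ll _]] := nf; have [l0 us ph ih] := cu.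
have [en en0 Hen] := nearby_curve cu T1 hd.
have [eU eU0 HeU] := Uo g Ug.
have [M M0 HM] := speed_le L0 sg.
have pT : periodic T l by exact: der_periodic us.1 ph.
have q1 : 0 < en / (l + 1) by rewrite divr_gt0 //; lra.
have q2 : 0 < eU * k / (2 * l) by rewrite divr_gt0 // mulr_gt0.
have q3 : 0 < eU / (2 * M) by rewrite divr_gt0 // mulr_gt0.
exists (Num.min (en / (l + 1)) (Num.min (eU * k / (2 * l)) (eU / (2 * M)))).
  by rewrite !lt_min q1 q2.
move=> P w c [pP pw LP Lw] w0 P0 c1 He0 iG Hslope.
set e0 := Num.min _ _ in He0.
have e0' : 0 <= e0 by rewrite !le_min !ltW.
have b1 : e0 * l + e0 <= en.
  rewrite -[X in _ + X]mulr1 -mulrDr -ler_pdivlMr; last by lra.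
  by rewrite ge_min lexx.
have b2 : k^-1 * (e0 * l) < eU.
  have : e0 <= eU * k / (2 * l) by rewrite !ge_min lexx orbT.
  rewrite ler_pdivlMr ?mulr_gt0 // => h1.
  by rewrite mulrC ltr_pdivrMr //; have := mulr_gt0 eU0 k0; lra.
have b3 : M * e0 < eU.
  have : e0 <= eU / (2 * M) by rewrite !ge_min lexx !orbT.
  by rewrite ler_pdivlMr ?mulr_gt0 // => h1; lra.
have b4 : 0 <= e0 * l by rewrite mulr_ge0 // ltW.
pose G s := w s *: P s.
have G0 s : G s != 0 by rewrite /G scaler_eq0 negb_or P0 gt_eqF.
have LG : vLip G.
  have cP := vcont_enorm (vLip_vcont LP); have cw := Lip_cont Lw.
  have [B1 B10 HB1] := periodic_le l0 cw pw w0.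
  have [B2 B20 HB2] := periodic_le l0 cP (fun s => congr1 enorm (pP s)) (fun s => enorm_gt0 (P0 s)).
  apply: vLip_scale => //; last by exists B2.
  by exists B1 => s; rewrite gtr0_norm.
have cG := vLip_vcont LG.
have pG : periodic G l by move=> s; rewrite /G pw pP.
pose gam s := h 0 + vitg G 0 s.
have Dgam s : vder gam s (G s).
  by apply: (vder_eq (vderD (vder_cst (h 0) s) (vder_vitg 0 s cG))); rewrite add0r.
have pgam : periodic gam l.
  have D s : vder (fun s => gam (s + l) - gam s) s 0.
    apply: (vder_eq (vderB (vder_shift (Dgam (s + l))) (Dgam s))).
    by rewrite pG subrr.
  have F0 : gam (0 + l) - gam 0 = 0 by rewrite /gam add0r iG vitg_xx subrr.
  move=> s; apply/eqP; rewrite -subr_eq0; apply/eqP; rewrite -F0.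
  have [s0|/ltW s0] := leP s 0.
    by apply: (@vder0_const _ _ (fun s => gam (s + l) - gam s)) => // x _.
  by apply/esym; apply: (@vder0_const _ _ (fun s => gam (s + l) - gam s)) => // x _.
have near s : enorm (gam s - h s) <= e0 * l.
  have [j /andP[j0 j1]] := mod_shift 0 s l0.
  rewrite -(periodicz j s ph) -(periodicz j s pgam); move: (s + j%:~R * l) j0 j1 => x.
  rewrite subr0 => x0 xl.
  have D y : vder (fun y => gam y - h y) y (G y - T y) by apply: vderB; [exact: Dgam|exact: us.1].
  have := vder_lip D He0 x 0; rewrite /gam vitg_xx addr0 subrr !subr0 ger0_norm // => h1.
  by apply: le_trans h1 _; rewrite ler_wpM2l // ltW.
have mix x : 0 <= x <= 1 -> injective_mod l (fun s => (1 - x) *: h s + x *: gam s) /\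
    forall s t, dcp (fun s => (1 - x) *: h s + x *: gam s) (fun s => (1 - x) *: T s + x *: G s) s t ->
    2 <= enorm (((1 - x) *: h s + x *: gam s) - ((1 - x) *: h t + x *: gam t)).
  move=> /andP[x0 x1].
  have E (u v : V) : (1 - x) *: u + x *: v - u = x *: (v - u).
    by rewrite scalerBl scale1r scalerBr addrAC [u - _]addrC addrK addrC.
  apply: Hen.
  - by move=> s; apply: vderD; apply: vderZ; [exact: us.1|exact: Dgam].
  - by move=> s; rewrite ph pgam.
  - move=> s; rewrite E enormZ ger0_norm //.
    have h1 := ler_pM x0 (enorm_ge0 _) x1 (near s); rewrite mul1r in h1.
    by apply: le_trans h1 _; lra.
  - move=> s; rewrite E enormZ ger0_norm //.
    have h1 := ler_pM x0 (enorm_ge0 _) x1 (He0 s); rewrite mul1r in h1.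
    by apply: le_trans h1 _; lra.
have [|ig hd2] := mix 1; first by rewrite ler01 lexx.
have E1 (F H : R -> V) : (fun s => (1 - 1 : R) *: F s + (1 : R) *: H s) = H.
  by apply/funext => s; rewrite subrr scale0r scale1r add0r.
rewrite !E1 in ig hd2.
have c0 : 0 < c by lra.
have EG s : enorm (G s) = w s * enorm (P s) by rewrite /G enormZ gtr0_norm.
have EGf : (fun s => enorm (G s)) = (fun s => w s * enorm (P s)) by apply/funext.
have slope s t : enorm (unitv (G s) - unitv (G t)) <= c * `|itg (fun s => enorm (G s)) s t|.
  rewrite EGf /G !unitvZ //; apply: unit_slope => //; exact: Lip_cont.
have bf : ball_free (pull k S gam) (k * c)^-1.
  apply: (pull_ball_free k0 L0 sg nf Dgam pgam LG G0 c1 ig slope) => s t /hd2.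
  by rewrite subrr !scale0r !add0r !scale1r.
have sp : simple_C11 L (pull k S gam) by exact: (pull_simple k0 L0 sg nf Dgam pgam LG G0 ig).
have kc : 0 < k * c by rewrite mulr_gt0.
have in_class : (U `&` knot_class L g `&` simple_C11 L) (pull k S gam).
  split=> //; split; last first.
    by apply: (pull_knot_class k0 L0 nf Dgam pgam) => x x01; exact: (mix x x01).1.
  apply: HeU; first by case: sp.
  move=> t; have [h1 h2] := pull_near k0 sg nf Dgam t near He0 HM.
  by split; [exact: le_lt_trans h1 b2|exact: le_lt_trans h2 b3].
have ki : 0 < k^-1 by rewrite invr_gt0.
have RL : ropelength L g = l%:E.
  by rewrite /ropelength rb inver (gt_eqF ki) invrK -(EFinM (loop_length L g)) mulrC -ll.
have := Umin _ in_class; rewrite RL /ropelength (pull_length k0 sg nf Dgam pgam LG) EGf.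
set I := itg _ 0 l.
have I0 : 0 <= I.
  apply: itg_ge0; [|exact: ltW|].
    by apply: contM; [exact: Lip_cont|apply: vcont_enorm; exact: vLip_vcont].
  by move=> s _; rewrite mulr_ge0 ?enorm_ge0 // ltW.
have rb2 := ball_free_radius bf.
have rb3 : ((ball_radius (pull k S gam))^-1 <= (k * c)%:E)%E.
  have kc1 : (0 <= ((k * c)^-1)%:E)%E by rewrite lee_fin invr_ge0 ltW.
  have kci : 0 < (k * c)^-1 by rewrite invr_gt0.
  have -> : (k * c)%:E = (((k * c)^-1)%:E^-1)%E by rewrite inver (gt_eqF kci) invrK.
  by rewrite lee_pV2 // inE //=; exact: le_trans kc1 rb2.
have kI : (0 <= (k^-1 * I)%:E)%E by rewrite lee_fin mulr_ge0 // invr_ge0 ltW.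
move=> /le_trans/(_ (lee_wpmul2l kI rb3)); rewrite -(EFinM (k^-1 * I)) lee_fin.
by rewrite [X in _ <= X](_ : _ = c * I) //; field; rewrite gt_eqF.
Qed.

(** An arc of curvature less than [k] would be an arc of slack, against
    [no_slack]. *)
Lemma extremal_curvature k L g s0 : 0 < k -> 0 < L -> relatively_extremal L g ->
  ball_radius g = (k^-1)%:E -> (forall s, (curvature g s <= k%:E)%E) ->
  ((k^-1)%:E < (2^-1)%:E * MDC g)%E -> (curvature g s0 < k%:E)%E -> False.
Proof.
move=> k0 L0 ex rb Hk kM slack; have [[cg ig g0 _] _] := ex.
have [l [h [T [S [Si nf]]]]] := normal_form_exists k0 L0 cg ig g0.
have T1 := nf_lip1 k0 g0 nf Hk.
have [cu _ _ SiK [gh TS _ _ _]] := nf.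
have hd s t : dcp h T s t -> 2 < enorm (h s - h t).
  move=> /(nf_double_critical k0 g0 nf) d; move: kM; rewrite lte_pdivlMl // => kM.
  have : (MDC g <= (enorm (g (Si s) - g (Si t)))%:E)%E.
    by apply: ereal_inf_lbound; exists (g (Si s), g (Si t)).
  move=> /(lt_le_trans kM); rewrite -EFinM lte_fin !gh !SiK -scalerBr enormZ.
  by rewrite gtr0_norm ?invr_gt0 // mulrC ltr_pM2l // invr_gt0.
have [r [eta [r0 eta0 H]]] := nf_slack k0 g0 nf slack.
apply: (no_slack cu T1 _ r0 eta0 H); exact: extremal_no_gain nf T1 rb hd.
Qed.

End Extremal.

Theorem theorem3 (R : realType) (n : nat) (hn : (2 <= n)%N) (L : R) (hL : 0 < L)
    (g : R -> 'rV[R]_n) (hg : relatively_extremal L g) :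
  (~ (forall s : R, curvature g s = ((ball_radius g)^-1)%E) ->
     thickness g = ((2^-1)%:E * MDC g)%E) /\
  ((ball_radius g < (2^-1)%:E * MDC g)%E ->
     ball_radius g = focal_distance g ->
     forall s : R, curvature g s = ((focal_distance g)^-1)%E).
Proof.
have sg : simple_C11 L g by case: hg.
have g0 : forall s, derive1 g s != 0 by case: sg.
have [M HM] := curvature_bounded hL sg.
have kge s : (0 <= curvature g s)%E by exact: curvature_ge0 sg.
pose K := ereal_sup (range (curvature g)).
have Kub s : (curvature g s <= K)%E by apply: ereal_sup_ubound; exists s.
have K0 : (0 <= K)%E := le_trans (kge 0) (Kub 0).
have KM : (K <= M%:E)%E by apply: ge_ereal_sup => _ [s _ <-].
have [k Kk] : exists k : R, K = k%:E.
  by case: (K) K0 KM => [k| |] //; exists k.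
have k0 : 0 <= k by rewrite Kk lee_fin in K0.
have F : focal_distance g = (k%:E^-1)%E by rewrite /focal_distance -/K Kk.
have Fpos : (focal_distance g < (2^-1)%:E * MDC g)%E -> 0 < k /\ focal_distance g = (k^-1)%:E.
  rewrite F; have [->|kn] := eqVneq k 0.
    by rewrite inve0 ltNge leey.
  by move=> _; rewrite lt_neqAle eq_sym kn k0 inver (negPf kn).
have conj2 : (focal_distance g < (2^-1)%:E * MDC g)%E -> ball_radius g = focal_distance g ->
    forall s : R, curvature g s = ((focal_distance g)^-1)%E.
  move=> FM RF s; have [kp Fk] := Fpos FM; rewrite F inveK.
  apply/eqP; rewrite eq_le -{1}Kk Kub /= leNgt; apply/negP.
  by apply: (extremal_curvature kp hL hg); rewrite ?RF -?Fk // => x; rewrite -Kk.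
split; last by move=> RM RF; apply: conj2 => //; rewrite -RF.
move=> notk; apply/eqP; rewrite eq_le thickness_le_MDC /=.
(* A radius bounded by both the focal distance and half the distance of the
   double critical pairs. *)
have bf r : 0 < r -> (r%:E <= (2^-1)%:E * MDC g)%E -> (r%:E <= focal_distance g)%E -> ball_free g r.
  move=> r0 rM rF; apply: (curvature_MDC_ball_free hL sg r0 _ rM) => s.
  apply: le_trans (Kub s) _; rewrite Kk lee_fin.
  have [->|kn] := eqVneq k 0; first by rewrite invr_ge0 ltW.
  have kp : 0 < k by rewrite lt_neqAle eq_sym kn.
  move: rF; rewrite F inver (negPf kn) lee_fin => rF.
  by rewrite -[k]invrK lef_pV2 // posrE // invr_gt0.
have [MF|FM] := leP ((2^-1)%:E * MDC g)%E (focal_distance g).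
  have M0 := MDC_ge0 g; have bt r : 0 < r -> (r%:E <= (2^-1)%:E * MDC g)%E -> (r%:E <= thickness g)%E.
    by move=> r0 rM; apply: ball_free_thickness => //; apply: bf => //; exact: le_trans rM MF.
  have t0 : (0 <= thickness g)%E by apply: ereal_sup_ubound; left.
  case: ((2^-1)%:E * MDC g)%E M0 bt => [r| |] // M0 bt.
    have [->//|rn] := eqVneq r 0; apply: bt => //.
    by rewrite lt_neqAle eq_sym rn; rewrite lee_fin in M0.
  have [t E] : exists t, thickness g = t%:E \/ thickness g = +oo%E.
    by case: (thickness g) t0 => [t| |] // _; [exists t; left|exists 0; right].
  case: E => E; last by rewrite E.
  have t1 : 0 < `|t| + 1 by rewrite ltr_wpDl.
  have := bt _ t1 (leey _); rewrite E lee_fin leNgt.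
  by rewrite (le_lt_trans (ler_norm t)) // ltrDl.
have [kp Fk] := Fpos FM; have ki : 0 < k^-1 by rewrite invr_gt0.
case: notk => s; suff RF : ball_radius g = focal_distance g by rewrite RF; exact: conj2.
apply/eqP; rewrite eq_le; apply/andP; split; last first.
  by rewrite Fk; apply: ball_free_radius; apply: bf; rewrite -?Fk // ltW.
rewrite Fk leNgt; apply/negP => lt.
have [r [kr rb]] : exists r, k^-1 < r /\ (r%:E < ball_radius g)%E.
  case: (ball_radius g) lt => [b| |] //.
    by rewrite lte_fin => kb; exists ((k^-1 + b) / 2); rewrite lte_fin; split; lra.
  by move=> _; exists (k^-1 + 1); rewrite ltrDl ltr01 ltry.
have r0 : 0 < r by exact: lt_trans kr.
(* Tangent balls of radius [r] would bound the curvature by [r^-1], which is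
   less than its supremum [k]. *)
have rbf := radius_ball_free g0 rb.
have [cg ig _ _] := sg; have ri : 0 < r^-1 by rewrite invr_gt0.
have [l [h [T [S [Si nf]]]]] := normal_form_exists ri hL cg ig g0.
have cT : vcont T.
  have [_ _ _ SiK [_ TS _ _ [cSi _]]] := nf.
  have -> : T = fun s => unitv (derive1 g (Si s)) by apply/funext => x; rewrite -{1}(SiK x) TS.
  have cd : vcont (derive1 g) by apply: continuous_vcont; case: cg.
  apply: (@vcont_comp _ _ _ _ (fun t => unitv (derive1 g t)) Si cSi).
  apply: vcontZ => // x; apply: cvgV; first by rewrite gt_eqF // enorm_gt0.
  exact: (speed_cont cg).
have /(nf_ball_free ri g0 nf) ub : ball_free g (r^-1)^-1 by rewrite invrK.
have : (K <= (r^-1)%:E)%E.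
  by apply: ge_ereal_sup => _ [x _ <-]; exact: (ball_curvature ri g0 nf ub cT).
rewrite Kk lee_fin -[k]invrK lef_pV2 ?posrE // => h1.
by have := lt_le_trans kr h1; rewrite ltxx.
Qed.
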